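(* Let $p=q=2$, $\mathcal X=\{x\in\mathbb R^d:\|x\|_2\le1\}$ and $\psi(x)=\|x\|_2^2/2$. Suppose all loss functions $f_1,\dots,f_T$ are $G$-Lipschitz on $\mathcal X$ with respect to the $\ell_2$-norm: $|f_t(x)-f_t(y)|\le G\|x-y\|_2$ for all $x,y\in\mathcal X$, $t=1,\dots,T$. Run the algorithm PBMD (described in the context) with the parameters $$\mu=\min\Big\{\frac{R\sqrt d}{\sqrt{\lambda T}\,c_\mu},\ \frac r2\Big\},\qquad \alpha=\frac{\mu}{r},\qquad \gamma=\frac{1}{\sqrt{48}(1+\sqrt2)RG\sqrt{dT}},$$ $$N=\Big\lceil\tfrac12\log_2\Big(1+\frac{2RG_\psi^\alpha T}{A_\psi^\alpha}\Big)\Big\rceil+1,\qquad \eta_{(k)}=2^{k-1}\sqrt{\frac{A_\psi^\alpha}{6(1+\sqrt2)^2G^2dT/\lambda}},\quad k=1,\dots,N,$$ where $r,R,\lambda,c_\mu,G_\psi^\alpha,A_\psi^\alpha$ are defined in the context. Then for every comparator sequence $u^1,\dots,u^T\in\mathcal X$, with $\mathcal P_{T,2}=\sum_{t=1}^{T-1}\|u^{t+1}-u^t\|_2$, the expected dynamic regret of PBMD satisfies $$\mathbb E\Big[\sum_{t=1}^T\Big(\frac{f_t(x^{t,+})+f_t(x^{t,-})}{2}-f_t(u^t)\Big)\Big]=\mathcal O\Big(G\sqrt{dT(1+\mathcal P_{T,2})}\Big),$$ where the expectation is taken with respect to all the randomness $s^1,\dots,s^T$. Here $\mathcal O(\cdot)$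 treats $A_\psi^\alpha$ as a constant and hides no dependence on $d$, $T$, $G$, the losses or the comparators.
   Context: Setting: $d\ge3$, and $T$ is the number of iterations. At each iteration $t$ an adversary selects a convex loss function $f_t$ on $\mathbb R^d$, unknown to the learner; the learner chooses two points $x^{t,+},x^{t,-}\in\mathcal X$ and observes only $f_t(x^{t,+})$ and $f_t(x^{t,-})$. The comparator sequence is not known to the learner. Notation: $\log$ is the natural logarithm; $\mathbb B_2^d=\{x\in\mathbb R^d:\|x\|_2\le1\}$; $\partial\mathbb B_1^d=\{x\in\mathbb R^d:\|x\|_1=1\}$; $\operatorname{sign}$ acts componentwise with $\operatorname{sign}(0)=1$; $\mathcal X_\alpha=(1-\alpha)\mathcal X=\{(1-\alpha)x:x\in\mathcal X\}$; the Bregman divergence is $B_\psi(x;y)=\psi(x)-\psi(y)-\langle\nabla\psi(y),x-y\rangle$. Constants: $r,R>0$ are radii with $r\mathbb B_2^d\subseteq\mathcal X\subseteq R\mathbb B_2^d$ (for instance $r=R=1$); $\lambda=1$ is the strong convexity constant of $\psi$ with respect to the $\ell_2$-norm; $c_\mu=1+2\zeta_2(d)+R/r$, where $\zeta_2(d)=2d^{1/2}/(d+1)$ if $2<\log d$ and $\zeta_2(d)=e\log(d)/(d+1)$ otherwise; $G_\psi^\alpha=\sup_{y\in\mathcal X_\alpha}\|\nabla\psi(y)\|_2$; $F_\psi^\alpha=\sup_{x\in\mathcal X_\alpha}\psi(x)-\inf_{x\in\mathcal X_\alpha}\psi(x)$; and, for the chosen initialization $y^1\in\mathcal X_\alpha$,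 $A_\psi^\alpha$ is any constant satisfying $$A_\psi^\alpha\ \ge\ F_\psi^\alpha+\sup_{v\in\mathcal X_\alpha}B_\psi(v;y^1)+\max\{1,\lambda\}R^2 .$$ Algorithm PBMD (inputs $\mu,\alpha,\gamma>0$, $N$, step sizes $\eta_{(1)},\dots,\eta_{(N)}$). Initialize: pick $y^1\in\mathcal X_\alpha$, set $y_{(k)}^1=y^1$ and $\omega_{(k)}^1=\frac{N+1}{N}\frac{1}{k(k+1)}$ for $k=1,\dots,N$. For $t=1,\dots,T$: set $y^t=\sum_{k=1}^N\omega_{(k)}^ty_{(k)}^t$; draw $s^t$ from the uniform distribution on $\partial\mathbb B_1^d$; play $x^{t,\pm}=y^t\pm\mu s^t$; set $g^t=\frac{d}{2\mu}\big(f_t(x^{t,+})-f_t(x^{t,-})\big)\operatorname{sign}(s^t)$ and $\varphi^t(y)=\langle g^t,y-y^t\rangle$; update $$\omega_{(k)}^{t+1}=\frac{\omega_{(k)}^t\exp(-\gamma\varphi^t(y_{(k)}^t))}{\sum_{j=1}^N\omega_{(j)}^t\exp(-\gamma\varphi^t(y_{(j)}^t))},\qquad y_{(k)}^{t+1}=\operatorname*{argmin}_{y\in\mathcal X_\alpha}\ \langle g^t,y\rangle+\frac1{\eta_{(k)}}B_\psi(y;y_{(k)}^t).$$ *)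

(* Defs.v *)
From HB Require Import structures.
From mathcomp Require Import all_boot all_order all_algebra.
From mathcomp Require Import all_classical all_reals all_analysis.

Set Implicit Arguments.
Unset Strict Implicit.
Unset Printing Implicit Defensive.

Import Order.TTheory GRing.Theory Num.Theory.
Import numFieldNormedType.Exports.

Local Open Scope classical_set_scope.
Local Open Scope ring_scope.

Section Vectors.
Context {R : realType} {d : nat}.
Implicit Types (x y : 'rV[R]_d) (X : set 'rV[R]_d) (psi : 'rV[R]_d -> R).

Definition dot x y : R := \sum_(i < d) x 0 i * y 0 i.

(* The norm `|x| that the library puts on row vectors is the max norm. *)
Definition l2norm x : R := Num.sqrt (dot x x).

Definition l2ball (rho : R) : set 'rV[R]_d := [set x | l2norm x <= rho].

(* sign(0) = 1, unlike Num.sg. *)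
Definition signv x : 'rV[R]_d := \row_i (if 0 <= x 0 i then 1 else -1).

Definition gradient psi y : 'rV[R]_d := \row_i 'D_(delta_mx 0 i) psi y.

Definition bregman psi x y : R := psi x - psi y - dot (gradient psi y) (x - y).

Definition shrink (alpha : R) X : set 'rV[R]_d := [set (1 - alpha) *: x | x in X].

(* Some minimizer of F over X, and 0 if there is none. *)
Definition argmin X (F : 'rV[R]_d -> R) : 'rV[R]_d :=
  xget 0 [set y | X y /\ forall z, X z -> F y <= F z].

End Vectors.

Section UniformL1Sphere.
Context {R : realType}.

(* n-dimensional Lebesgue measure of a Borel set, by slicing (Tonelli). *)
Fixpoint lebesgue_tuple (n : nat) : set (n.-tuple R) -> \bar R :=
  if n is m.+1 then
    fun A => (\int[@lebesgue_measure R]_x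
                lebesgue_tuple [set v : m.-tuple R | A [tuple of x :: v]])%E
  else fun A => \d_[tuple] A.

(* The point of the l1-sphere of R^d (0 < d) whose first d - 1 coordinates are
   z and whose last one is eps * (1 - |z|_1): the default value of nth is taken
   at the single index d - 1 = size z. *)
Definition l1_sphere_graph (d : nat) (eps : R) (z : d.-1.-tuple R) : d.-tuple R :=
  [tuple nth (eps * (1 - \sum_(a <- z) `|a|)) z i | i < d].

(* (d - 1)-dimensional surface measure on the l1-sphere, the union of the
   graphs of z |-> 1 - |z|_1 and z |-> |z|_1 - 1 over the l1-ball of R^(d - 1):
   the area element sqrt (1 + |gradient|_2^2) is equal to sqrt d, and the two
   graphs overlap in a null set only. *)
Definition l1_sphere_area (d : nat) (A : set (d.-tuple R)) : \bar R :=
  (\sum_(eps <- [:: 1; -1]%R) (Num.sqrt d%:R)%:E *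
     lebesgue_tuple [set z : d.-1.-tuple R |
       (\sum_(a <- z) `|a| <= 1)%R /\ A (l1_sphere_graph eps z)])%E.

Definition uniform_l1_sphere (d : nat) (A : set (d.-tuple R)) : \bar R :=
  (fine (l1_sphere_area A) / fine (@l1_sphere_area d setT))%:E.

End UniformL1Sphere.

(* Mutual independence of X 0, ..., X (n - 1). *)
Definition mutually_independent {R : realType} {dO dT : measure_display}
    {Omega : measurableType dO} {V : measurableType dT} (P : probability Omega R)
    (n : nat) (X : nat -> Omega -> V) : Prop :=
  forall (J : {set 'I_n}) (A : 'I_n -> set V),
    (forall t, measurable (A t)) ->
    P (\bigcap_(t in [set` J]) (X t @^-1` A t)) =
    (\prod_(t in J) P (X t @^-1` A t))%E.

(* Rounds and experts are numbered from 0: in this section the index t (resp. k)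
   stands for the round t + 1 (resp. the expert k + 1) of the usual numbering. *)
Section PBMD.
Context {R : realType} {d : nat}.
Variables (psi : 'rV[R]_d -> R) (D : set 'rV[R]_d) (mu gamma : R).
Variables (N : nat) (eta : nat -> R) (y1 : 'rV[R]_d).

(* Weights and positions of the N experts. *)
Definition pbmd_state : Type := ('I_N -> R) * ('I_N -> 'rV[R]_d).

Definition pbmd_init : pbmd_state :=
  (fun k : 'I_N => N.+1%:R / N%:R * (k.+1 * k.+2)%N%:R^-1, fun=> y1).

Definition pbmd_mean (S : pbmd_state) : 'rV[R]_d :=
  \sum_(k < N) S.1 k *: S.2 k.

Definition pbmd_estimate (f : 'rV[R]_d -> R) (y s : 'rV[R]_d) : 'rV[R]_d :=
  (d%:R / (2 * mu) * (f (y + mu *: s) - f (y - mu *: s))) *: signv s.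

Definition pbmd_step (f : 'rV[R]_d -> R) (s : 'rV[R]_d) (S : pbmd_state) :
    pbmd_state :=
  let y := pbmd_mean S in
  let g := pbmd_estimate f y s in
  let phi z := dot g (z - y) in
  (fun k : 'I_N => S.1 k * expR (- gamma * phi (S.2 k)) /
            \sum_(j < N) S.1 j * expR (- gamma * phi (S.2 j)),
   fun k : 'I_N => argmin D (fun z => dot g z + (eta k)^-1 * bregman psi z (S.2 k))).

Variables (f : nat -> 'rV[R]_d -> R) (s : nat -> 'rV[R]_d).

Fixpoint pbmd_run (t : nat) : pbmd_state :=
  if t is t'.+1 then pbmd_step (f t') (s t') (pbmd_run t') else pbmd_init.

Definition pbmd_plus (t : nat) : 'rV[R]_d := pbmd_mean (pbmd_run t) + mu *: s t.

Definition pbmd_minus (t : nat) : 'rV[R]_d := pbmd_mean (pbmd_run t) - mu *: s t.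

Definition pbmd_regret (T : nat) (u : nat -> 'rV[R]_d) : R :=
  \sum_(t < T) ((f t (pbmd_plus t) + f t (pbmd_minus t)) / 2 - f t (u t)).

End PBMD.

Definition zeta2 {R : realType} (d : nat) : R :=
  if 2 < ln d%:R :> R then 2 * Num.sqrt d%:R / d.+1%:R
  else expR 1 * ln d%:R / d.+1%:R.

Definition path_length {R : realType} {d : nat} (T : nat) (u : nat -> 'rV[R]_d) : R :=
  \sum_(t < T.-1) l2norm (u t.+1 - u t).

(* Main.v *)
From HB Require Import structures.
Require Import Defs.
From mathcomp Require Import all_boot all_order all_algebra.
From mathcomp Require Import all_classical all_reals all_analysis.
From mathcomp Require Import measurable_realfun ring lra.

(** Let [w] have independent Laplace coordinates, of density [exp (- |x|) / 2].
    Then [w / |w|_1] is independent of [|w|_1] and is uniform on the l1-sphere,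
    which gives two estimates of the gradient estimator [g] at a fixed point
    [y], for a convex G-Lipschitz loss [f].
    - Bias: replace [f] by a smooth convex [F] (an infimal convolution). Slicing
      the sphere along the i-th axis turns [d * E (sg s_i * F (y + mu s))] into
      [mu] times an average over the l1-ball of the i-th partial derivative of
      [F]; by convexity, [E <g, y - u> >= f y - f u - 8 G mu].
    - Variance: the Poincare inequality of the Laplace product law, applied to
      [F (y + mu w / d)], together with [E |s - w / d|^2 <= 2 / d^2], yields
      [E (f (y + mu s) - f (y - mu s))^2 = O (G^2 mu^2 / d^2)], hence
      [E |g|^2 = O (G^2 d)].
    Pathwise, exponential weights compete with every expert at a cost
    logarithmic in its index, and mirror descent with step [eta_k] competes with
    the comparators; one of the N step sizes is nearly optimal for the path
    length. Integrating over s^t first, with all other draws fixed, lets the two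
    estimates be applied at the random point y^t. *)

Set Implicit Arguments.
Unset Strict Implicit.
Unset Printing Implicit Defensive.

Import Order.TTheory GRing.Theory Num.Theory.
Import numFieldNormedType.Exports.

Local Open Scope classical_set_scope.
Local Open Scope ring_scope.

(** * The Laplace distribution *)

(** With the Lipschitz bound alone and [E |s|_2^2] of order [1 / d], the second moment of the
    estimator would be [O (G^2 d^2)]. The missing factor [d] is a concentration effect, which calls
    for a Poincare inequality whose constant does not grow with the dimension; this is why the
    sphere is reached from a product law. That inequality is established for bounded functions, so
    the smoothed loss is first composed with a smooth bounded truncation, which shrinks the relevant
    increments by a factor of at most 3. The two estimates smooth at different scales: in the bias
    the smoothing error is multiplied by a quantity of order [d^2 / mu], hence the scale
    [(mu / d)^2], while [mu / d] is enough for the variance.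

    A second obstacle is that losses are Lipschitz on the unit ball only, and that draws lie on the
    sphere only almost surely. Each loss is therefore composed with the projection on the ball,
    which makes it globally Lipschitz, bounded and measurable; the two runs agree off a null set,
    and the expected regret is bounded by domination off that set. *)

Section Density.
Context d (T : measurableType d) (R : realType).
Local Open Scope ereal_scope.
Variables (m nu : {measure set T -> \bar R}) (p : T -> R).
Hypothesis p_ge0 : forall x, (0 <= p x)%R.
Hypothesis mp : measurable_fun [set: T] p.
Hypothesis nuE : forall V, measurable V -> nu V = \int[m]_(x in V) (p x)%:E.

Import HBNNSimple.

(** Monotone convergence along the simple approximations of [f] reduces the identity to indicators,
    where it is [nuE]. *)
Lemma ge0_integral_density (f : T -> \bar R) :
  measurable_fun [set: T] f -> (forall x, 0 <= f x) ->
  \int[nu]_x f x = \int[m]_x (f x * (p x)%:E).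
Proof.
move=> mf f0.
pose f_ := nnsfun_approx measurableT mf.
have fc x : (f_ n x)%:E @[n --> \oo] --> f x.
  by apply: cvg_nnsfun_approx.
transitivity (limn (fun n => \int[nu]_x (f_ n x)%:E)).
  rewrite -monotone_convergence//.
  - by apply: eq_integral => y _; apply/esym/cvg_lim => //.
  - by move=> n; exact/measurable_EFinP/measurable_funP.
  - by move=> n y _; rewrite lee_fin.
  - by move=> y _ m' n mn; rewrite lee_fin; exact/lefP/nd_nnsfun_approx.
transitivity (limn (fun n => \int[m]_x ((f_ n x)%:E * (p x)%:E))); last first.
  rewrite -monotone_convergence//.
  - apply: eq_integral => y _; apply/cvg_lim => //.
    by apply: cvgeZr.
  - move=> n; apply: emeasurable_funM; apply/measurable_EFinP => //.
  - by move=> n y _; rewrite mule_ge0// lee_fin.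
  - move=> y _ m' n mn; rewrite lee_wpmul2r ?lee_fin//.
    exact/lefP/nd_nnsfun_approx.
congr (limn _); apply/funext => n.
transitivity (\sum_(k \in range (f_ n))
    \int[nu]_x (k * \1_(f_ n @^-1` [set k]) x)%:E).
  under eq_integral do rewrite fimfunE -fsumEFin//.
  rewrite ge0_integral_fsum//.
  - by move=> y; exact/measurable_EFinP/measurable_funM.
  - by move=> y x _; rewrite nnfun_muleindic_ge0.
transitivity (\sum_(k \in range (f_ n))
    \int[m]_x ((k * \1_(f_ n @^-1` [set k]) x)%:E * (p x)%:E)); last first.
  rewrite -ge0_integral_fsum//; last 2 first.
  - move=> y; apply: emeasurable_funM; apply/measurable_EFinP => //.
    exact: measurable_funM.
  - by move=> y x _; rewrite mule_ge0 ?nnfun_muleindic_ge0// lee_fin.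
  apply: eq_integral => x _; rewrite fimfunE -fsumEFin//.
  rewrite ge0_mule_fsuml// => i; exact: nnfun_muleindic_ge0.
apply: eq_fsbigr => r; rewrite inE => -[t _ <-{r}].
under [RHS]eq_integral do rewrite EFinM -muleA.
rewrite [RHS]ge0_integralZl//; last 3 first.
- apply: emeasurable_funM; apply/measurable_EFinP => //.
- by move=> x _; rewrite mule_ge0// lee_fin.
- by rewrite lee_fin.
under [LHS]eq_integral do rewrite EFinM.
rewrite [LHS]ge0_integralZl//; last 2 first.
- by apply/measurable_EFinP.
- by rewrite lee_fin.
congr (_ * _).
rewrite integral_indic// setIT nuE// integral_mkcond.
by apply: eq_integral => x _; rewrite epatch_indic muleC.
Qed.

End Density.

Section HalfLine.
Context {R : realType}.
Notation leb := (@lebesgue_measure R).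
Implicit Types (P dP : R -> R).

(** The cubic term in [expR x >= 1 + x ^+ 3 / 6] beats [1 + x ^+ 2] by one power of [x]. What
    remains is a polynomial inequality, in which [x * (x - 1) ^+ 2] and [(x - 1) ^+ 2] absorb the
    negative terms. *)
Lemma expRN_quadratic_bound (x : R) : 0 <= x ->
  (1 + x ^+ 2) * expR (- x) <= 12 / (1 + x).
Proof.
move=> x0; rewrite expRN.
have h := expR_ge1Dxn 2 x0; have f6 : (3`!)%:R = 6 :> R by [].
rewrite f6 in h.
have e0 := expR_gt0 x.
rewrite ler_pdivrMr// mulrAC ler_pdivlMr ?ltr_pwDl//.
apply: (@le_trans _ _ (12 * (1 + x ^+ 3 / 6))); last by rewrite ler_pM2l.
have := mulr_ge0 x0 (sqr_ge0 (x - 1)); have := sqr_ge0 (x - 1); lra.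
Qed.

Lemma cvg_quadratic_expRN P (K : R) : 0 <= K ->
  (forall x : R, 0 <= x -> `|P x| <= K * (1 + x ^+ 2)) ->
  P x * expR (- x) @[x --> +oo%R] --> 0.
Proof.
move=> K0 PK; apply/cvgrPdist_le => e e0.
near=> x; rewrite sub0r normrN normrM (ger0_norm (expR_ge0 _)).
have x0 : 0 <= x by near: x; exact: nbhs_pinfty_ge.
apply: (@le_trans _ _ (K * (1 + x ^+ 2) * expR (- x))).
  by rewrite ler_wpM2r ?expR_ge0// PK.
rewrite -mulrA; apply: (@le_trans _ _ (K * (12 / (1 + x)))).
  by rewrite ler_wpM2l// expRN_quadratic_bound.
rewrite mulrA ler_pdivrMr ?ltr_pwDl//.
have : K * 12 / e <= x by near: x; apply: nbhs_pinfty_ge; rewrite num_real.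
rewrite ler_pdivrMr// => h; rewrite (le_trans h)// mulrC ler_wpM2l ?(ltW e0)//.
by rewrite lerDr.
Unshelve. all: by end_near. Qed.

(** The integrand is the derivative of [- (P x * expR (- x))], which vanishes at infinity. Solving
    [P - dP = 1], [x], [x ^+ 2] in polynomials then yields the moments of the exponential law
    without integration by parts. *)
Lemma integral_expRN_derive P dP (K : R) : 0 <= K ->
  (forall x : R, 0 <= x -> `|P x| <= K * (1 + x ^+ 2)) ->
  (forall x : R, is_derive x 1 P (dP x)) -> continuous dP ->
  (forall x : R, 0 <= x -> dP x <= P x) ->
  (\int[leb]_(x in `[0%R, +oo[) ((P x - dP x) * expR (- x))%:E = (P 0)%:E)%E.
Proof.
move=> K0 PK dPE cdP dPP.
have cP : continuous P.
  by move=> x; apply: differentiable_continuous; apply/derivable1_diffP; exact: ex_derive.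
have cE : continuous (fun x : R => expR (- x)).
  by move=> x; apply: continuous_comp; [exact: opp_continuous|exact: continuous_expR].
have cF : continuous (fun x : R => (P x - dP x) * expR (- x)).
  by move=> x; apply: cvgM; [apply: cvgB; [exact: cP|exact: cdP]|exact: cE].
have cPE : continuous (fun x : R => P x * expR (- x)).
  by move=> x; apply: cvgM; [exact: cP|exact: cE].
rewrite (@ge0_continuous_FTC2y _ _ (fun x => - (P x * expR (- x))) _ 0).
- by rewrite oppr0 expR0 mulr1 sub0e EFinN oppeK.
- by move=> x x0; rewrite mulr_ge0 ?expR_ge0// subr_ge0 dPP.
- exact: (@continuous_subspaceT R R _ _ cF).
- by rewrite -oppr0; apply: cvgN; exact: cvg_quadratic_expRN K0 PK.
- by move=> x _; exact: ex_derive.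
- apply: cvg_at_right_filter; apply: cvgN; exact: cPE.
- move=> x _; rewrite derive1E derive_val.
  by rewrite /GRing.scale/=; ring.
Qed.

Lemma integral_expRN : (\int[leb]_(x in `[0%R, +oo[) (expR (- x))%:E = 1)%E.
Proof.
have := @integral_expRN_derive (cst 1) (cst 0) 1.
under eq_integral do rewrite /cst subr0 mul1r; apply => //.
- by move=> x x0; rewrite normr1 mul1r lerDl sqr_ge0.
- exact: cst_continuous.
Qed.

Lemma integral_id_expRN :
  (\int[leb]_(x in `[0%R, +oo[) (x * expR (- x))%:E = 1)%E.
Proof.
have := @integral_expRN_derive (fun x => x + 1) (cst 1) 2.
under eq_integral do rewrite /cst addrK; rewrite add0r; apply => //.
- by move=> x x0; rewrite ger0_norm; nra.
- by move=> x; rewrite -[cst 1 x]addr0; exact: is_deriveD.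
- exact: cst_continuous.
- by move=> x x0; rewrite lerDr.
Qed.

Lemma integral_sqr_expRN :
  (\int[leb]_(x in `[0%R, +oo[) (x ^+ 2 * expR (- x))%:E = 2%:E)%E.
Proof.
have := @integral_expRN_derive (fun x => x ^+ 2 + (2 * x + 2)) (fun x => 2 * x + 2) 5.
under eq_integral do rewrite addrK; rewrite mulr0 expr0n add0r add0r; apply => //.
- by move=> x x0; rewrite ger0_norm; nra.
- move=> x; apply: is_derive_eq; rewrite /GRing.scale/=; ring.
- move=> x; apply: cvgD; last exact: cvg_cst.
  by apply: cvgM; [exact: cvg_cst|exact: cvg_id].
- by move=> x x0; rewrite lerDr sqr_ge0.
Qed.

End HalfLine.

Definition lap_pdf {R : realType} (x : R) : R := expR (- `|x|) / 2.

(* [lebesgue_measure] lives on [measurableTypeR R], whose display differs from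
   the one of the canonical measurable structure of [R]; [lap] is transferred
   to the latter. *)
Definition lap0 {R : realType} (V : set (measurableTypeR R)) : \bar R :=
  (\int[@lebesgue_measure R]_(x in V) (lap_pdf x)%:E)%E.

Section Laplace.
Context {R : realType}.
Notation leb := (@lebesgue_measure R).
Notation half := (`[0%R, +oo[%classic : set R).
Local Open Scope ereal_scope.

Lemma lap_pdf_ge0 (x : R) : (0 <= lap_pdf x)%R.
Proof. by rewrite divr_ge0// expR_ge0. Qed.

Lemma measurable_lap_pdf : measurable_fun [set: R] (@lap_pdf R).
Proof.
apply: measurable_funM => //; apply: measurableT_comp => //.
by apply: measurableT_comp => //.
Qed.

Lemma ge0_integral_split0 (f : R -> \bar R) :
  measurable_fun [set: R] f -> (forall x, 0 <= f x) ->
  \int[leb]_x f x = \int[leb]_(x in half) f x + \int[leb]_(x in half) f (- x)%R.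
Proof.
move=> mf f0.
have mfN : measurable_fun [set: R] (fun x => f (- x)%R) by apply: measurableT_comp.
have -> : [set: R] = half `|` `]-oo, 0%R[%classic.
  apply/seteqP; split => x //= _; rewrite !in_itv/= andbT.
  by case: (leP 0%R x) => _; [left|right].
rewrite ge0_integral_setU//=; first last.
- apply/eqP; rewrite -subset0 => x []/=; rewrite !in_itv/= andbT => x0.
  by rewrite ltNge x0.
- exact: measurable_funTS.
congr (_ + _).
rewrite (ge0_integration_by_substitution0 mfN)//.
under [RHS]eq_integral do rewrite opprK.
rewrite integral_itv_bndo_bndc//; exact: measurable_funTS.
Qed.

Let lap0_set0 : lap0 set0 = 0 :> \bar R.
Proof. exact: integral_set0. Qed.

Let lap0_ge0 (A : set (measurableTypeR R)) : 0 <= lap0 A.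
Proof. by rewrite integral_ge0//= => x _; rewrite lee_fin lap_pdf_ge0. Qed.

Let lap0_sigma_additive : semi_sigma_additive (@lap0 R).
Proof.
move=> /= F mF tF mUF; rewrite /lap0; apply: cvg_toP.
  apply: ereal_nondecreasing_is_cvgn => m n mn.
  apply: lee_sum_nneg_natr => // k _ _; apply: integral_ge0 => /= x Fkx.
  by rewrite lee_fin lap_pdf_ge0.
rewrite ge0_integral_bigcup//=.
- by apply/measurable_funTS/measurableT_comp => //; exact: measurable_lap_pdf.
- by move=> x _; rewrite lee_fin lap_pdf_ge0.
Qed.

HB.instance Definition _ := isMeasure.Build _ _ _
  (@lap0 R) lap0_set0 lap0_ge0 lap0_sigma_additive.

Definition idR : measurableTypeR R -> R := id.

Lemma measurable_idR : measurable_fun [set: measurableTypeR R] idR.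
Proof. by move=> _ Y mY; rewrite setTI. Qed.

Lemma measurable_funL d (T : measurableType d) (f : R -> T) :
  measurable_fun [set: R] f ->
  measurable_fun [set: measurableTypeR R] (f : measurableTypeR R -> T).
Proof. by move=> mf; apply: (measurableT_comp mf measurable_idR). Qed.

Lemma integral_lap0 (f : R -> \bar R) :
  measurable_fun [set: R] f -> (forall x, 0 <= f x) ->
  \int[@lap0 R]_x f x = \int[leb]_x (f x * (lap_pdf x)%:E).
Proof.
move=> mf f0; apply: (@ge0_integral_density _ _ R leb (@lap0 R) lap_pdf) => //.
  exact: lap_pdf_ge0.
by apply: measurable_funL; exact: measurable_lap_pdf.
Qed.

Lemma integral_lap0_half (f : R -> \bar R) :
  measurable_fun [set: R] f -> (forall x, 0 <= f x) ->
  \int[@lap0 R]_x f x =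
  \int[leb]_(x in half) (f x * (expR (- x) / 2)%:E) +
  \int[leb]_(x in half) (f (- x)%R * (expR (- x) / 2)%:E).
Proof.
move=> mf f0.
rewrite integral_lap0// ge0_integral_split0; last first.
- by move=> x; rewrite mule_ge0// lee_fin lap_pdf_ge0.
- apply: emeasurable_funM => //; apply/measurable_EFinP; exact: measurable_lap_pdf.
apply: f_equal2; apply: eq_integral => x; rewrite inE set_itvE => /= x0.
  by rewrite /lap_pdf ger0_norm.
by rewrite /lap_pdf normrN ger0_norm.
Qed.

Lemma integral_lap0_even (f : R -> R) :
  measurable_fun [set: R] f -> (forall x, (0 <= f x)%R) ->
  (forall x, f (- x)%R = f x) ->
  \int[@lap0 R]_x (f x)%:E = \int[leb]_(x in half) (f x * expR (- x))%:E.
Proof.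
move=> mf f0 fN.
rewrite integral_lap0_half; [|exact/measurable_EFinP|by move=> x; rewrite lee_fin].
under [X in _ + X]eq_integral do rewrite fN.
have mh : measurable_fun half (fun x => ((f x)%:E * (expR (- x) / 2)%:E)).
  apply: measurable_funTS; apply: emeasurable_funM; apply/measurable_EFinP => //.
  by apply: measurable_funM => //; apply: measurableT_comp.
rewrite -ge0_integralD//=; try by move=> x _; rewrite mule_ge0// lee_fin// divr_ge0 ?expR_ge0.
by apply: eq_integral => x _; rewrite -EFinM -EFinD; congr EFin; field.
Qed.

Let lap0T : lap0 [set: measurableTypeR R] = 1.
Proof.
rewrite -[LHS]mul1e -integral_cst//= (@integral_lap0_even (cst 1%R))//.
by under eq_integral do rewrite mul1r; exact: integral_expRN.
Qed.

HB.instance Definition _ := @Measure_isProbability.Build _ _ R (@lap0 R) lap0T.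
HB.instance Definition _ := isMeasurableFun.Build _ _ _ _ _ measurable_idR.

Definition lap : probability R R :=
  distribution (@lap0 R) idR.

Lemma integral_lapE (f : R -> \bar R) :
  measurable_fun [set: R] f -> (forall x, 0 <= f x) ->
  \int[lap]_x f x = \int[@lap0 R]_x f x.
Proof. by move=> mf f0; rewrite /lap/= ge0_integral_pushforward. Qed.

Lemma integral_lap (f : R -> \bar R) :
  measurable_fun [set: R] f -> (forall x, 0 <= f x) ->
  \int[lap]_x f x =
  \int[leb]_(x in half) (f x * (expR (- x) / 2)%:E) +
  \int[leb]_(x in half) (f (- x)%R * (expR (- x) / 2)%:E).
Proof. by move=> mf f0; rewrite integral_lapE// integral_lap0_half. Qed.

Lemma integral_lap_even (f : R -> R) :
  measurable_fun [set: R] f -> (forall x, (0 <= f x)%R) ->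
  (forall x, f (- x)%R = f x) ->
  \int[lap]_x (f x)%:E = \int[leb]_(x in half) (f x * expR (- x))%:E.
Proof.
move=> mf f0 fN; rewrite integral_lapE ?integral_lap0_even//.
exact/measurable_EFinP.
Qed.

Lemma integral_lap_normr : \int[lap]_x `|x|%:E = 1.
Proof.
rewrite (@integral_lap_even (fun x => `|x|%R)) => //; last by move=> x; rewrite normrN.
rewrite -(@integral_id_expRN R); apply: eq_integral => x.
by rewrite inE/= in_itv/= andbT => x0; rewrite ger0_norm.
Qed.

Lemma integral_lap_sqr : \int[lap]_x (x ^+ 2)%:E = 2%:E.
Proof.
rewrite (@integral_lap_even (fun x => x ^+ 2)%R) //.
- exact: integral_sqr_expRN.
- by move=> x; rewrite sqr_ge0.
- by move=> x; rewrite sqrrN.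
Qed.

Lemma integral_lap_opp (f : R -> \bar R) :
  measurable_fun [set: R] f -> (forall x, 0 <= f x) ->
  \int[lap]_x f (- x)%R = \int[lap]_x f x.
Proof.
move=> mf f0; rewrite integral_lap//; last by apply: measurableT_comp.
by under [X in _ + X]eq_integral do rewrite opprK; rewrite addeC -integral_lap.
Qed.

Lemma lap_set1 (a : R) : lap [set a] = 0.
Proof. by rewrite /lap/= /distribution /pushforward/= preimage_id /lap0 integral_set1. Qed.

(** Lebesgue measure has density [2 * expR |x|] with respect to the Laplace law. Read from right to
    left, this turns Lebesgue integrals into integrals for a probability, so that a single Fubini
    theorem, that of [iid], serves throughout. *)
Lemma integral_lap_expR (f : R -> \bar R) :
  measurable_fun [set: R] f -> (forall x, 0 <= f x) ->
  \int[lap]_x ((2 * expR `|x|)%:E * f x) = \int[leb]_x f x.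
Proof.
move=> mf f0.
have mg : measurable_fun [set: R] (fun x : R => (2 * expR `|x|)%:E).
  apply/measurable_EFinP; apply: measurable_funM => //.
  by apply: measurableT_comp => //.
have mgf : measurable_fun [set: R] (fun x : R => (2 * expR `|x|)%:E * f x).
  exact: emeasurable_funM.
have gf0 x : 0 <= (2 * expR `|x|)%:E * f x.
  by rewrite mule_ge0// lee_fin mulr_ge0 ?expR_ge0.
rewrite integral_lapE// integral_lap0//.
apply: eq_integral => x _; rewrite muleAC -EFinM /lap_pdf expRN.
rewrite (_ : _ * _ = 1)%R ?mul1e//; field; by rewrite gt_eqF ?expR_gt0.
Qed.

End Laplace.
Arguments lap : clear implicits.

(** * Poincare inequality for the exponential weight on the half-line *)

Section HalfLinePoincare.
Context {R : realType}.
Notation leb := (@lebesgue_measure R).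
Local Open Scope ereal_scope.

Lemma continuous_FTC_itv (G k : R -> R) (a b : R) : (a < b)%R ->
  (forall x : R, is_derive x 1%R G (k x)) -> continuous k ->
  \int[leb]_(x in `[a, b]) (k x)%:E = (G b - G a)%:E.
Proof.
move=> ab dG ck.
have cG : continuous G.
  by move=> x; apply: differentiable_continuous; apply/derivable1_diffP; exact: ex_derive.
rewrite EFinB; apply: (@continuous_FTC2 _ k G) => //.
- exact: (@continuous_subspaceT R R _ _ ck).
- split; first by move=> x _; exact: ex_derive.
  + by apply: cvg_at_right_filter; exact: cG.
  + by apply: cvg_at_left_filter; exact: cG.
- by move=> x _; rewrite derive1E derive_val.
Qed.

(** [V] is the derivative of [- U]. Since [u 0 = 0] and [U] is nonnegative, the integral of [V] over
    [[0, n]] is at most 0, so that no growth condition at infinity is involved; a pointwise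
    comparison of [U - 4 * K] with [2 * V] and a monotone limit in [n] conclude. *)
Lemma half_line_poincare (u k : R -> R) : u 0%R = 0%R ->
  (forall x : R, is_derive x 1%R u (k x)) -> continuous k ->
  \int[leb]_(x in `[0%R, +oo[) (u x ^+ 2 * (expR (- x) / 2))%:E <=
  4%:E * \int[leb]_(x in `[0%R, +oo[) (k x ^+ 2 * (expR (- x) / 2))%:E.
Proof.
move=> u0 du ck.
have cu : continuous u.
  by move=> x; apply: differentiable_continuous; apply/derivable1_diffP; exact: ex_derive.
have cE : continuous (fun x : R => expR (- x) / 2)%R.
  move=> x; apply: cvgM; last exact: cvg_cst.
  by apply: continuous_comp; [exact: opp_continuous|exact: continuous_expR].
pose U x := (u x ^+ 2 * (expR (- x) / 2))%R.
pose K x := (k x ^+ 2 * (expR (- x) / 2))%R.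
have cU : continuous U by move=> x; apply: cvgM; [apply: cvgM; exact: cu|exact: cE].
have cK : continuous K by move=> x; apply: cvgM; [apply: cvgM; exact: ck|exact: cE].
have U0 x : (0 <= U x)%R by rewrite mulr_ge0 ?sqr_ge0// divr_ge0 ?expR_ge0.
have K0 x : (0 <= K x)%R by rewrite mulr_ge0 ?sqr_ge0// divr_ge0 ?expR_ge0.
pose V x := (U x - 2 * u x * k x * (expR (- x) / 2))%R.
have cV : continuous V.
  move=> x; apply: cvgB; first exact: cU.
  apply: cvgM; last exact: cE.
  apply: cvgM; last exact: ck.
  by apply: cvgM; [exact: cvg_cst|exact: cu].
have iC (f : R -> R) (n : nat) : continuous f ->
    leb.-integrable `[0%R, n%:R] (EFin \o f).
  move=> cf; apply: continuous_compact_integrable; first exact: segment_compact.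
  exact: (@continuous_subspaceT R R _ _ cf).
have bound (n : nat) : \int[leb]_(x in `[0%R, n%:R]) (U x)%:E <=
    4%:E * \int[leb]_(x in `[0%R, n%:R]) (K x)%:E.
  case: n => [|n]; first by rewrite set_itv1 !integral_set1 mule0.
  have dU (x : R) : is_derive x 1%R (fun x => - U x)%R (V x).
    by apply: is_derive_eq; rewrite /V /U /GRing.scale/=; field.
  have ftc := @continuous_FTC_itv (fun x => - U x)%R V 0%R n.+1%:R
    (ltr0Sn _ _) dU cV.
  have {}ftc : \int[leb]_(x in `[0%R, n.+1%:R]) (V x)%:E <= 0.
    have U00 : U 0%R = 0%R by rewrite /U u0 expr0n mul0r.
    by rewrite ftc lee_fin U00 oppr0 subr0 oppr_le0.
  have : \int[leb]_(x in `[0%R, n.+1%:R]) (U x - 4 * K x)%:E <= 0.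
    apply: (@le_trans _ _ (\int[leb]_(x in `[0%R, n.+1%:R]) (2 * V x)%:E)).
      apply: le_integral => //.
      - apply: iC => x; apply: cvgB; first exact: cU.
        by apply: cvgM; [exact: cvg_cst|exact: cK].
      - by apply: iC => x; apply: cvgM; [exact: cvg_cst|exact: cV].
      (* The difference [2 * V x - (U x - 4 * K x)] is the square of [u x - 2 * k x] times the
         weight; this is the origin of the constant 4. *)
      - move=> x _; rewrite lee_fin /V /U /K.
        have := expR_ge0 (- x)%R; set e := expR _ => e0.
        have := mulr_ge0 (sqr_ge0 (u x - 2 * k x)%R) e0; nra.
    under eq_integral do rewrite EFinM.
    rewrite integralZl//; last exact: iC.
    by rewrite mule_ge0_le0.
  under eq_integral do rewrite EFinB.
  rewrite integralB//; last 2 first.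
  - exact: iC.
  - by apply: iC => x; apply: cvgM; [exact: cvg_cst|exact: cK].
  under [X in _ - X]eq_integral do rewrite EFinM.
  rewrite [X in _ - X]integralZl//; last exact: iC.
  rewrite sube_le0//.
have mUE (f : R -> R) D : continuous f -> measurable_fun D (EFin \o f).
  move=> cf; apply: measurable_funTS; apply/measurable_EFinP.
  exact: continuous_measurable_fun.
rewrite (_ : `[0%R, +oo[%classic = \bigcup_n `[0%R, n%:R]%classic); last first.
  rewrite (itv_bndy_bigcup_BRight true (0:R)); apply: eq_bigcupr => n _.
  by rewrite add0r.
have cvgU := @ge0_nondecreasing_set_cvg_integral _ (measurableTypeR R) R
  (fun n : nat => `[0%R, n%:R]%classic : set R) (EFin \o U) leb.
have nd : nondecreasing_seq (fun n : nat => `[0%R, n%:R]%classic : set R).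
  by move=> m n mn; rewrite subsetEset; apply: subset_itvl; rewrite bnd_simp ler_nat.
have {}cvgU := cvgU nd (fun=> measurable_itv _) (fun=> mUE _ _ cU) _.
have Uge (i : nat) (x : measurableTypeR R) :
  `[0%R, i%:R]%classic x -> 0%R <= (EFin \o U) x by rewrite lee_fin.
rewrite -(cvg_lim _ (cvgU Uge))//.
apply: lime_le; first by apply/cvg_ex; eexists; exact: (cvgU Uge).
apply: nearW => n; rewrite (le_trans (bound n))// lee_wpmul2l//.
apply: ge0_subset_integral => //.
- by apply: bigcup_measurable => i _; exact: measurable_itv.
- exact: mUE.
- by move=> x _; rewrite lee_fin.
- by move=> x Dx; exists n.
Qed.

(** The pushforward of Lebesgue measure along the affine map, multiplied by [c], gives intervals
    their length, hence is Lebesgue measure by uniqueness. *)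
Lemma integral_lebesgue_affine (c b : R) (f : R -> \bar R) : (0 < c)%R ->
  measurable_fun [set: R] f -> (forall x, 0 <= f x) ->
  \int[leb]_x f x = c%:E * \int[leb]_x f (c * x + b)%R.
Proof.
move=> c0 mf f0.
pose T (x : measurableTypeR R) : measurableTypeR R := (c * x + b)%R.
have mT : measurable_fun [set: measurableTypeR R] T.
  by apply: measurable_funD => //; exact: measurable_funM.
have cn : (0 <= c)%R by exact: ltW.
pose m : {measure set (measurableTypeR R) -> \bar R} :=
  mscale (NngNum cn) (pushforward leb T).
have mE A : measurable A -> leb A = m mT A.
  apply: lebesgue_measure_unique => _ [[p q]/= _ <-].
  rewrite /m/= /mscale/= /pushforward.
  rewrite (_ : T @^-1` _ = `]((p - b) / c)%R, ((q - b) / c)%R]%classic); last first.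
    apply/seteqP; split => x /=; rewrite !in_itv/= /T ltr_pdivrMr// ler_pdivlMr//.
      by move=> /andP[? ?]; apply/andP; split; lra.
    by move=> /andP[? ?]; apply/andP; split; lra.
  rewrite !lebesgue_measure_itv/= !lte_fin ltr_pM2r ?invr_gt0// ltrD2r.
  case: ifPn => _; last by rewrite mule0.
  by rewrite -!EFinB -EFinM; congr EFin; field; rewrite gt_eqF.
rewrite (@eq_measure_integral _ _ _ setT (m mT))//; last by move=> A mA _; exact: mE.
rewrite ge0_integral_mscale//= ge0_integral_pushforward//.
Qed.

End HalfLinePoincare.

(** * Independent samples and polar coordinates of the l1 norm *)

Section ProductProbability.
Context d1 d2 (T1 : measurableType d1) (T2 : measurableType d2) (R : realType).
Variables (P1 : probability T1 R) (P2 : probability T2 R).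
Local Open Scope ereal_scope.

Definition prodP : set (T1 * T2) -> \bar R := P1 \x P2.

HB.instance Definition _ := Measure.on prodP.

Let prodPT : prodP setT = 1.
Proof.
rewrite /prodP -setXTT product_measure1E// -[X in _ * X]/(P2 setT).
by rewrite -[X in X * _]/(P1 setT) !probability_setT mule1.
Qed.

HB.instance Definition _ := Measure_isProbability.Build _ _ _ prodP prodPT.

End ProductProbability.

Section IidTuple.
Context d (T : measurableType d) (R : realType).
Local Open Scope ereal_scope.

Definition consX n (xv : T * n.-tuple T) : n.+1.-tuple T := [tuple of xv.1 :: xv.2].

Lemma measurable_consX n : measurable_fun [set: T * n.-tuple T] (@consX n).
Proof. exact: (measurable_cons measurable_fst measurable_snd). Qed.

HB.instance Definition _ n := isMeasurableFun.Build _ _ _ _ (@consX n) (@measurable_consX n).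

Fixpoint iid (P : probability T R) n : probability (n.-tuple T) R :=
  match n with
  | 0 => \d_[tuple]
  | m.+1 => distribution (prodP P (iid P m)) (@consX m)
  end.

Variable P : probability T R.

Lemma integral_iid0 (f : 0.-tuple T -> \bar R) :
  measurable_fun [set: 0.-tuple T] f ->
  \int[iid P 0]_w f w = f [tuple].
Proof. by move=> mf; rewrite integral_dirac// diracT mul1e. Qed.

Variable n : nat.
Variable f : n.+1.-tuple T -> \bar R.
Hypothesis mf : measurable_fun [set: n.+1.-tuple T] f.
Hypothesis f0 : forall w, 0 <= f w.

Lemma measurable_comp_consX :
  measurable_fun [set: T * n.-tuple T] (fun xv => f (consX xv)).
Proof. exact: (measurableT_comp mf (@measurable_consX n)). Qed.

Lemma integral_iidS :
  \int[iid P n.+1]_w f w = \int[P]_x \int[iid P n]_v f [tuple of x :: v].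
Proof.
rewrite /= ge0_integral_pushforward//=.
rewrite -[LHS]/(\int[P \x iid P n]_x (f \o @consX n) x).
rewrite fubini_tonelli1; [by []|exact: measurable_comp_consX|].
by move=> x; exact: f0.
Qed.

Lemma integral_iidS_swap :
  \int[iid P n.+1]_w f w = \int[iid P n]_v \int[P]_x f [tuple of x :: v].
Proof.
rewrite integral_iidS (@fubini_tonelli _ _ _ _ _ P (iid P n) (f \o @consX n)).
- by [].
- exact: measurable_comp_consX.
- by move=> x; exact: f0.
Qed.

End IidTuple.

Section MeasurableTools.
Context d (T : measurableType d) (R : realType).

Lemma measurable_fun_invr_ge0 (D : set T) (f : T -> R) : measurable_fun D f ->
  (forall x, 0 <= f x) -> measurable_fun D (fun x => (f x)^-1).
Proof.
move=> mf f0; under eq_fun do rewrite -powR_inv1//.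
by apply: (measurableT_comp (f := fun a : R => a `^ (-1)) _ mf); exact: measurable_powR.
Qed.

Lemma measurable_fun_tuple d' (V : measurableType d') n (f : T -> n.-tuple V) :
  (forall i, measurable_fun [set: T] (fun x => tnth (f x) i)) ->
  measurable_fun [set: T] f.
Proof. by move=> h; apply/measurable_fun_tnthP => i; exact: h. Qed.

Lemma measurable_fun_tnth d' (V : measurableType d') n (f : T -> n.-tuple V) i :
  measurable_fun [set: T] f -> measurable_fun [set: T] (fun x => tnth (f x) i).
Proof. by move=> mf; have /measurable_fun_tnthP/(_ i) := mf. Qed.

End MeasurableTools.

Section Insert.
Context (T : Type).

Definition ins n (i : 'I_n.+1) (z : n.-tuple T) (x : T) : n.+1.-tuple T :=
  [tuple (if unlift i j is Some k then tnth z k else x) | j < n.+1].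

Lemma tnth_ins n (i : 'I_n.+1) z x : tnth (ins i z x) i = x.
Proof. by rewrite tnth_mktuple unlift_none. Qed.

Lemma tnth_ins_lift n (i : 'I_n.+1) z x k : tnth (ins i z x) (lift i k) = tnth z k.
Proof. by rewrite tnth_mktuple liftK. Qed.

Lemma ins0E n (z : n.-tuple T) x : ins ord0 z x = [tuple of x :: z].
Proof.
apply: eq_from_tnth => j; case: (unliftP ord0 j) => [k|] ->.
  by rewrite tnth_ins_lift tnthS.
by rewrite tnth_ins tnth0.
Qed.

Lemma insSE n (i : 'I_n.+1) (z : n.-tuple T) x y :
  ins (lift ord0 i) [tuple of y :: z] x = [tuple of y :: ins i z x].
Proof.
apply: eq_from_tnth => j; case: (unliftP ord0 j) => [k|] ->.
  rewrite [RHS]tnthS; case: (unliftP i k) => [l|] ->; last by rewrite !tnth_ins.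
  rewrite tnth_ins_lift (_ : lift ord0 (lift i l) = lift (lift ord0 i) (lift ord0 l)).
    by rewrite tnth_ins_lift tnthS.
  by apply: val_inj => /=; rewrite /bump /= !add1n ltnS addnS.
rewrite [RHS]tnth0 (_ : ord0 = lift (lift ord0 i) ord0); last by apply: val_inj.
by rewrite tnth_ins_lift tnth0.
Qed.

End Insert.

Section IntegralInsert.
Context d0 (V : measurableType d0) (R : realType) (P : probability V R).
Local Open Scope ereal_scope.

Lemma measurable_ins d (T : measurableType d) n (i : 'I_n.+1) (f : T -> n.-tuple V)
    (g : T -> V) : measurable_fun [set: T] f -> measurable_fun [set: T] g ->
  measurable_fun [set: T] (fun t => ins i (f t) (g t)).
Proof.
move=> mf mg; apply: measurable_fun_tuple => j; case: (unliftP i j) => [k|] ->.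
  under eq_fun do rewrite tnth_ins_lift; exact: measurable_fun_tnth.
by under eq_fun do rewrite tnth_ins.
Qed.

Lemma measurable_integral_ins n (i : 'I_n.+1) (f : n.+1.-tuple V -> \bar R) :
  measurable_fun [set: n.+1.-tuple V] f -> (forall w, 0 <= f w) ->
  measurable_fun [set: n.-tuple V] (fun z => \int[P]_x f (ins i z x)).
Proof.
move=> mf f0.
have := @measurable_fun_fubini_tonelli_F _ _ _ _ _ P
  (fun zx : n.-tuple V * V => f (ins i zx.1 zx.2)).
apply => //; apply: (measurableT_comp mf); exact: measurable_ins.
Qed.

(** Any coordinate can be taken as the innermost integration variable. If [i] is not the head, the
    head is peeled off on both sides and the induction hypothesis acts on the tail. *)
Lemma integral_iid_ins n (i : 'I_n.+1) (f : n.+1.-tuple V -> \bar R) :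
  measurable_fun [set: n.+1.-tuple V] f -> (forall w, 0 <= f w) ->
  \int[iid P n.+1]_w f w = \int[iid P n]_z \int[P]_x f (ins i z x).
Proof.
elim: n i f => [|n IH] i f mf f0.
  rewrite (integral_iidS_swap P mf f0) (ord1 i).
  by under [RHS]eq_integral do under eq_integral do rewrite ins0E.
case: (unliftP ord0 i) => [j|] ->; last first.
  rewrite (integral_iidS_swap P mf f0).
  by under [RHS]eq_integral do under eq_integral do rewrite ins0E.
rewrite (integral_iidS P mf f0).
rewrite (integral_iidS P (measurable_integral_ins (lift ord0 j) mf f0)); last first.
  by move=> z; apply: integral_ge0.
apply: eq_integral => y _; rewrite (IH j).
- by under [RHS]eq_integral do under eq_integral do rewrite insSE.
- by apply: (measurableT_comp mf); exact: measurable_cons.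
- by move=> w; exact: f0.
Qed.

End IntegralInsert.

Definition l1n {R : realType} n (w : n.-tuple R) : R := \sum_(a <- w) `|a|.

Definition scalet {R : realType} n (c : R) (w : n.-tuple R) : n.-tuple R :=
  [tuple of map (fun a => c * a) w].

(** At the zero tuple the inverse of [l1n w] is 0 and the value is again the zero tuple, off the
    sphere; in positive dimension the Laplace law does not charge that point. *)
Definition nrm {R : realType} n (w : n.-tuple R) : n.-tuple R :=
  scalet (l1n w)^-1 w.

Section L1.
Context {R : realType}.
Implicit Types n : nat.

Lemma l1nE n (w : n.-tuple R) : l1n w = \sum_(i < n) `|tnth w i|.
Proof. by rewrite /l1n big_tuple. Qed.

Lemma l1n_ge0 n (w : n.-tuple R) : 0 <= l1n w.
Proof. by rewrite sumr_ge0. Qed.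

Lemma l1n_cons n (v : n.-tuple R) x : l1n [tuple of x :: v] = `|x| + l1n v.
Proof. by rewrite /l1n big_cons. Qed.

Lemma l1n_ins n (i : 'I_n.+1) (z : n.-tuple R) x : l1n (ins i z x) = `|x| + l1n z.
Proof.
rewrite !l1nE (bigD1_ord i)//= tnth_ins; congr (_ + _).
by apply: eq_bigr => j _; rewrite tnth_ins_lift.
Qed.

Lemma tnth_scalet n c (w : n.-tuple R) i : tnth (scalet c w) i = c * tnth w i.
Proof. by rewrite tnth_map. Qed.

Lemma l1n_scalet n c (w : n.-tuple R) : l1n (scalet c w) = `|c| * l1n w.
Proof.
rewrite !l1nE mulr_sumr; apply: eq_bigr => i _.
by rewrite tnth_scalet normrM.
Qed.

Lemma scalet_cons n c (v : n.-tuple R) x :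
  scalet c [tuple of x :: v] = [tuple of c * x :: scalet c v].
Proof. exact: val_inj. Qed.

Lemma scalet_ins n c (i : 'I_n.+1) (z : n.-tuple R) x :
  scalet c (ins i z x) = ins i (scalet c z) (c * x).
Proof.
apply: eq_from_tnth => j; rewrite tnth_scalet.
case: (unliftP i j) => [k|] ->; first by rewrite !tnth_ins_lift tnth_scalet.
by rewrite !tnth_ins.
Qed.

Section Measurability.
Context d (T : measurableType d).

Lemma measurable_l1n n (f : T -> n.-tuple R) : measurable_fun [set: T] f ->
  measurable_fun [set: T] (fun t => l1n (f t)).
Proof.
move=> mf; under eq_fun do rewrite l1nE.
apply: measurable_sum => i; apply: measurableT_comp => //.
exact: measurable_fun_tnth.
Qed.

Lemma measurable_scalet n (c : T -> R) (f : T -> n.-tuple R) :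
  measurable_fun [set: T] c -> measurable_fun [set: T] f ->
  measurable_fun [set: T] (fun t => scalet (c t) (f t)).
Proof.
move=> mc mf; apply: measurable_fun_tuple => i; under eq_fun do rewrite tnth_scalet.
by apply: measurable_funM => //; exact: measurable_fun_tnth.
Qed.

Lemma measurable_nrm n (f : T -> n.-tuple R) : measurable_fun [set: T] f ->
  measurable_fun [set: T] (fun t => nrm (f t)).
Proof.
move=> mf; apply: measurable_scalet => //; apply: measurable_fun_invr_ge0.
  exact: measurable_l1n.
by move=> t; exact: l1n_ge0.
Qed.

End Measurability.

Local Open Scope ereal_scope.

Lemma integral_lap_scale (rho : R) (f : R -> \bar R) : (0 < rho)%R ->
  measurable_fun [set: R] f -> (forall x, 0 <= f x) ->
  \int[lap R]_x ((expR `|x|)%:E * f (rho^-1 * x)%R) =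
  rho%:E * \int[lap R]_x ((expR `|x|)%:E * f x).
Proof.
move=> r0 mf f0.
have mfr : measurable_fun [set: R] (fun x => f (rho^-1 * x)%R).
  by apply: (measurableT_comp mf); exact: measurable_funM.
have me : measurable_fun [set: R] (fun x : R => (expR `|x|)%:E).
  apply/measurable_EFinP; apply: measurableT_comp => //.
have E (g : R -> \bar R) : measurable_fun [set: R] g -> (forall x, 0 <= g x) ->
    \int[@lebesgue_measure R]_x g x = 2%:E * \int[lap R]_x ((expR `|x|)%:E * g x).
  move=> mg g0; rewrite -integral_lap_expR// -ge0_integralZl//.
  - by apply: eq_integral => x _; rewrite EFinM muleA.
  - exact: emeasurable_funM.
  - by move=> x _; rewrite mule_ge0// lee_fin expR_ge0.
have := @integral_lebesgue_affine R rho^-1 0 f.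
rewrite invr_gt0 => /(_ r0 mf f0); under [in RHS]eq_integral do rewrite addr0.
rewrite !E//; set I := \int[_]_x _; set J := \int[_]_x _.
move=> /(congr1 (fun a => (2^-1 * rho)%:E * a)).
have h (x : \bar R) : (2^-1 * rho)%:E * (2%:E * x) = rho%:E * x.
  by rewrite muleA -EFinM; congr (_%:E * _); field.
by rewrite [_%:E * (2%:E * J)]muleCA !h muleA -EFinM divff ?gt_eqF// mul1e => ->.
Qed.

(** Up to the factor [2 ^ n], the weight [expR (l1n z)] turns the Laplace law into Lebesgue measure,
    which is homogeneous of degree [n]; the induction applies [integral_lap_scale] to one coordinate
    at a time. *)
Lemma integral_iid_scale n (rho : R) (f : n.-tuple R -> \bar R) : (0 < rho)%R ->
  measurable_fun [set: n.-tuple R] f -> (forall x, 0 <= f x) ->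
  \int[iid (lap R) n]_z ((expR (l1n z))%:E * f (scalet rho^-1 z)) =
  (rho ^+ n)%:E * \int[iid (lap R) n]_z ((expR (l1n z))%:E * f z).
Proof.
move=> r0; elim: n f => [|n IH] f mf f0.
  rewrite expr0 mul1e; apply: eq_integral => z _; congr (_ * f _).
  by rewrite (tuple0 z); apply: val_inj.
have me m : measurable_fun [set: m.-tuple R] (fun z => (expR (l1n z))%:E).
  apply/measurable_EFinP; apply: measurableT_comp => //; exact: measurable_l1n.
have e0 (a : R) : 0 <= (expR a)%:E by rewrite lee_fin expR_ge0.
have mc x : measurable_fun [set: n.-tuple R] (fun v => f [tuple of x :: v]).
  by apply: (measurableT_comp mf); exact: measurable_cons.
have ms : measurable_fun [set: n.+1.-tuple R]
    (fun z => (expR (l1n z))%:E * f (scalet rho^-1 z)).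
  apply: (emeasurable_funM (me _)).
  apply: (measurableT_comp mf (f := f) (g := fun z => scalet rho^-1 z)).
  by apply: measurable_scalet.
rewrite (integral_iidS (lap R) ms) => [|w]; last exact: mule_ge0.
rewrite (@integral_iidS _ _ _ (lap R) n (fun z => (expR (l1n z))%:E * f z)); last 2 first.
- exact: (emeasurable_funM (me _) mf).
- by move=> w; exact: mule_ge0.
pose K x := \int[iid (lap R) n]_v ((expR (l1n v))%:E * f [tuple of x :: v]).
have K0 x : 0 <= K x by apply: integral_ge0 => v _; exact: mule_ge0.
have mK : measurable_fun [set: R] K.
  have := @measurable_fun_fubini_tonelli_F _ _ _ _ _ (iid (lap R) n)
    (fun xv : R * n.-tuple R => (expR (l1n xv.2))%:E * f [tuple of xv.1 :: xv.2]).
  apply; last by move=> w; exact: mule_ge0.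
  apply: emeasurable_funM; last exact: measurable_comp_consX mf.
  exact: (measurableT_comp (me n) measurable_snd).
have L x : \int[iid (lap R) n]_v ((expR (l1n [tuple of x :: v]))%:E * f [tuple of x :: v])
    = (expR `|x|)%:E * K x.
  rewrite -ge0_integralZl//; last 2 first.
  - exact: (emeasurable_funM (me _) (mc _)).
  - by move=> v _; exact: mule_ge0.
  by apply: eq_integral => v _; rewrite l1n_cons expRD EFinM muleA.
under [in RHS]eq_integral do rewrite L.
rewrite exprS mulrC EFinM -muleA -(integral_lap_scale r0 mK K0).
rewrite -ge0_integralZl//; last 3 first.
- apply: emeasurable_funM.
    apply/measurable_EFinP; apply: measurableT_comp => //.
  by apply: (measurableT_comp mK); exact: measurable_funM.
- by move=> x _; rewrite mule_ge0.
- by rewrite lee_fin exprn_ge0// ltW.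
apply: eq_integral => x _.
rewrite muleCA -(IH _ (mc _))// -ge0_integralZl//; last 2 first.
- apply: (emeasurable_funM (me _)).
  apply: (measurableT_comp (mc _) (g := fun z => scalet rho^-1 z)).
  by apply: measurable_scalet.
- by move=> v _; exact: mule_ge0.
by apply: eq_integral => v _; rewrite l1n_cons expRD EFinM scalet_cons muleA.
Qed.

(** Bridge between the sliced Lebesgue measure in the definition of the uniform law and the
    probability [iid (lap R) n]: each slicing variable contributes one density [2 * expR |x|]. *)
Lemma lebesgue_tupleE n (A : set (n.-tuple R)) : measurable A ->
  lebesgue_tuple A =
  \int[iid (lap R) n]_w ((2 ^+ n * expR (l1n w))%:E * (\1_A w)%:E).
Proof.
have me m : measurable_fun [set: m.-tuple R] (fun z => (2 ^+ m * expR (l1n z))%:E).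
  apply/measurable_EFinP; apply: measurable_funM => //.
  apply: measurableT_comp => //; exact: measurable_l1n.
have mi m (B : set (m.-tuple R)) : measurable B ->
    measurable_fun [set: m.-tuple R] (fun z => (\1_B z)%:E : \bar R).
  by move=> mB; apply/measurable_EFinP.
have p0 m (z : m.-tuple R) (B : set (m.-tuple R)) :
    0 <= (2 ^+ m * expR (l1n z))%:E * (\1_B z)%:E.
  by rewrite mule_ge0// lee_fin mulr_ge0// ?expR_ge0// exprn_ge0.
elim: n A => [|n IH] A mA.
  rewrite integral_iid0; last exact: emeasurable_funM (me _) (mi _ _ _).
  by rewrite /= diracE /l1n big_nil expR0 mul1r mul1e indicE.
rewrite (integral_iidS (lap R) (emeasurable_funM (me _) (mi _ _ mA))) => [|w]; last exact: p0.
pose K x := \int[iid (lap R) n]_v ((2 ^+ n * expR (l1n v))%:E *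
  (\1_A [tuple of x :: v])%:E).
have mK : measurable_fun [set: R] K.
  have := @measurable_fun_fubini_tonelli_F _ _ _ _ _ (iid (lap R) n)
    (fun xv : R * n.-tuple R => (2 ^+ n * expR (l1n xv.2))%:E *
      (\1_A [tuple of xv.1 :: xv.2])%:E).
  apply; last first.
    by move=> w; rewrite mule_ge0// lee_fin mulr_ge0// ?expR_ge0// exprn_ge0.
  apply: emeasurable_funM; last exact: measurable_comp_consX (mi _ _ mA).
  exact: (measurableT_comp (me n) measurable_snd).
have mc (x : R) : measurable [set v : n.-tuple R | A [tuple of x :: v]].
  rewrite -[X in measurable X]setTI; apply: (measurable_cons _ _ measurableT mA) => //.
transitivity (\int[@lebesgue_measure R]_x K x).
  by rewrite /=; apply: eq_integral => x _; rewrite (IH _ (mc x)).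
rewrite -integral_lap_expR; last 2 first.
- exact: mK.
- move=> x; apply: integral_ge0 => v _.
  by rewrite mule_ge0// lee_fin mulr_ge0// ?expR_ge0// exprn_ge0.
apply: eq_integral => x _; rewrite -ge0_integralZl//; last first.
  exact: (emeasurable_funM (me _) (mi n _ (mc x))).
apply: eq_integral => v _; rewrite l1n_cons -!EFinM expRD exprS.
by congr EFin; ring.
Qed.

End L1.

(** * Polar coordinates for the l1-norm *)

Section Polar.
Context {R : realType}.
Local Open Scope ereal_scope.
Notation Q := (iid (lap R)).

(** Up to a constant factor, the surface integral of [phi] over the l1-sphere, seen as two graphs
    over the hyperplane that omits coordinate [i]; [expR (l1n z)] undoes the Laplace density. The
    coordinate is free, because the Stokes formula slices along each axis in turn. *)
Definition sphere_slice n (i : 'I_n.+1) (phi : n.+1.-tuple R -> \bar R) : \bar R :=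
  \int[Q n]_z ((expR (l1n z) * (l1n z <= 1)%R%:R)%:E *
    (phi (ins i z (1 - l1n z)%R) + phi (ins i z (- (1 - l1n z))%R))).

(** The integral of [g x * x ^+ n] over the positive half-line, with the Laplace weight; [x ^+ n] is
    the Jacobian of polar coordinates in dimension [n.+1]. *)
Definition radial n (g : R -> R) : \bar R :=
  \int[lap R]_x ((0 < x)%R%:R * g x * x ^+ n)%:E.

Lemma measurable_nat_of_bool d (T : measurableType d) (b : T -> bool) :
  measurable_fun [set: T] b -> measurable_fun [set: T] (fun t => (b t)%:R : R).
Proof. by move=> mb; apply: (measurableT_comp (f := fun b : bool => b%:R : R) _ mb). Qed.

Section PolarFormula.
Variables (n : nat) (i : 'I_n.+1) (g : R -> R) (phi : n.+1.-tuple R -> \bar R).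
Hypotheses (mg : measurable_fun [set: R] g) (g0 : forall x, (0 <= g x)%R).
Hypotheses (mphi : measurable_fun [set: n.+1.-tuple R] phi)
  (phi0 : forall w, 0 <= phi w).

Let Phi (z : n.-tuple R) (x : R) : \bar R :=
  phi (scalet x^-1 (ins i z (x - l1n z)%R)) +
  phi (scalet x^-1 (ins i z (- (x - l1n z))%R)).

(** The integrand once [x] stands for the l1-norm of the whole tuple instead of its coordinate [i];
    the two terms of [Phi] are the two signs of that coordinate. *)
Let H (z : n.-tuple R) (x : R) : \bar R :=
  ((0 < x)%R%:R * g x * (l1n z <= x)%R%:R * expR (l1n z))%:E * Phi z x.

Let H0 z x : 0 <= H z x.
Proof.
by rewrite mule_ge0 ?adde_ge0// lee_fin !mulr_ge0// expR_ge0.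
Qed.

Lemma measurable_fun_phi d (T : measurableType d) (f : T -> n.+1.-tuple R) :
  measurable_fun [set: T] f -> measurable_fun [set: T] (fun t => phi (f t)).
Proof. exact: (measurableT_comp mphi). Qed.

(** The inverse is handled as that of a nonnegative function: the variable is clipped at 0, exactly
    where the indicator vanishes. *)
Lemma measurable_fun_pos_invr d (T : measurableType d) (x : T -> R) :
  measurable_fun [set: T] x ->
  measurable_fun [set: T] (fun t => (0 < x t)%R%:R * (x t)^-1)%R.
Proof.
move=> mx; rewrite (_ : (fun _ => _) =
  (fun t => (0 < x t)%R%:R * (Num.max 0 (x t))^-1)%R); last first.
  apply/funext => t; case: ltP => h; last by rewrite !mul0r.
  by [].
apply: measurable_funM.
  by apply: measurable_nat_of_bool; exact: measurable_fun_ltr.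
apply: measurable_fun_invr_ge0 => [|t]; last by rewrite le_max lexx.
exact: measurable_maxr.
Qed.

Let mH : measurable_fun [set: n.-tuple R * R] (fun zx => H zx.1 zx.2).
Proof.
rewrite (_ : (fun _ => _) = (fun zx : n.-tuple R * R =>
  ((0 < zx.2)%R%:R * g zx.2 * (l1n zx.1 <= zx.2)%R%:R * expR (l1n zx.1))%:E *
  (phi (scalet ((0 < zx.2)%R%:R * zx.2^-1)%R (ins i zx.1 (zx.2 - l1n zx.1)%R)) +
   phi (scalet ((0 < zx.2)%R%:R * zx.2^-1)%R (ins i zx.1 (- (zx.2 - l1n zx.1))%R))))); 
  last first.
  apply/funext => -[z x]/=; rewrite /H /Phi.
  by case: ltP => h; rewrite ?mul1r// !mul0r mul0e mul0e.
have m1 : measurable_fun [set: n.-tuple R * R] (fun zx => l1n zx.1).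
  by apply: measurable_l1n.
have mp : measurable_fun [set: n.-tuple R * R] (fun zx => (0 < zx.2)%R%:R * zx.2^-1)%R.
  exact: measurable_fun_pos_invr.
have mB : measurable_fun [set: n.-tuple R * R] (fun zx => zx.2 - l1n zx.1)%R.
  exact: measurable_funB.
apply: emeasurable_funM.
  apply/measurable_EFinP; apply: measurable_funM; last first.
    exact: measurableT_comp.
  apply: measurable_funM; last first.
    by apply: measurable_nat_of_bool; exact: measurable_fun_ler.
  apply: measurable_funM; last by apply: (measurableT_comp mg).
  by apply: measurable_nat_of_bool; exact: measurable_fun_ltr.
apply: emeasurable_funD; apply: measurable_fun_phi; apply: measurable_scalet => //.
  exact: measurable_ins.
by apply: measurable_ins => //; exact: measurableT_comp.
Qed.

Let inner (z : n.-tuple R) :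
  \int[lap R]_x ((g (l1n (ins i z x)))%:E * phi (nrm (ins i z x))) =
  \int[lap R]_x H z x.
Proof.
pose c := l1n z; have c0 : (0 <= c)%R by exact: l1n_ge0.
pose G x := (g (l1n (ins i z x)))%:E * phi (nrm (ins i z x)).
have mi : measurable_fun [set: R] (fun x => ins i z x) by exact: measurable_ins.
have mG : measurable_fun [set: R] G.
  apply: emeasurable_funM; last by apply: measurable_fun_phi; exact: measurable_nrm.
  apply/measurable_EFinP; apply: (measurableT_comp mg); exact: measurable_l1n.
have mGN : measurable_fun [set: R] (fun x => G (- x)%R) by apply: (measurableT_comp mG).
have G0 x : 0 <= G x by rewrite mule_ge0// lee_fin.
have mE : measurable_fun [set: R] (fun x : R => (expR (- x) / 2)%:E).
  by apply/measurable_EFinP; apply: measurable_funM => //; apply: measurableT_comp.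
have E0 x : 0 <= (expR (- x) / 2)%:E :> \bar R by rewrite lee_fin divr_ge0 ?expR_ge0.
rewrite (integral_lap mG G0) -ge0_integralD//; last 4 first.
- by move=> x _; rewrite mule_ge0.
- by apply: measurable_funTS; exact: emeasurable_funM.
- by move=> x _; rewrite mule_ge0.
- by apply: measurable_funTS; exact: emeasurable_funM.
pose K x := (0 <= x)%R%:R%:E * (G x * (expR (- x) / 2)%:E + G (- x)%R * (expR (- x) / 2)%:E).
have mb : measurable_fun [set: R] (fun x : R => (0 <= x)%R%:R%:E : \bar R).
  apply/measurable_EFinP; apply: measurable_nat_of_bool; exact: measurable_fun_ler.
have mK : measurable_fun [set: R] K.
  apply: (emeasurable_funM mb); apply: emeasurable_funD; exact: emeasurable_funM.
have K0 x : 0 <= K x by rewrite mule_ge0 ?lee_fin// adde_ge0// mule_ge0.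
transitivity (\int[@lebesgue_measure R]_x K x).
  rewrite integral_mkcond; apply: eq_integral => x _; rewrite patchE /K.
  rewrite mem_setE in_itv/= andbT; case: ifPn; rewrite ?mul1e ?mul0e//.
(* A translation by [c = l1n z]: the new variable is the l1-norm of the whole tuple. *)
rewrite (@integral_lebesgue_affine _ 1 (- c))// mul1e.
rewrite -integral_lap_expR//; last first.
  by apply: (measurableT_comp mK); apply: measurable_funD => //; exact: measurable_funM.
apply: ae_eq_integral => //.
- apply: emeasurable_funM.
    apply/measurable_EFinP; apply: measurable_funM => //.
    by apply: measurableT_comp => //; exact: normr_measurable.
  by apply: (measurableT_comp mK); apply: measurable_funD => //; exact: measurable_funM.
- exact: (measurableT_comp mH (pair1_measurable z)).
(* At 0 the indicator [0 < x] in [H] is zero while the other integrand may be positive; this is the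
   only exceptional point. *)
exists [set 0%R]; split; [exact: measurable_set1|exact: lap_set1|].
move=> x /= /not_implyP[_ /eqP]; apply: contraNP => /eqP x0.
apply/eqP; rewrite mul1r /K /H.
rewrite subr_ge0; case: (leP c x) => cx; rewrite /c in cx; last first.
  by rewrite !(mulr0, mul0r, mul0e, mule0).
have xp : (0 < x)%R by rewrite lt_neqAle eq_sym x0 (le_trans c0).
have l1 : l1n (ins i z (x - c)%R) = x.
  by rewrite l1n_ins ger0_norm ?subr_ge0// subrK.
have l2 : l1n (ins i z (- (x - c))%R) = x.
  by rewrite l1n_ins normrN ger0_norm ?subr_ge0// subrK.
rewrite xp /G /nrm l1 l2.
rewrite -ge0_muleDl ?mule_ge0 ?lee_fin// -ge0_muleDr// -/c -/(Phi z x).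
rewrite mul1e [_ * Phi z x * _]muleAC -EFinM muleA -EFinM; congr (EFin _ * Phi z x).
rewrite (gtr0_norm xp) opprB expRD expRN.
have := expR_gt0 x; move: (expR x) => e e0.
have -> : true%:R = 1%R :> R by [].
by field; rewrite gt_eqF.
Qed.

(** By [inner], the norm becomes an integration variable [x]. Exchanging the integrals and rescaling
    [z] by [x] makes the angular integral independent of [x], at the price of the Jacobian
    [x ^+ n]. *)
Lemma polar : \int[Q n.+1]_w ((g (l1n w))%:E * phi (nrm w)) =
  radial n g * sphere_slice i phi.
Proof.
have mL : measurable_fun [set: n.+1.-tuple R] (fun w => (g (l1n w))%:E * phi (nrm w)).
  apply: emeasurable_funM; last by apply: measurable_fun_phi; exact: measurable_nrm.
  by apply/measurable_EFinP; apply: (measurableT_comp mg); exact: measurable_l1n.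
rewrite (integral_iid_ins (lap R) i mL) => [|w]; last by rewrite mule_ge0// lee_fin.
under eq_integral do rewrite inner.
rewrite (@fubini_tonelli _ _ _ _ _ (Q n) (lap R) (fun zx => H zx.1 zx.2) mH); last first.
  by move=> zx; exact: H0.
pose M (z : n.-tuple R) := ((l1n z <= 1)%R%:R)%:E *
  (phi (ins i z (1 - l1n z)%R) + phi (ins i z (- (1 - l1n z))%R)).
have M0 z : 0 <= M z by rewrite mule_ge0 ?adde_ge0// lee_fin.
have m1 : measurable_fun [set: n.-tuple R] (fun z : n.-tuple R => 1 - l1n z)%R.
  by apply: measurable_funB => //; exact: measurable_l1n.
have mM : measurable_fun [set: n.-tuple R] M.
  apply: emeasurable_funM.
    apply/measurable_EFinP; apply: measurable_nat_of_bool.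
    by apply: measurable_fun_ler => //; exact: measurable_l1n.
  apply: emeasurable_funD; apply: measurable_fun_phi; apply: measurable_ins => //.
  exact: measurableT_comp.
have me : measurable_fun [set: n.-tuple R] (fun z : n.-tuple R => (expR (l1n z))%:E).
  by apply/measurable_EFinP; apply: measurableT_comp => //; exact: measurable_l1n.
have sE : sphere_slice i phi = \int[Q n]_z ((expR (l1n z))%:E * M z).
  by apply: eq_integral => z _; rewrite /M EFinM muleA.
have s0 : 0 <= sphere_slice i phi.
  by rewrite sE; apply: integral_ge0 => z _; rewrite mule_ge0// lee_fin expR_ge0.
rewrite /radial -ge0_integralZr//; last 2 first.
- apply/measurable_EFinP; apply: measurable_funM; last exact: measurable_funX.
  apply: measurable_funM => //; apply: measurable_nat_of_bool.
  exact: measurable_fun_ltr.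
- by move=> x _; rewrite lee_fin; case: ltP => x0; rewrite !(mul0r, mul1r)// mulr_ge0// exprn_ge0// ltW.
apply: eq_integral => x _; rewrite /H /=.
case: (ltP 0%R x) => x0; last first.
  by rewrite !mul0r mul0e; apply: integral0_eq => z _; rewrite !mul0r mul0e.
have tE : true%:R = 1%R :> R by [].
transitivity ((g x)%:E * \int[Q n]_z ((expR (l1n z))%:E * M (scalet x^-1 z))); last first.
  by rewrite (integral_iid_scale x0 mM M0) -sE muleA -EFinM tE mul1r.
rewrite -ge0_integralZl//; last 3 first.
- apply: (emeasurable_funM me); apply: (measurableT_comp mM (g := fun z => scalet x^-1 z)).
  exact: measurable_scalet.
- by move=> z _; rewrite mule_ge0// lee_fin expR_ge0.
- by rewrite lee_fin.
apply: eq_integral => z _; rewrite /M /Phi !scalet_ins l1n_scalet tE mul1r.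
rewrite gtr0_norm ?invr_gt0//.
have -> : (x^-1 * l1n z <= 1)%R = (l1n z <= x)%R.
  by rewrite mulrC ler_pdivrMr// mul1r.
have -> : (x^-1 * (x - l1n z) = 1 - x^-1 * l1n z)%R by field; rewrite gt_eqF.
have -> : (x^-1 * - (x - l1n z) = - (1 - x^-1 * l1n z))%R by field; rewrite gt_eqF.
by rewrite !muleA -!EFinM; congr (EFin _ * _); ring.
Qed.

End PolarFormula.
End Polar.

(** * The uniform law of the l1-sphere *)

Section SphereLaw.
Context {R : realType}.
Local Open Scope ereal_scope.
Notation Q := (iid (lap R)).

Lemma measurable_nrmT n : measurable_fun [set: n.-tuple R] (@nrm R n).
Proof. exact: measurable_nrm. Qed.

HB.instance Definition _ n := isMeasurableFun.Build _ _ _ _ (@nrm R n) (@measurable_nrmT n).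

Definition sphere_law n : probability (n.-tuple R) R := distribution (Q n) (@nrm R n).

Lemma integral_sphere_law n (f : n.-tuple R -> \bar R) :
  measurable_fun [set: n.-tuple R] f -> (forall x, 0 <= f x) ->
  \int[sphere_law n]_s f s = \int[Q n]_w f (nrm w).
Proof. by move=> mf f0; rewrite /sphere_law ge0_integral_pushforward. Qed.

Lemma radial_slice1 n (i : 'I_n.+1) :
  @radial R n (cst 1%R) * sphere_slice i (cst 1) = 1.
Proof.
rewrite -polar//; transitivity (\int[Q n.+1]_(w in setT) (cst 1 w)).
  by apply: eq_integral => w _; rewrite mule1.
by rewrite integral_cst// mul1e [LHS]probability_setT.
Qed.

Lemma radial_ge0 n (g : R -> R) : (forall x, (0 <= g x)%R) -> 0 <= @radial R n g.
Proof.
move=> g0; apply: integral_ge0 => x _; rewrite lee_fin.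
by case: ltP => x0; rewrite !(mul0r, mul1r)// mulr_ge0// exprn_ge0// ltW.
Qed.

Lemma sphere_slice_ge0 n (i : 'I_n.+1) (phi : n.+1.-tuple R -> \bar R) :
  (forall w, 0 <= phi w) -> 0 <= sphere_slice i phi.
Proof.
move=> p0; apply: integral_ge0 => z _; by rewrite mule_ge0 ?adde_ge0.
Qed.

Lemma integral_sphere_slice n (i : 'I_n.+1) (phi : n.+1.-tuple R -> \bar R) :
  measurable_fun [set: n.+1.-tuple R] phi -> (forall w, 0 <= phi w) ->
  \int[sphere_law n.+1]_s phi s = @radial R n (cst 1%R) * sphere_slice i phi.
Proof.
move=> mphi p0; rewrite integral_sphere_law// -polar//.
by apply: eq_integral => w _; rewrite mul1e.
Qed.

(** Independence of [l1n w] and [nrm w]: by [polar] both sides are products of a radial and an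
    angular factor, and the normalizations cancel through [radial_slice1]. *)
Lemma integral_l1n_nrm n (g : R -> R) (phi : n.+1.-tuple R -> \bar R) :
  measurable_fun [set: R] g -> (forall x, (0 <= g x)%R) ->
  measurable_fun [set: n.+1.-tuple R] phi -> (forall w, 0 <= phi w) ->
  \int[Q n.+1]_w ((g (l1n w))%:E * phi (nrm w)) =
  (\int[Q n.+1]_w (g (l1n w))%:E) * (\int[sphere_law n.+1]_s phi s).
Proof.
move=> mg g0 mphi p0; rewrite (polar ord0)//.
transitivity ((@radial R n g * @sphere_slice R n ord0 (cst 1)) *
   \int[sphere_law n.+1]_s phi s); last first.
  congr (_ * _); rewrite -(polar ord0)//; apply: eq_integral => w _.
  by rewrite mule1.
rewrite (integral_sphere_slice ord0)//.
set a := radial _ g; set b := radial _ _; set c := sphere_slice _ phi.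
set v := sphere_slice _ _.
have bv : b * v = 1 by exact: (radial_slice1 ord0).
by rewrite -muleA (muleA v) (muleC v) bv mul1e.
Qed.


Lemma l1_sphere_graphE n (eps : R) (z : n.-tuple R) :
  @l1_sphere_graph R n.+1 eps z = ins ord_max z (eps * (1 - l1n z))%R.
Proof.
apply: eq_from_tnth => j; rewrite tnth_mktuple.
case: (unliftP ord_max j) => [k|] ->.
  by rewrite tnth_ins_lift lift_max (tnth_nth (eps * (1 - \sum_(a <- z) `|a|))%R).
by rewrite tnth_ins nth_default//= size_tuple.
Qed.

(** The square root is the area element and [2 ^+ n] comes from [lebesgue_tupleE]; both cancel in
    the normalized law. *)
Lemma l1_sphere_areaE n (A : set (n.+1.-tuple R)) : measurable A ->
  @l1_sphere_area R n.+1 A = (Num.sqrt n.+1%:R * 2 ^+ n)%:E *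
    sphere_slice ord_max (fun w => (\1_A w)%:E).
Proof.
move=> mA; pose B (eps : R) := [set z : n.-tuple R |
  (\sum_(a <- z) `|a| <= 1)%R /\ A (@l1_sphere_graph R n.+1 eps z)].
have mi (eps : R) : measurable_fun [set: n.-tuple R]
    (fun z : n.-tuple R => ins ord_max z (eps * (1 - l1n z))%R).
  apply: measurable_ins => //; apply: measurable_funM => //.
  by apply: measurable_funB => //; exact: measurable_l1n.
have mb : measurable_fun [set: n.-tuple R] (fun z : n.-tuple R => (l1n z <= 1)%R).
  by apply: measurable_fun_ler => //; exact: measurable_l1n.
have mB eps : measurable (B eps).
  rewrite (_ : B eps = (fun z : n.-tuple R => (l1n z <= 1)%R) @^-1` [set true] `&`
     (fun z : n.-tuple R => ins ord_max z (eps * (1 - l1n z))%R) @^-1` A); last first.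
    by apply/seteqP; split => z; rewrite /B /= l1_sphere_graphE /l1n.
  apply: measurableI; rewrite -[X in measurable X]setTI.
    exact: mb.
  exact: mi.
have m1 : measurable_fun [set: n.+1.-tuple R] (fun w => (\1_A w)%:E : \bar R).
  exact/measurable_EFinP.
have mt : measurable_fun [set: n.-tuple R]
   (fun z : n.-tuple R => (expR (l1n z) * (l1n z <= 1)%R%:R)%:E).
  apply/measurable_EFinP; apply: measurable_funM.
    by apply: measurableT_comp => //; exact: measurable_l1n.
  exact: measurable_nat_of_bool.
have mh (eps : R) : measurable_fun [set: n.-tuple R] (fun z : n.-tuple R =>
    (expR (l1n z) * (l1n z <= 1)%R%:R)%:E *
    (\1_A (ins ord_max z (eps * (1 - l1n z))%R))%:E).
  by apply: (emeasurable_funM mt); apply: (measurableT_comp m1).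
have h0 (eps : R) (z : n.-tuple R) : 0 <= (expR (l1n z) * (l1n z <= 1)%R%:R)%:E *
    (\1_A (ins ord_max z (eps * (1 - l1n z))%R))%:E.
  by rewrite mule_ge0// lee_fin// mulr_ge0// expR_ge0.
have LE (eps : R) : lebesgue_tuple (B eps) = (2 ^+ n)%:E * \int[Q n]_z (
    (expR (l1n z) * (l1n z <= 1)%R%:R)%:E * (\1_A (ins ord_max z (eps * (1 - l1n z))%R))%:E).
  rewrite lebesgue_tupleE// -ge0_integralZl//.
  apply: eq_integral => z _; rewrite -!EFinM; congr EFin.
  rewrite -!mulrA; congr (_ * (_ * _))%R.
  rewrite !indicE /B; case: (leP (l1n z) 1%R) => z1; last first.
    by rewrite mul0r memNset//= => -[]; rewrite leNgt -/(l1n z) z1.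
  rewrite mul1r; congr (_%:R); congr nat_of_bool; apply/idP/idP; rewrite !inE /= l1_sphere_graphE.
    by case.
  by [].
rewrite /l1_sphere_area !big_cons big_nil adde0 -!/(B _) !LE.
rewrite [in RHS]EFinM -!muleA -ge0_muleDr; last 2 first.
- by rewrite mule_ge0 ?lee_fin ?exprn_ge0//; apply: integral_ge0 => z _; exact: h0.
- by rewrite mule_ge0 ?lee_fin ?exprn_ge0//; apply: integral_ge0 => z _; exact: h0.
congr (_ * _); rewrite -ge0_muleDr; last 2 first.
- by apply: integral_ge0 => z _; exact: h0.
- by apply: integral_ge0 => z _; exact: h0.
congr (_ * _); rewrite -ge0_integralD//.
apply: eq_integral => z _; rewrite -ge0_muleDr ?lee_fin//.
by rewrite mul1r mulN1r.
Qed.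

(** Both laws are the normalization of the same slice integral along the last coordinate. *)
Lemma uniform_l1_sphereE n (A : set (n.+1.-tuple R)) : measurable A ->
  uniform_l1_sphere A = sphere_law n.+1 A.
Proof.
move=> mA.
have m1 (B : set (n.+1.-tuple R)) : measurable B ->
    measurable_fun [set: n.+1.-tuple R] (fun w => (\1_B w)%:E : \bar R).
  by move=> mB; exact/measurable_EFinP.
have lawE B : measurable B -> sphere_law n.+1 B =
    radial n (cst 1%R) * sphere_slice ord_max (fun w => (\1_B w)%:E).
  move=> mB; rewrite -integral_sphere_slice//; last exact: m1.
  by rewrite integral_indic// setIT.
rewrite /uniform_l1_sphere !l1_sphere_areaE//.
have := lawE _ mA; have := lawE _ measurableT.
have := @radial_ge0 n (cst 1%R) (fun=> ler01).
have i0 (B : set (n.+1.-tuple R)) w : 0 <= (\1_B w)%:E :> \bar R by rewrite lee_fin.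
have := sphere_slice_ge0 ord_max (i0 A).
have := sphere_slice_ge0 ord_max (i0 setT).
set b := sphere_slice _ _; set a := sphere_slice _ _; set r := radial _ _.
move=> b0 a0 r0 bE aE.
have PA1 : sphere_law n.+1 A <= 1 := probability_le1 _ mA.
rewrite probability_setT in bE.
have rb : r != 0 /\ b != 0.
  by split; apply/eqP => h; move: bE; rewrite h ?mul0e ?mule0 => /eqP; rewrite onee_eq0.
case: rb => rn bn.
have rp : 0 < r by rewrite lt0e rn.
have bp : 0 < b by rewrite lt0e bn.
(* [fine] sends infinite values to 0, so all three factors must be seen to be finite; for [r] and
   [b] this follows from [r * b = 1], for [a] from a probability being at most 1. *)
have [rr rE] : exists x, r = x%:E.
  case: (r) rp bE => [x _ _|_ /esym|//]; first by exists x.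
  by rewrite gt0_mulye.
have [bb bE'] : exists x, b = x%:E.
  case: (b) bp bE => [x _ _|_ /esym|//]; first by exists x.
  by rewrite gt0_muley.
have [aa aE'] : exists x, a = x%:E.
  case: (a) a0 aE PA1 => [x _ _ _|_ ->|//]; first by exists x.
  by rewrite gt0_muley.
rewrite aE rE aE' bE' -!EFinM /=; congr EFin.
move: bE; rewrite rE bE' -EFinM => -[h].
move: rn bn; rewrite rE bE' !eqe => rn bn.
have sn : (Num.sqrt n.+1%:R * 2 ^+ n != 0 :> R)%R.
  by rewrite mulf_neq0 ?expf_neq0// gt_eqF// sqrtr_gt0.
have -> : rr = (bb^-1)%R by apply: (mulIf bn); rewrite mulVf.
move: sn; set k := (_ * 2 ^+ n)%R => sn.
by field; rewrite bn sn.
Qed.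

Definition l2sq n (w : n.-tuple R) : R := \sum_(a <- w) a ^+ 2.

Lemma l2sq_cons n (v : n.-tuple R) x : l2sq [tuple of x :: v] = (x ^+ 2 + l2sq v)%R.
Proof. by rewrite /l2sq big_cons. Qed.

Lemma l2sq_ge0 n (v : n.-tuple R) : (0 <= l2sq v)%R.
Proof. by rewrite sumr_ge0// => i _; rewrite sqr_ge0. Qed.

Lemma l2sqE n (w : n.-tuple R) : l2sq w = (\sum_(i < n) (tnth w i) ^+ 2)%R.
Proof. by rewrite /l2sq big_tuple. Qed.

Lemma l2sq_scalet n c (w : n.-tuple R) : l2sq (scalet c w) = (c ^+ 2 * l2sq w)%R.
Proof.
rewrite !l2sqE mulr_sumr; apply: eq_bigr => i _.
by rewrite tnth_scalet exprMn.
Qed.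

Lemma measurable_l2sq n : measurable_fun [set: n.-tuple R] (@l2sq n).
Proof.
rewrite (_ : @l2sq n = fun w => (\sum_(i < n) (tnth w i) ^+ 2)%R); last first.
  by apply/funext => w; rewrite l2sqE.
by apply: measurable_sum => i; apply: measurable_funX; exact: measurable_tnth.
Qed.


Section ProbabilityIntegral.
Context d (T : measurableType d) (P : probability T R).

Lemma integral_cst_probability (r : \bar R) : \int[P]_x r = r.
Proof.
have := integral_cst P measurableT r.
move=> ->; rewrite [X in _ * X](_ : _ = 1) ?mule1//.
exact: (probability_setT P).
Qed.

Lemma ge0_integralDcst (f : T -> R) (a : R) : (0 <= a)%R ->
  measurable_fun [set: T] f -> (forall x, (0 <= f x)%R) ->
  \int[P]_x (a + f x)%:E = a%:E + \int[P]_x (f x)%:E.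
Proof.
move=> a0 mf f0; under eq_integral do rewrite EFinD.
rewrite ge0_integralD//; last exact/measurable_EFinP.
  by rewrite integral_cst_probability.
by move=> x _; rewrite lee_fin.
Qed.

End ProbabilityIntegral.

Lemma measurable_normT : measurable_fun [set: R] (fun x : R => `|x|%R).
Proof. exact: normr_measurable. Qed.

Lemma integral_l1n n : \int[Q n]_w (l1n w)%:E = n%:R%:E.
Proof.
elim: n => [|n IH].
  rewrite integral_iid0; last by apply/measurable_EFinP; exact: measurable_l1n.
  by rewrite /l1n big_nil.
have ml m : measurable_fun [set: m.-tuple R] (fun w => (l1n w)%:E).
  by apply/measurable_EFinP; exact: measurable_l1n.
rewrite (integral_iidS (lap R) (ml _)) => [|w]; last by rewrite lee_fin l1n_ge0.
transitivity (\int[lap R]_x (n%:R + `|x|)%:E).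
  apply: eq_integral => x _; under eq_integral do rewrite l1n_cons.
  rewrite ge0_integralDcst//; last by move=> v; exact: l1n_ge0.
    by rewrite IH -EFinD addrC.
  exact: measurable_l1n.
rewrite ge0_integralDcst//.
by rewrite integral_lap_normr -EFinD -natr1.
Qed.

Lemma integral_l2sq n : \int[Q n]_w (l2sq w)%:E = (2 * n%:R)%:E.
Proof.
elim: n => [|n IH].
  rewrite integral_iid0; last by apply/measurable_EFinP; exact: measurable_l2sq.
  by rewrite /l2sq big_nil mulr0.
have ml m : measurable_fun [set: m.-tuple R] (fun w => (l2sq w)%:E).
  by apply/measurable_EFinP; exact: measurable_l2sq.
rewrite (integral_iidS (lap R) (ml _)) => [|w]; last by rewrite lee_fin l2sq_ge0.
transitivity (\int[lap R]_x (2 * n%:R + x ^+ 2)%:E).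
  apply: eq_integral => x _; under eq_integral do rewrite l2sq_cons.
  rewrite ge0_integralDcst ?sqr_ge0//; last by move=> v; exact: l2sq_ge0.
    by rewrite IH -EFinD addrC.
  exact: measurable_l2sq.
rewrite ge0_integralDcst//; last by move=> x; exact: sqr_ge0.
by rewrite integral_lap_sqr -EFinD; congr EFin; ring.
Qed.

Lemma integral_sqr_l1n n : \int[Q n]_w (l1n w ^+ 2)%:E = (n%:R ^+ 2 + n%:R)%:E.
Proof.
elim: n => [|n IH].
  rewrite integral_iid0; last first.
    by apply/measurable_EFinP; apply: measurable_funX; exact: measurable_l1n.
  by rewrite /l1n big_nil expr0n addr0.
have ml m : measurable_fun [set: m.-tuple R] (fun w => (l1n w ^+ 2)%:E).
  by apply/measurable_EFinP; apply: measurable_funX; exact: measurable_l1n.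
rewrite (integral_iidS (lap R) (ml _)) => [|w]; last by rewrite lee_fin sqr_ge0.
transitivity (\int[lap R]_x ((n%:R ^+ 2 + n%:R)%:E + ((x ^+ 2)%:E + (2 * n%:R)%:E * `|x|%:E))).
  apply: eq_integral => x _.
  under eq_integral do rewrite l1n_cons sqrrD -mulr_natl real_normK ?num_real// -addrA.
  rewrite ge0_integralDcst ?sqr_ge0//; last 2 first.
  - apply: measurable_funD; last by apply: measurable_funX; exact: measurable_l1n.
    apply: measurable_funM => //; apply: measurable_funM => //; exact: measurable_l1n.
  - by move=> v; rewrite addr_ge0 ?sqr_ge0// mulr_ge0// mulr_ge0// l1n_ge0.
  under eq_integral do rewrite EFinD.
  have mf1 : measurable_fun [set: n.-tuple R] (fun v => (2 * (`|x| * l1n v))%:E).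
    apply/measurable_EFinP; apply: measurable_funM => //; apply: measurable_funM => //.
    exact: measurable_l1n.
  have f10 (v : n.-tuple R) : setT v -> 0 <= (2 * (`|x| * l1n v))%:E.
    by move=> _; rewrite lee_fin !mulr_ge0// l1n_ge0.
  have f20 (v : n.-tuple R) : setT v -> 0 <= (l1n v ^+ 2)%:E.
    by move=> _; rewrite lee_fin sqr_ge0.
  rewrite (ge0_integralD (Q n) measurableT f10 mf1 f20 (ml n)).
  have -> : \int[Q n]_v (2 * (`|x| * l1n v))%:E = (2 * `|x|)%:E * \int[Q n]_v (l1n v)%:E.
    rewrite -ge0_integralZl//.
    - by apply: eq_integral => v _; rewrite -EFinM mulrA.
    - by apply/measurable_EFinP; exact: measurable_l1n.
    - by move=> v _; rewrite lee_fin l1n_ge0.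
  rewrite IH integral_l1n -!EFinM -!EFinD; congr EFin; ring.
have m1 : measurable_fun [set: R] (fun x : R => (2 * n%:R)%:E * `|x|%:E).
  apply: emeasurable_funM => //; apply/measurable_EFinP; exact: measurable_normT.
have m2 : measurable_fun [set: R] (fun x : R => (x ^+ 2)%:E).
  by apply/measurable_EFinP; apply: measurable_funX.
have p1 (x : R) : setT x -> 0 <= (2 * n%:R)%:E * `|x|%:E by rewrite -EFinM lee_fin !mulr_ge0.
have p2 (x : R) : setT x -> 0 <= (x ^+ 2)%:E by rewrite lee_fin sqr_ge0.
have m12 := emeasurable_funD m2 m1.
have p12 (x : R) : setT x -> 0 <= (x ^+ 2)%:E + (2 * n%:R)%:E * `|x|%:E.
  by move=> _; rewrite adde_ge0// ?p1 ?p2.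
have p0 (x : R) : setT x -> 0 <= (n%:R ^+ 2 + n%:R)%:E :> \bar R.
  by rewrite lee_fin addr_ge0// sqr_ge0.
rewrite (ge0_integralD (lap R) measurableT p0 (@measurable_cst _ _ _ _ _ _) p12 m12).
rewrite integral_cst_probability (ge0_integralD (lap R) measurableT p2 m2 p1 m1).
rewrite ge0_integralZl//.
rewrite integral_lap_normr integral_lap_sqr mule1 -!EFinD; first by congr EFin; ring.
by apply/measurable_EFinP; exact: measurable_normT.
Qed.

Lemma integral_l1n_variance n :
  \int[Q n]_w ((l1n w - n%:R) ^+ 2)%:E = n%:R%:E.
Proof.
have mv : measurable_fun [set: n.-tuple R] (fun w => ((l1n w - n%:R) ^+ 2)%:E).
  apply/measurable_EFinP; apply: measurable_funX; apply: measurable_funB => //.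
  exact: measurable_l1n.
have ml : measurable_fun [set: n.-tuple R] (fun w => ((2 * n%:R)%:E * (l1n w)%:E)).
  by apply: emeasurable_funM => //; apply/measurable_EFinP; exact: measurable_l1n.
(* The cross term of the square is moved to the other side, so that only nonnegative functions are
   integrated. *)
have h : \int[Q n]_w (((l1n w - n%:R) ^+ 2)%:E + ((2 * n%:R)%:E * (l1n w)%:E)) =
    \int[Q n]_w (n%:R ^+ 2 + l1n w ^+ 2)%:E.
  by apply: eq_integral => w _; rewrite -EFinM -EFinD; congr EFin; ring.
have p1 (w : n.-tuple R) : setT w -> 0 <= ((l1n w - n%:R) ^+ 2)%:E by rewrite lee_fin sqr_ge0.
have p2 (w : n.-tuple R) : setT w -> 0 <= (2 * n%:R)%:E * (l1n w)%:E.
  by move=> _; rewrite -EFinM lee_fin !mulr_ge0// l1n_ge0.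
move: h; rewrite (ge0_integralD (Q n) measurableT p1 mv p2 ml).
rewrite ge0_integralZl//; last 2 first.
- by apply/measurable_EFinP; exact: measurable_l1n.
- by move=> w _; rewrite lee_fin l1n_ge0.
rewrite integral_l1n ge0_integralDcst ?sqr_ge0//; last 2 first.
- by apply: measurable_funX; exact: measurable_l1n.
- by move=> w; exact: sqr_ge0.
rewrite integral_sqr_l1n -EFinM -EFinD.
case: (\int[_]_w _) => [x|//|//]; rewrite -EFinD => -[h]; congr EFin; lra.
Qed.

(** With [d = n.+1], independence factors [E |w|_2^2 = 2 d] as [E |w|_1^2 * E |s|_2^2], where
    [E |w|_1^2 = d (d + 1)]. *)
Lemma integral_l2sq_nrm n : (n.+2%:R * n.+1%:R)%:E *
  \int[sphere_law n.+1]_s (l2sq s)%:E = (2 * n.+1%:R)%:E.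
Proof.
rewrite -integral_l2sq.
have := @integral_l1n_nrm n (fun x => x ^+ 2)%R (fun w => (l2sq w)%:E).
rewrite integral_sqr_l1n => h; rewrite (_ : (_ * _)%R = n.+1%:R ^+ 2 + n.+1%:R)%R; last first.
  by ring.
rewrite -h//; last 3 first.
- by move=> x; exact: sqr_ge0.
- by apply/measurable_EFinP; exact: measurable_l2sq.
- by move=> w; rewrite lee_fin l2sq_ge0.
apply: eq_integral => w _; rewrite -EFinM; congr EFin.
rewrite /nrm l2sq_scalet.
have [w0|w0] := eqVneq (l1n w) 0%R; last by rewrite mulrA -exprMn divff// expr1n mul1r.
suff -> : l2sq w = 0%R by rewrite mulr0 mulr0.
rewrite l2sqE big1// => i _; apply/eqP; rewrite sqrf_eq0.
move: w0; rewrite l1nE => /eqP; rewrite psumr_eq0// => /allP/(_ i).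
by rewrite mem_index_enum normr_eq0; apply.
Qed.

(** Since [s - w / d = (1 - |w|_1 / d) s], this is the computation of [E |s - w / d|_2^2], up to the
    factor [d^2]: by independence it combines the variance [d] of [|w|_1] with the second moment of
    [s]. *)
Lemma integral_nrm_dist n : (n.+2%:R * n.+1%:R)%:E *
  \int[Q n.+1]_w (l2sq (nrm w) * (l1n w - n.+1%:R) ^+ 2)%:E =
  (2 * n.+1%:R * n.+1%:R)%:E.
Proof.
transitivity ((n.+2%:R * n.+1%:R)%:E * (n.+1%:R%:E *
  \int[sphere_law n.+1]_s (l2sq s)%:E) : \bar R).
  rewrite -integral_l1n_variance -(@integral_l1n_nrm n (fun x => (x - n.+1%:R) ^+ 2)%R)//.
  - by congr (_ * _); apply: eq_integral => w _; rewrite -EFinM mulrC.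
  - by apply: measurable_funX; exact: measurable_funB.
  - by move=> x; exact: sqr_ge0.
  - by apply/measurable_EFinP; exact: measurable_l2sq.
  - by move=> w; rewrite lee_fin l2sq_ge0.
by rewrite muleCA integral_l2sq_nrm -EFinM; congr EFin; ring.
Qed.

End SphereLaw.

(** * Bounded measurable functions and the Poincare inequality *)

Section BoundedMeasurable.
Context d (T : measurableType d) (R : realType).
Implicit Types f g : T -> R.

(** A class closed under all the operations at hand and integrable for every probability, so that
    means add, scale and commute without further side conditions. *)
Definition bmeas f := measurable_fun [set: T] f /\ exists M, forall x, `|f x| <= M.

Lemma bmeasW f : bmeas f -> measurable_fun [set: T] f.
Proof. by case. Qed.

Lemma bmeas_cst c : bmeas (fun=> c).
Proof. by split => //; exists `|c|. Qed.

Lemma bmeasD f g : bmeas f -> bmeas g -> bmeas (fun x => f x + g x).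
Proof.
move=> [mf [M fM]] [mg [N gN]]; split; first exact: measurable_funD.
by exists (M + N) => x; rewrite (le_trans (ler_normD _ _))// lerD.
Qed.

Lemma bmeasN f : bmeas f -> bmeas (fun x => - f x).
Proof.
move=> [mf [M fM]]; split; first exact: measurableT_comp.
by exists M => x; rewrite normrN.
Qed.

Lemma bmeasB f g : bmeas f -> bmeas g -> bmeas (fun x => f x - g x).
Proof. by move=> bf bg; apply: bmeasD => //; exact: bmeasN. Qed.

Lemma bmeasM f g : bmeas f -> bmeas g -> bmeas (fun x => f x * g x).
Proof.
move=> [mf [M fM]] [mg [N gN]]; split; first exact: measurable_funM.
by exists (M * N) => x; rewrite normrM ler_pM.
Qed.

Lemma bmeasX f n : bmeas f -> bmeas (fun x => f x ^+ n).
Proof.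
move=> bf; elim: n => [|n IH]; first exact: bmeas_cst.
by under eq_fun do rewrite exprS; exact: bmeasM.
Qed.

Lemma bmeas_sum (I : Type) (s : seq I) (F : I -> T -> R) :
  (forall i, bmeas (F i)) -> bmeas (fun x => \sum_(i <- s) F i x).
Proof.
move=> bF; elim: s => [|i s IH].
  by under eq_fun do rewrite big_nil; exact: bmeas_cst.
by under eq_fun do rewrite big_cons; exact: bmeasD.
Qed.

Lemma bmeas_nat_of_bool (b : T -> bool) : measurable_fun [set: T] b ->
  bmeas (fun x => (b x)%:R).
Proof.
move=> mb; split; first exact: measurable_nat_of_bool.
by exists 1 => x; case: (b x); rewrite ?normr1 ?normr0.
Qed.

Lemma bmeas_bounded f (M : R) : measurable_fun [set: T] f ->
  (forall x, `|f x| <= M) -> bmeas f.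
Proof. by move=> mf fM; split => //; exists M. Qed.

Variable P : probability T R.

Lemma bmeas_integrable f : bmeas f -> P.-integrable [set: T] (EFin \o f).
Proof.
move=> [mf [M fM]]; apply: measurable_bounded_integrable => //.
  by rewrite [X in (X < _)%E](probability_setT P) ltry.
exists M; split; first by rewrite num_real.
by move=> x Mx y _ /=; exact: le_trans (fM y) (ltW Mx).
Qed.

Definition mean f : R := \int[P]_x f x.

Lemma meanE f : bmeas f -> (\int[P]_x (f x)%:E = (mean f)%:E)%E.
Proof.
move=> bf; rewrite /mean /Rintegral fineK//.
exact: (integrable_fin_num _ (bmeas_integrable bf)).
Qed.

Lemma eq_mean f g : f =1 g -> mean f = mean g.
Proof. by move=> fg; congr mean; exact/funext. Qed.

Lemma mean_cst c : mean (fun=> c) = c.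
Proof. by rewrite /mean /Rintegral integral_cst_probability. Qed.

Lemma meanD f g : bmeas f -> bmeas g -> mean (fun x => f x + g x) = mean f + mean g.
Proof. by move=> bf bg; rewrite /mean RintegralD//; exact: bmeas_integrable. Qed.

Lemma meanB f g : bmeas f -> bmeas g -> mean (fun x => f x - g x) = mean f - mean g.
Proof. by move=> bf bg; rewrite /mean RintegralB//; exact: bmeas_integrable. Qed.

Lemma meanZ c f : bmeas f -> mean (fun x => c * f x) = c * mean f.
Proof. by move=> bf; rewrite /mean RintegralZl//; exact: bmeas_integrable. Qed.

Lemma mean_sum (I : Type) (s : seq I) (F : I -> T -> R) :
  (forall i, bmeas (F i)) ->
  mean (fun x => \sum_(i <- s) F i x) = \sum_(i <- s) mean (F i).
Proof.
move=> bF; elim: s => [|i s IH].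
  by rewrite big_nil; under eq_mean do rewrite big_nil; exact: mean_cst.
rewrite big_cons -IH -meanD//; last exact: bmeas_sum.
by apply: eq_mean => x; rewrite big_cons.
Qed.

Lemma le_mean f g : bmeas f -> bmeas g -> (forall x, f x <= g x) -> mean f <= mean g.
Proof. by move=> bf bg fg; apply: le_Rintegral => //; exact: bmeas_integrable. Qed.

Lemma mean_ge0 f : (forall x, 0 <= f x) -> 0 <= mean f.
Proof. by move=> f0; apply: Rintegral_ge0. Qed.

Lemma mean_sqr_dist f c : bmeas f ->
  mean (fun x => (f x - c) ^+ 2) = mean (fun x => (f x - mean f) ^+ 2) + (mean f - c) ^+ 2.
Proof.
move=> bf; set m := mean f.
have -> : mean (fun x => (f x - c) ^+ 2) =
    mean (fun x => ((f x - m) ^+ 2 + 2 * (m - c) * f x) + ((m - c) ^+ 2 - 2 * (m - c) * m)).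
  by apply: eq_mean => x; ring.
have b1 : bmeas (fun x => (f x - m) ^+ 2).
  by apply: bmeasX; apply: bmeasB => //; exact: bmeas_cst.
have b2 : bmeas (fun x => 2 * (m - c) * f x) by apply: bmeasM => //; exact: bmeas_cst.
rewrite meanD ?mean_cst; [|exact: bmeasD|exact: bmeas_cst].
by rewrite meanD// meanZ// -/m; ring.
Qed.

Lemma mean_sqr_dist_le f c : bmeas f ->
  mean (fun x => (f x - mean f) ^+ 2) <= mean (fun x => (f x - c) ^+ 2).
Proof. by move=> bf; rewrite (mean_sqr_dist c bf) lerDl sqr_ge0. Qed.

Lemma sqr_mean_le f : bmeas f -> mean f ^+ 2 <= mean (fun x => f x ^+ 2).
Proof.
move=> bf; have := mean_sqr_dist 0 bf; under eq_mean do rewrite subr0.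
by move=> ->; rewrite subr0 lerDr mean_ge0// => x; exact: sqr_ge0.
Qed.

End BoundedMeasurable.

Lemma bmeas_comp d1 d2 (T1 : measurableType d1) (T2 : measurableType d2) (R : realType)
  (f : T2 -> R) (g : T1 -> T2) :
  bmeas f -> measurable_fun [set: T1] g -> bmeas (fun x => f (g x)).
Proof.
move=> [mf [M fM]] mg; split; first exact: (measurableT_comp mf).
by exists M => x.
Qed.

Section FubiniMean.
Context d1 d2 (T1 : measurableType d1) (T2 : measurableType d2) (R : realType).
Variables (P1 : probability T1 R) (P2 : probability T2 R) (F : T1 * T2 -> R).
Hypothesis bF : bmeas F.

Lemma bmeas_mean2 : bmeas (fun x => mean P2 (fun y => F (x, y))).
Proof.
have [mF [M FM]] := bF.
have bx x : bmeas (fun y => F (x, y)).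
  by apply: (bmeas_comp bF); exact: pair1_measurable.
split; last first.
  exists M => x; rewrite ler_norml; apply/andP; split.
    rewrite -(mean_cst P2 (- M)); apply: le_mean => //; first exact: bmeas_cst.
    by move=> y; have := FM (x, y); rewrite ler_norml => /andP[].
  rewrite -(mean_cst P2 M); apply: le_mean => //; first exact: bmeas_cst.
  by move=> y; have := FM (x, y); rewrite ler_norml => /andP[].
(* Adding the bound [M] makes the integrand nonnegative and brings the signed case back to Tonelli;
   the same shift is used in the later lemmas on means. *)
have F0 xy : (0 <= (F xy + M)%:E)%E.
  by rewrite lee_fin; have := FM xy; rewrite ler_norml => /andP[]; lra.
have mG : measurable_fun [set: T1 * T2] (fun xy => (F xy + M)%:E).
  by apply/measurable_EFinP; exact: measurable_funD.
have := @measurable_fun_fubini_tonelli_F _ _ _ _ _ P2 _ mG F0.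
rewrite (_ : fubini_F _ _ = EFin \o (fun x => mean P2 (fun y => F (x, y)) + M)); last first.
  apply/funext => x; rewrite /fubini_F meanE; last by apply: bmeasD => //; exact: bmeas_cst.
  by rewrite meanD//= ?mean_cst//; exact: bmeas_cst.
move=> /measurable_EFinP h.
rewrite (_ : (fun x => _) = (fun x => (mean P2 (fun y => F (x, y)) + M) - M)).
  exact: measurable_funB.
by apply/funext => x; rewrite addrK.
Qed.

End FubiniMean.

Section FubiniMeanSwap.
Context d1 d2 (T1 : measurableType d1) (T2 : measurableType d2) (R : realType).
Variables (P1 : probability T1 R) (P2 : probability T2 R) (F : T1 * T2 -> R).
Hypothesis bF : bmeas F.

Lemma mean_shift d (T : measurableType d) (P : probability T R) (f : T -> R) (M : R) :
  bmeas f -> mean P (fun x => f x + M) = mean P f + M.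
Proof. by move=> bf; rewrite meanD ?mean_cst//; exact: bmeas_cst. Qed.

Lemma fubini_mean : mean P1 (fun x => mean P2 (fun y => F (x, y))) =
  mean P2 (fun y => mean P1 (fun x => F (x, y))).
Proof.
have [mF [M FM]] := bF.
have F0 xy : (0 <= (F xy + M)%:E)%E.
  by rewrite lee_fin; have := FM xy; rewrite ler_norml => /andP[]; lra.
have mG : measurable_fun [set: T1 * T2] (fun xy => (F xy + M)%:E).
  by apply/measurable_EFinP; exact: measurable_funD.
have bx x : bmeas (fun y => F (x, y)).
  by apply: (bmeas_comp bF); exact: pair1_measurable.
have by' y : bmeas (fun x => F (x, y)).
  by apply: (bmeas_comp bF); exact: pair2_measurable.
have bF' : bmeas (fun yx : T2 * T1 => F (yx.2, yx.1)).
  by apply: (bmeas_comp bF); apply: measurable_fun_pair.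
have := @fubini_tonelli _ _ _ _ _ P1 P2 _ mG F0.
under eq_integral do
  rewrite (meanE P2 (bmeasD (bx _) (bmeas_cst _ M))) (mean_shift _ _ (bx _)).
under [in RHS]eq_integral do
  rewrite (meanE P1 (bmeasD (by' _) (bmeas_cst _ M))) (mean_shift _ _ (by' _)).
have b2 := bmeas_mean2 P2 bF; have b1 := bmeas_mean2 P1 bF'.
rewrite (meanE P1 (bmeasD b2 (bmeas_cst _ M))) (meanE P2 (bmeasD b1 (bmeas_cst _ M))).
by rewrite !mean_shift// => -[] /addIr.
Qed.

End FubiniMeanSwap.

Section IidMean.
Context d (T : measurableType d) (R : realType) (P : probability T R).

Lemma mean_iid0 (f : 0.-tuple T -> R) : bmeas f -> mean (iid P 0) f = f [tuple].
Proof.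
move=> bf; rewrite /mean /Rintegral integral_iid0//.
by apply/measurable_EFinP; exact: bmeasW.
Qed.

Lemma bmeas_cons n (f : n.+1.-tuple T -> R) : bmeas f ->
  bmeas (fun xv : T * n.-tuple T => f [tuple of xv.1 :: xv.2]).
Proof. by move=> bf; apply: (bmeas_comp bf); exact: (@measurable_consX _ T n). Qed.

Lemma bmeas_cons1 n (f : n.+1.-tuple T -> R) x : bmeas f ->
  bmeas (fun v : n.-tuple T => f [tuple of x :: v]).
Proof. by move=> bf; apply: (bmeas_comp bf); exact: measurable_cons. Qed.

Lemma bmeas_cons2 n (f : n.+1.-tuple T -> R) (v : n.-tuple T) : bmeas f ->
  bmeas (fun x : T => f [tuple of x :: v]).
Proof. by move=> bf; apply: (bmeas_comp bf); exact: measurable_cons. Qed.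

Lemma mean_iidS n (f : n.+1.-tuple T -> R) : bmeas f ->
  mean (iid P n.+1) f = mean P (fun x => mean (iid P n) (fun v => f [tuple of x :: v])).
Proof.
move=> bf; have [mf [M fM]] := bf.
have f0 w : (0 <= (f w + M)%:E)%E.
  by rewrite lee_fin; have := fM w; rewrite ler_norml => /andP[]; lra.
have mg : measurable_fun [set: n.+1.-tuple T] (fun w => (f w + M)%:E).
  by apply/measurable_EFinP; exact: measurable_funD.
have := integral_iidS P mg f0.
rewrite (meanE (iid P n.+1) (bmeasD bf (bmeas_cst _ M))) mean_shift//.
under eq_integral do rewrite (meanE (iid P n) (bmeasD (bmeas_cons1 _ bf) (bmeas_cst _ M)))
  (mean_shift _ _ (bmeas_cons1 _ bf)).
have b2 := bmeas_mean2 (iid P n) (bmeas_cons bf).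
by rewrite (meanE P (bmeasD b2 (bmeas_cst _ M))) mean_shift// => -[] /addIr.
Qed.

Lemma mean_iidS_swap n (f : n.+1.-tuple T -> R) : bmeas f ->
  mean (iid P n.+1) f = mean (iid P n) (fun v => mean P (fun x => f [tuple of x :: v])).
Proof. by move=> bf; rewrite mean_iidS// (fubini_mean P (iid P n) (bmeas_cons bf)). Qed.

End IidMean.

Definition upd {T : Type} n (w : n.-tuple T) (i : 'I_n) (t : T) : n.-tuple T :=
  [tuple (if j == i then t else tnth w j) | j < n].

Lemma upd_cons0 T n (v : n.-tuple T) x t :
  upd [tuple of x :: v] ord0 t = [tuple of t :: v].
Proof.
apply: eq_from_tnth => j; rewrite tnth_mktuple.
case: (unliftP ord0 j) => [k|] ->; last by rewrite eqxx tnth0.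
by rewrite eq_sym (negbTE (neq_lift _ _)) !tnthS.
Qed.

Lemma upd_consS T n (v : n.-tuple T) x i t :
  upd [tuple of x :: v] (lift ord0 i) t = [tuple of x :: upd v i t].
Proof.
apply: eq_from_tnth => j; rewrite tnth_mktuple.
case: (unliftP ord0 j) => [k|] ->; last by rewrite (negbTE (neq_lift _ _)) !tnth0.
by rewrite !tnthS tnth_mktuple (inj_eq lift_inj).
Qed.

Lemma upd_ins T n (i : 'I_n.+1) (z : n.-tuple T) y t : upd (ins i z y) i t = ins i z t.
Proof.
apply: eq_from_tnth => j; rewrite tnth_mktuple.
case: (unliftP i j) => [k|] ->; last by rewrite eqxx tnth_ins.
by rewrite eq_sym (negbTE (neq_lift _ _)) !tnth_ins_lift.
Qed.

(** Derivatives along coordinate lines, continuous on each line: the one-dimensional inequality is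
    applied one coordinate at a time, and joint differentiability never enters. *)
Definition partials {R : realType} n (H : n.-tuple R -> R)
    (h : 'I_n -> n.-tuple R -> R) :=
  forall i w, (forall t : R, is_derive t 1 (fun t => H (upd w i t)) (h i (upd w i t))) /\
    continuous (fun t : R => h i (upd w i t)).

(** * Poincare inequality for the product of Laplace laws *)

Section Poincare.
Context {R : realType}.

(** The variance is at most the second moment around [g 0]. That moment splits at 0 into two
    half-lines on which [g - g 0] vanishes at the origin, the left one being reflected. *)
Lemma poincare_lap (g k : R -> R) : bmeas g -> bmeas k ->
  (forall x : R, is_derive x 1 g (k x)) -> continuous k ->
  mean (lap R) (fun x => (g x - mean (lap R) g) ^+ 2) <=
  4 * mean (lap R) (fun x => k x ^+ 2).
Proof.
move=> bg bk dg ck; apply: (le_trans (mean_sqr_dist_le _ (g 0) bg)).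
have bg2 : bmeas (fun x => (g x - g 0) ^+ 2).
  by apply: bmeasX; apply: bmeasB => //; exact: bmeas_cst.
have bk2 : bmeas (fun x => k x ^+ 2) by exact: bmeasX.
have bk4 : bmeas (fun x => 4 * k x ^+ 2) by apply: bmeasM => //; exact: bmeas_cst.
rewrite -lee_fin -meanZ// -(meanE _ bg2) -(meanE _ bk4).
rewrite !integral_lap; last 4 first.
- by apply/measurable_EFinP; exact: bmeasW.
- by move=> x; rewrite lee_fin mulr_ge0// sqr_ge0.
- by apply/measurable_EFinP; exact: bmeasW.
- by move=> x; rewrite lee_fin sqr_ge0.
have half (u v : R -> R) : u 0 = 0 -> (forall x : R, is_derive x 1 u (v x)) -> continuous v ->
  (\int[@lebesgue_measure R]_(x in `[0%R, +oo[) ((u x ^+ 2)%:E * (expR (- x) / 2)%:E) <=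
  \int[@lebesgue_measure R]_(x in `[0%R, +oo[) ((4 * v x ^+ 2)%:E * (expR (- x) / 2)%:E))%E.
  move=> u0 du cv; have := half_line_poincare u0 du cv.
  have cu : continuous u.
    by move=> x; apply: differentiable_continuous; apply/derivable1_diffP; exact: ex_derive.
  have ce : continuous (fun x : R => v x ^+ 2 * (expR (- x) / 2)).
    move=> x; apply: cvgM; first by apply: cvgM; exact: cv.
    apply: cvgM; last exact: cvg_cst.
    by apply: continuous_comp; [exact: opp_continuous|exact: continuous_expR].
  rewrite -ge0_integralZl//; last 2 first.
  - apply: measurable_funTS; apply/measurable_EFinP.
    exact: continuous_measurable_fun.
  - by move=> x _; rewrite lee_fin mulr_ge0 ?sqr_ge0// divr_ge0// expR_ge0.
  under eq_integral do rewrite EFinM.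
  by under [X in (_ <= X)%E -> _]eq_integral do rewrite EFinM muleA -EFinM.
apply: leeD.
  apply: (half (fun x => g x - g 0) k) => //; first by rewrite subrr.
  by move=> x; rewrite -[k x]subr0; exact: is_deriveB.
under [X in (_ <= X)%E]eq_integral do rewrite -[k _ ^+ 2]sqrrN.
apply: (half (fun x => g (- x) - g 0) (fun x => - k (- x))).
    by rewrite oppr0 subrr.
  move=> x; rewrite -[- k _]subr0; apply: is_deriveB.
  have -> : - k (- x) = k (- x) *: (-1) by rewrite /GRing.scale/= mulrN1.
  exact: is_derive1_comp.
move=> x; apply: cvgN; apply: continuous_comp; [exact: opp_continuous|exact: ck].
Qed.

Lemma partials_cons n (H : n.+1.-tuple R -> R) h x : partials H h ->
  partials (fun v => H [tuple of x :: v]) (fun i v => h (lift ord0 i) [tuple of x :: v]).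
Proof.
move=> Hh i w; have [d c] := Hh (lift ord0 i) [tuple of x :: w]; split.
  by move=> t; have := d t; under eq_fun do rewrite upd_consS; rewrite upd_consS.
by have := c; under eq_fun do rewrite upd_consS.
Qed.

(** Tensorization: the variance is the mean conditional variance given the head, bounded by
    induction, plus the variance of the conditional mean [m], bounded by the one-dimensional
    inequality. The constant 4 is the same in every dimension. *)
Lemma poincare_iid n (H : n.-tuple R -> R) h : bmeas H -> (forall i, bmeas (h i)) ->
  partials H h ->
  mean (iid (lap R) n) (fun w => (H w - mean (iid (lap R) n) H) ^+ 2) <=
  4 * \sum_i mean (iid (lap R) n) (fun w => h i w ^+ 2).
Proof.
elim: n H h => [|n IH] H h bH bh Hh.
  rewrite big_ord0 mulr0 mean_iid0; last first.
    by apply: bmeasX; apply: bmeasB => //; exact: bmeas_cst.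
  by rewrite mean_iid0// subrr expr0n.
set Q := iid (lap R) n.
pose m x := mean Q (fun v => H [tuple of x :: v]).
pose M := mean (iid (lap R) n.+1) H; rewrite -/M.
have bm : bmeas m by exact: (bmeas_mean2 Q (bmeas_cons bH)).
have ME : M = mean (lap R) m by rewrite /M mean_iidS.
have bHM : bmeas (fun w => (H w - M) ^+ 2).
  by apply: bmeasX; apply: bmeasB => //; exact: bmeas_cst.
have b1 : bmeas (fun x => \sum_i mean Q (fun v => h (lift ord0 i) [tuple of x :: v] ^+ 2)).
  apply: bmeas_sum => i.
  by apply: (bmeas_mean2 Q (bmeas_cons (f := fun w => h _ w ^+ 2) _)); exact: bmeasX.
have b2 : bmeas (fun x => (m x - M) ^+ 2).
  by apply: bmeasX; apply: bmeasB => //; exact: bmeas_cst.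
have b41 : bmeas (fun x => 4 * \sum_i mean Q (fun v => h (lift ord0 i) [tuple of x :: v] ^+ 2)).
  by apply: bmeasM => //; exact: bmeas_cst.
rewrite mean_iidS//.
apply: (@le_trans _ _ (mean (lap R) (fun x =>
    4 * (\sum_i mean Q (fun v => h (lift ord0 i) [tuple of x :: v] ^+ 2)) + (m x - M) ^+ 2))).
  apply: le_mean; first exact: (bmeas_mean2 Q (bmeas_cons bHM)).
    exact: bmeasD.
  move=> x; rewrite (mean_sqr_dist Q M (bmeas_cons1 x bH)) lerD2r.
  apply: IH; first exact: bmeas_cons1.
    by move=> i; exact: bmeas_cons1.
  exact: partials_cons.
rewrite meanD// meanZ// big_ord_recl addrC mulrDr; apply: lerD; last first.
  rewrite ler_pM2l// mean_sum; last first.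
    move=> i; apply: (bmeas_mean2 Q (bmeas_cons (f := fun w => h _ w ^+ 2) _)).
    exact: bmeasX.
  apply: ler_sum => i _; rewrite mean_iidS//; exact: bmeasX.
pose k (v : n.-tuple R) := mean (lap R) (fun x => H [tuple of x :: v]).
have bHs : bmeas (fun vx : n.-tuple R * R => H [tuple of vx.2 :: vx.1]).
  by apply: (bmeas_comp bH); exact: measurable_cons.
have bk : bmeas k by exact: (bmeas_mean2 (lap R) bHs).
have bHk : bmeas (fun xv : R * n.-tuple R => (H [tuple of xv.1 :: xv.2] - k xv.2) ^+ 2).
  apply: bmeasX; apply: bmeasB; first exact: bmeas_cons.
  by apply: (bmeas_comp bk).
(* By Jensen the square passes inside the mean over the tail, and the one-dimensional inequality is
   then used for each fixed tail; this avoids differentiating [m] under the integral. *)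
apply: (@le_trans _ _ (mean (lap R) (fun x => mean Q (fun v =>
    (H [tuple of x :: v] - k v) ^+ 2)))).
  apply: le_mean => //; first exact: (bmeas_mean2 Q bHk).
  move=> x; have -> : m x - M = mean Q (fun v => H [tuple of x :: v] - k v).
    rewrite meanB//; last exact: bmeas_cons1.
    by rewrite /M mean_iidS_swap.
  by apply: sqr_mean_le; apply: bmeasB => //; exact: bmeas_cons1.
rewrite (fubini_mean (lap R) Q bHk) mean_iidS_swap; last exact: bmeasX.
have bh2s : bmeas (fun vx : n.-tuple R * R => h ord0 [tuple of vx.2 :: vx.1] ^+ 2).
  by apply: (bmeas_comp (bmeasX 2 (bh ord0))); exact: measurable_cons.
have bh2 : bmeas (fun v : n.-tuple R => mean (lap R) (fun x => h ord0 [tuple of x :: v] ^+ 2)).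
  exact: (bmeas_mean2 (lap R) bh2s).
rewrite -meanZ//; apply: le_mean.
- apply: (bmeas_mean2 (lap R) (F := fun vx : n.-tuple R * R =>
    (H [tuple of vx.2 :: vx.1] - k vx.1) ^+ 2)).
  by apply: bmeasX; apply: bmeasB => //; apply: (bmeas_comp bk).
- by apply: bmeasM => //; exact: bmeas_cst.
move=> v; have [d c] := Hh ord0 [tuple of 0 :: v].
apply: poincare_lap.
- exact: bmeas_cons2.
- exact: bmeas_cons2.
- by move=> x; have := d x; under eq_fun do rewrite upd_cons0; rewrite upd_cons0.
- by have := c; under eq_fun do rewrite upd_cons0.
Qed.

End Poincare.

(** * A Stokes formula on the l1-ball *)

Section Stokes.
Context {R : realType}.
Notation Q := (iid (lap R)).

(** Up to the factor [2 ^ n], the density of Lebesgue measure on the unit l1-ball with respect to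
    the Laplace product law. *)
Definition ball_weight n (w : n.-tuple R) : R := expR (l1n w) * (l1n w <= 1)%R%:R.

Lemma ball_weight_ge0 n (w : n.-tuple R) : 0 <= ball_weight w.
Proof. by rewrite mulr_ge0// expR_ge0. Qed.

Lemma bmeas_ball_weight n : bmeas (@ball_weight n).
Proof.
split.
  apply: measurable_funM.
    by apply: measurableT_comp => //; exact: measurable_l1n.
  apply: measurable_nat_of_bool; apply: measurable_fun_ler => //.
  exact: measurable_l1n.
exists (expR 1) => w; rewrite ger0_norm ?ball_weight_ge0// /ball_weight.
by case: (leP (l1n w) 1) => h /=; rewrite ?mulr1n ?mulr0n; [rewrite mulr1 ler_expR|rewrite mulr0 expR_ge0].
Qed.

Definition slice n (i : 'I_n.+1) (phi : n.+1.-tuple R -> R) : R :=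
  mean (Q n) (fun z => ball_weight z *
    (phi (ins i z (1 - l1n z)) + phi (ins i z (- (1 - l1n z))))).

Lemma measurable_ins_slice n (i : 'I_n.+1) (e : R) :
  measurable_fun [set: n.-tuple R] (fun z : n.-tuple R => ins i z (e * (1 - l1n z))).
Proof.
apply: measurable_ins => //; apply: measurable_funM => //.
by apply: measurable_funB => //; exact: measurable_l1n.
Qed.

Lemma bmeas_slice n (i : 'I_n.+1) (phi : n.+1.-tuple R -> R) : bmeas phi ->
  bmeas (fun z : n.-tuple R => ball_weight z *
    (phi (ins i z (1 - l1n z)) + phi (ins i z (- (1 - l1n z))))).
Proof.
move=> bphi; apply: bmeasM; first exact: bmeas_ball_weight.
apply: bmeasD.
  have := bmeas_comp bphi (measurable_ins_slice i 1).
  by under eq_fun do rewrite mul1r.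
have := bmeas_comp bphi (measurable_ins_slice i (-1)).
by under eq_fun do rewrite mulN1r.
Qed.

Lemma slice_shift n (i : 'I_n.+1) (phi : n.+1.-tuple R -> R) (M : R) : bmeas phi ->
  slice i (fun w => phi w + M) = slice i phi + M * slice i (fun=> 1).
Proof.
move=> bphi; rewrite /slice -meanZ; last exact: bmeas_slice (bmeas_cst _ _).
rewrite -meanD; first by apply: eq_mean => z; ring.
- exact: bmeas_slice.
- by apply: bmeasM; [exact: bmeas_cst|exact: bmeas_slice (bmeas_cst _ _)].
Qed.

Lemma sphere_sliceE n (i : 'I_n.+1) (phi : n.+1.-tuple R -> R) : bmeas phi ->
  sphere_slice i (fun w => (phi w)%:E) = (slice i phi)%:E.
Proof.
move=> bphi; rewrite /slice -meanE; last exact: bmeas_slice.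
by apply: eq_integral => z _; rewrite -EFinD -EFinM.
Qed.

(* The normalization constant of the sphere law, seen in graph coordinates. *)
Definition slice_const n : R := fine (@radial R n (cst 1)).

Lemma slice_const1 n (i : 'I_n.+1) : slice_const n * slice i (fun=> 1) = 1 /\
  @radial R n (cst 1) = (slice_const n)%:E.
Proof.
have h := @radial_slice1 R n i.
rewrite (@sphere_sliceE n i (fun=> 1)) in h; last exact: bmeas_cst.
have s0 : 0 <= slice i (fun=> 1).
  by apply: mean_ge0 => z; rewrite mulr_ge0 ?ball_weight_ge0.
have r0 := @radial_ge0 R n (cst 1) (fun=> ler01).
have sp : 0 < slice i (fun=> 1).
  rewrite lt_neqAle s0 andbT; apply/eqP => s0'; move: h; rewrite -s0' mule0 => /eqP.
  by rewrite eq_sym onee_eq0.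
have rE : @radial R n (cst 1) = (slice_const n)%:E.
  rewrite /slice_const; move: h r0; set r := radial _ _; case: r => [r|h _|_]//.
  by move: h; rewrite gt0_mulye.
by move: h; rewrite rE -EFinM => -[].
Qed.

Lemma mean_sphere_law n (i : 'I_n.+1) (phi : n.+1.-tuple R -> R) : bmeas phi ->
  mean (sphere_law n.+1) phi = slice_const n * slice i phi.
Proof.
move=> bphi; have [mphi [M phiM]] := bphi.
have bM : bmeas (fun w => phi w + M) by apply: bmeasD => //; exact: bmeas_cst.
have h := @integral_sphere_slice R n i (fun w => (phi w + M)%:E).
rewrite (meanE _ bM) (sphere_sliceE i bM) (slice_shift i M bphi) in h.
have [h1 rE] := slice_const1 i.
rewrite rE mean_shift// -EFinM in h.
rewrite mulrDr mulrCA h1 mulr1 in h.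
have mp : measurable_fun setT (fun w => (phi w + M)%:E).
  by apply/measurable_EFinP; exact: bmeasW.
have p0 w : (0 <= (phi w + M)%:E)%E.
  by rewrite lee_fin; have := phiM w; rewrite ler_norml => /andP[]; lra.
by have [/addIr] := h mp p0.
Qed.

Lemma continuous_bounded_segment (k : R -> R) (a : R) : continuous k ->
  exists M : R, forall x, `|x| <= a -> `|k x| <= M.
Proof.
move=> ck; have cw : {within `[- a, a], continuous k} by exact: continuous_subspaceT.
have := continuous_compact cw (@segment_compact R (- a) a).
move=> /compact_bounded[M [_ /(_ (M + 1))]]; rewrite ltrDl ltr01 => /(_ isT) h.
exists (M + 1) => x xa; apply: h; exists x => //=.
by rewrite in_itv/= -ler_norml.
Qed.

Lemma bmeas_segment (k : R -> R) (a : R) : continuous k ->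
  bmeas (fun x : R => 2 * expR `|x| * (`|x| <= a)%R%:R * k x).
Proof.
move=> ck; have ce : continuous (fun x : R => 2 * expR x * k x).
  move=> x; apply: cvgM; last exact: ck.
  by apply: cvgM; [exact: cvg_cst|exact: continuous_expR].
split.
  apply: measurable_funM; last exact: continuous_measurable_fun.
  apply: measurable_funM.
    by apply: measurable_funM => //; apply: measurableT_comp.
  by apply: measurable_nat_of_bool; exact: measurable_fun_ler.
have [M kM] := continuous_bounded_segment a ck.
exists (2 * expR a * `|M|) => x; case: (leP `|x| a) => xa /=; rewrite ?mulr1n ?mulr0n; last first.
  by rewrite mulr0 mul0r normr0 !mulr_ge0// expR_ge0.
rewrite mulr1 !normrM ler_pM// ?(le_trans (kM _ xa)) ?ler_norm//.
rewrite ger0_norm// ler_pM// ger0_norm ?expR_ge0// ler_expR//.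
Qed.

Lemma ge0_mean_lap_segment (G k : R -> R) (a : R) : 0 <= a ->
  (forall x : R, is_derive x 1 G (k x)) -> continuous k ->
  (forall x, `|x| <= a -> 0 <= k x) ->
  mean (lap R) (fun x : R => 2 * expR `|x| * (`|x| <= a)%R%:R * k x) = G a - G (- a).
Proof.
move=> a0 dG ck k0; apply: EFin_inj; rewrite -(meanE _ (bmeas_segment a ck)).
transitivity (\int[@lebesgue_measure R]_x ((`|x : R| <= a)%R%:R * k x)%:E)%E.
  rewrite -integral_lap_expR.
  - by apply: eq_integral => x _; rewrite -EFinM !mulrA.
  - apply/measurable_EFinP; apply: measurable_funM; last exact: continuous_measurable_fun.
    by apply: measurable_nat_of_bool; exact: measurable_fun_ler.
  - by move=> x; rewrite lee_fin; case: (leP `|x| a) => xa /=; rewrite ?mulr1n ?mulr0n ?mul1r ?k0// mul0r.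
transitivity (\int[@lebesgue_measure R]_(x in `[(- a)%R, a]) (k x)%:E)%E.
  rewrite [RHS]integral_mkcond; apply: eq_integral => x _.
  rewrite patchE mem_setE in_itv/= -ler_norml.
  by case: (leP `|x| a) => _ /=; rewrite ?mulr1n ?mulr0n ?mul1r ?mul0r.
move: a0; rewrite le_eqVlt => /predU1P[<-|a0].
  by rewrite oppr0 set_itv1 integral_set1 subrr.
by apply: continuous_FTC_itv => //; rewrite gtrN.
Qed.

(** The fundamental theorem of calculus on [[-a, a]], with the Lebesgue integral written as a
    Laplace mean. The sign condition of the previous lemma is removed by adding the slope [M] to [k]
    and subtracting the case of the constant [M]. *)
Lemma mean_lap_segment (G k : R -> R) (a : R) : 0 <= a ->
  (forall x : R, is_derive x 1 G (k x)) -> continuous k ->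
  mean (lap R) (fun x : R => 2 * expR `|x| * (`|x| <= a)%R%:R * k x) = G a - G (- a).
Proof.
move=> a0 dG ck.
have [M kM] := continuous_bounded_segment a ck.
have cM : continuous (fun _ : R => M) by move=> x; exact: cvg_cst.
have ckM : continuous (fun x : R => k x + M) by move=> x; apply: cvgD; [exact: ck|exact: cvg_cst].
have M0 : 0 <= M by rewrite (le_trans _ (kM 0 _))// normr0.
have dM (x : R) : is_derive x 1 (fun x : R => M * x) M.
  by apply: is_derive_eq; rewrite /GRing.scale/= mulr1.
have h1 := @ge0_mean_lap_segment (fun x => G x + M * x) (fun x => k x + M) a a0
  (fun x => is_deriveD (dG x) (dM x)) ckM.
have h2 := @ge0_mean_lap_segment (fun x => M * x) (fun=> M) a a0 dM cM (fun _ _ => M0).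
have -> : mean (lap R) (fun x : R => 2 * expR `|x| * (`|x| <= a)%R%:R * k x) =
   mean (lap R) (fun x : R => 2 * expR `|x| * (`|x| <= a)%R%:R * (k x + M) -
                2 * expR `|x| * (`|x| <= a)%R%:R * M).
  by apply: eq_mean => x; ring.
rewrite meanB; [|exact: bmeas_segment|exact: bmeas_segment].
rewrite h2 h1; first by ring.
by move=> x xa; have := kM x xa; rewrite ler_norml => /andP[]; lra.
Qed.

Lemma mean_iid_ins d0 (V : measurableType d0) (P : probability V R) n (i : 'I_n.+1)
    (f : n.+1.-tuple V -> R) : bmeas f ->
  mean (iid P n.+1) f = mean (iid P n) (fun z => mean P (fun x => f (ins i z x))).
Proof.
move=> bf; have [mf [M fM]] := bf.
have f0 w : (0 <= (f w + M)%:E)%E.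
  by rewrite lee_fin; have := fM w; rewrite ler_norml => /andP[]; lra.
have mg : measurable_fun [set: n.+1.-tuple V] (fun w => (f w + M)%:E).
  by apply/measurable_EFinP; exact: measurable_funD.
have bi : bmeas (fun zx : n.-tuple V * V => f (ins i zx.1 zx.2)).
  by apply: (bmeas_comp bf); exact: measurable_ins.
have bz z : bmeas (fun x => f (ins i z x)).
  by apply: (bmeas_comp bf); exact: measurable_ins.
have := integral_iid_ins P i mg f0.
rewrite (meanE (iid P n.+1) (bmeasD bf (bmeas_cst _ M))) mean_shift//.
under eq_integral do rewrite (meanE P (bmeasD (bz _) (bmeas_cst _ M))) (mean_shift _ _ (bz _)).
have b2 := bmeas_mean2 P bi.
by rewrite (meanE _ (bmeasD b2 (bmeas_cst _ M))) mean_shift// => -[] /addIr.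
Qed.

Lemma mean_ae_eq d (T : measurableType d) (P : probability T R) (f g : T -> R) (A : set T) :
  bmeas f -> bmeas g -> measurable A -> P A = 0%E -> (forall x, ~ A x -> f x = g x) ->
  mean P f = mean P g.
Proof.
move=> bf bg mA PA fg; rewrite /mean /Rintegral; congr fine.
apply: ae_eq_integral => //; try by apply/measurable_EFinP; exact: bmeasW.
exists A; split => // x /= /not_implyP[_ h]; apply: contrapT => /fg xE.
by apply: h; rewrite xE.
Qed.

Lemma measurable_tnth_eq0 n (i : 'I_n) : measurable [set w : n.-tuple R | tnth w i = 0].
Proof.
rewrite -[X in measurable X]setTI.
exact: (measurable_tnth i measurableT (measurable_set1 0)).
Qed.

Lemma iid_lap_tnth_eq0 n (i : 'I_n.+1) :
  Q n.+1 [set w : n.+1.-tuple R | tnth w i = 0] = 0%E.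
Proof.
have mA := measurable_tnth_eq0 i.
have := integral_indic (Q n.+1) measurableT mA; rewrite setIT => <-.
rewrite (integral_iid_ins (lap R) i) => [||w]; last 2 first.
- exact/measurable_EFinP.
- by rewrite lee_fin.
apply: integral0_eq => z _.
rewrite (_ : (fun x => _) = (fun x => (\1_[set 0 : R] x)%:E)).
  have := integral_indic (lap R) measurableT (measurable_set1 0); rewrite setIT => ->.
  exact: lap_set1.
apply/funext => x; rewrite !indicE; congr (_%:R%:E); congr nat_of_bool.
by apply/idP/idP; rewrite !inE /= tnth_ins.
Qed.

Lemma mean_sphere_lawE n (f : n.-tuple R -> R) : bmeas f ->
  mean (sphere_law n) f = mean (Q n) (fun w => f (nrm w)).
Proof.
move=> bf; have [mf [M fM]] := bf.
have f0 w : (0 <= (f w + M)%:E)%E.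
  by rewrite lee_fin; have := fM w; rewrite ler_norml => /andP[]; lra.
have mg : measurable_fun [set: n.-tuple R] (fun w => (f w + M)%:E).
  by apply/measurable_EFinP; exact: measurable_funD.
have bn : bmeas (fun w => f (nrm w)) by apply: (bmeas_comp bf); exact: measurable_nrm.
have := integral_sphere_law mg f0.
rewrite (meanE _ (bmeasD bf (bmeas_cst _ M))) (meanE _ (bmeasD bn (bmeas_cst _ M))).
by rewrite !mean_shift// => -[] /addIr.
Qed.

Lemma tnth_nrm n (w : n.-tuple R) i : tnth (nrm w) i = (l1n w)^-1 * tnth w i.
Proof. by rewrite tnth_scalet. Qed.

Lemma l1n_gt0 n (w : n.-tuple R) i : tnth w i != 0 -> 0 < l1n w.
Proof.
move=> wi; rewrite l1nE (bigD1 i)//= ltr_pwDl ?normr_gt0//.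
by rewrite sumr_ge0.
Qed.

Lemma l1n_nrm n (w : n.-tuple R) i : tnth w i != 0 -> l1n (nrm w) = 1.
Proof.
move=> /l1n_gt0 w0; rewrite l1n_scalet ger0_norm ?invr_ge0 ?(ltW w0)//.
by rewrite mulVf ?gt_eqF.
Qed.

(** A draw almost surely has norm 1 and a nonzero coordinate [i]. The latter makes the convention
    for the sign of 0 harmless, the former makes indicators of the ball equal to 1. *)
Lemma sphere_law_ae_eq n (i : 'I_n.+1) (f g : n.+1.-tuple R -> R) : bmeas f -> bmeas g ->
  (forall s, tnth s i != 0 -> l1n s = 1 -> f s = g s) ->
  mean (sphere_law n.+1) f = mean (sphere_law n.+1) g.
Proof.
move=> bf bg fg; rewrite !mean_sphere_lawE//.
apply: (mean_ae_eq _ _ (measurable_tnth_eq0 i) (iid_lap_tnth_eq0 i)).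
- by apply: (bmeas_comp bf); exact: measurable_nrm.
- by apply: (bmeas_comp bg); exact: measurable_nrm.
move=> w /= /eqP wi; apply: fg; last exact: l1n_nrm wi.
by rewrite tnth_nrm mulf_neq0// invr_neq0// gt_eqF// (l1n_gt0 wi).
Qed.

Lemma measurable_sg : measurable_fun [set: R] (@Num.sg R).
Proof.
rewrite (_ : @Num.sg R = (fun x => (0 < x)%R%:R - (x < 0)%R%:R)); last first.
  by apply/funext => x; rewrite /Num.sg; case: ltgtP => _ /=; rewrite ?subr0 ?sub0r.
by apply: measurable_funB; apply: measurable_nat_of_bool; exact: measurable_fun_ltr.
Qed.

Lemma bmeas_on_ball n (G : n.-tuple R -> R) (M : R) : measurable_fun [set: n.-tuple R] G ->
  (forall w, l1n w <= 1 -> `|G w| <= M) -> bmeas (fun w => (l1n w <= 1)%R%:R * G w).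
Proof.
move=> mG GM; split.
  apply: measurable_funM => //; apply: measurable_nat_of_bool.
  by apply: measurable_fun_ler => //; exact: measurable_l1n.
exists `|M| => w; case: (leP (l1n w) 1) => h /=; last by rewrite mul0r normr0.
by rewrite mul1r (le_trans (GM _ h))// ler_norm.
Qed.

Lemma bmeas_sg_tnth n (i : 'I_n) : bmeas (fun w : n.-tuple R => Num.sg (tnth w i)).
Proof.
split.
  by apply: (measurableT_comp measurable_sg); exact: measurable_tnth.
exists 1 => w; rewrite normr_sg; by case: (_ != _).
Qed.

Lemma ball_weight_ins n (i : 'I_n.+1) (z : n.-tuple R) x : l1n z <= 1 ->
  2 * ball_weight (ins i z x) =
  expR (l1n z) * (2 * expR `|x| * (`|x| <= 1 - l1n z)%R%:R).
Proof.
by move=> z1; rewrite /ball_weight l1n_ins -lerBrDr expRD; ring.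
Qed.

(** For a fixed [z] in the ball, the two points of the sphere above [z] are the ends of a segment
    parallel to axis [i]. They carry opposite signs, so the left side is the increment of [G] along
    that segment, that is, the integral of [g]. The indicator on the left keeps the function
    bounded, as [G] is controlled on the ball only. *)
Lemma stokes_slice n (i : 'I_n.+1) (G g : n.+1.-tuple R -> R) (M : R) :
  measurable_fun [set: n.+1.-tuple R] G -> measurable_fun [set: n.+1.-tuple R] g ->
  (forall w, l1n w <= 1 -> `|G w| <= M) -> (forall w, l1n w <= 1 -> `|g w| <= M) ->
  (forall z (t : R), is_derive t 1 (fun t => G (ins i z t)) (g (ins i z t))) ->
  (forall z, continuous (fun t => g (ins i z t))) ->
  mean (sphere_law n.+1) (fun s => Num.sg (tnth s i) * ((l1n s <= 1)%R%:R * G s)) =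
  2 * slice_const n * mean (Q n.+1) (fun w => ball_weight w * g w).
Proof.
move=> mG mg GM gM dG cg.
have bG := bmeas_on_ball mG GM; have bg := bmeas_on_ball mg gM.
have bphi := bmeasM (bmeas_sg_tnth i) bG.
have bwg : bmeas (fun w => ball_weight w * g w).
  rewrite (_ : (fun w => _) = (fun w => ball_weight w * ((l1n w <= 1)%R%:R * g w))).
    by apply: bmeasM => //; exact: bmeas_ball_weight.
  by apply/funext => w; rewrite /ball_weight; case: (leP (l1n w) 1) => _ /=; ring.
rewrite (mean_sphere_law i bphi) [2 * _]mulrC -mulrA; congr (_ * _).
rewrite -meanZ// (mean_iid_ins (lap R) i); last by apply: bmeasM => //; exact: bmeas_cst.
apply: eq_mean => z.
case: (leP (l1n z) 1) => z1; last first.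
  rewrite {1}/ball_weight leNgt z1 /= mulr0 mul0r -(mean_cst (lap R) 0); apply: eq_mean => x.
  rewrite /ball_weight l1n_ins leNgt (_ : (1 < _ + _) = true) /= ?mulr0 ?mul0r ?mulr0//.
  by rewrite (lt_le_trans z1)// lerDr.
have h0 : 0 <= 1 - l1n z by rewrite subr_ge0.
under [RHS]eq_mean do rewrite mulrA (ball_weight_ins _ _ z1) -mulrA.
rewrite meanZ; last first.
  exact: (bmeas_segment (1 - l1n z) (cg z)).
rewrite (mean_lap_segment h0 (dG z) (cg z)).
rewrite !tnth_ins !l1n_ins normrN ger0_norm// subrK lexx sgrN /ball_weight z1 /=.
rewrite !mul1r mulr1; congr (_ * _).
(* On the rim the segment is a point: the sign is 0 and the increment vanishes too. *)
have [h1|h1] := eqVneq (1 - l1n z) 0; first by rewrite h1 sgr0 oppr0 !mul0r addr0 subrr.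
by rewrite gtr0_sg ?lt_neqAle 1?eq_sym ?h1// mul1r mulN1r.
Qed.

(** The divergence of the identity map: apply [stokes_slice] to each coordinate function, whose
    derivative is 1, and sum, since [sg s_i * s_i] adds up to [|s|_1 = 1]. This evaluates the
    constant in [stokes] without computing any volume. *)
Lemma slice_const_ball n :
  n.+1%:R * (2 * slice_const n * mean (Q n.+1) (@ball_weight n.+1)) = 1.
Proof.
have H (i : 'I_n.+1) : mean (sphere_law n.+1)
   (fun s => Num.sg (tnth s i) * ((l1n s <= 1)%R%:R * tnth s i)) =
   2 * slice_const n * mean (Q n.+1) (@ball_weight n.+1).
  have b1 (w : n.+1.-tuple R) : l1n w <= 1 -> `|tnth w i| <= 1.
    by apply: le_trans; rewrite l1nE (bigD1 i)//= lerDl sumr_ge0.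
  have b2 (w : n.+1.-tuple R) : l1n w <= 1 -> `|1 : R| <= 1 by rewrite normr1.
  have d1 (z : n.-tuple R) (t : R) : is_derive t 1 (fun t => tnth (ins i z t) i) 1.
    by under eq_fun do rewrite tnth_ins; exact: is_derive_id.
  have c1 (z : n.-tuple R) : continuous (fun _ : R => 1 : R) by move=> t; exact: cvg_cst.
  rewrite (stokes_slice (@measurable_tnth _ R _ i) (measurable_cst _) b1 b2 d1 c1).
  by congr (_ * _); apply: eq_mean => w; rewrite mulr1.
have bi (i : 'I_n.+1) : bmeas (fun s : n.+1.-tuple R =>
    Num.sg (tnth s i) * ((l1n s <= 1)%R%:R * tnth s i)).
  apply: bmeasM; first exact: bmeas_sg_tnth.
  apply: (@bmeas_on_ball _ _ 1); first exact: measurable_tnth.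
  move=> w; apply: le_trans; rewrite l1nE (bigD1 i)//= lerDl sumr_ge0//.
transitivity (\sum_(i < n.+1) mean (sphere_law n.+1)
   (fun s : n.+1.-tuple R => Num.sg (tnth s i) * ((l1n s <= 1)%R%:R * tnth s i))).
  by under eq_bigr do rewrite H; rewrite sumr_const card_ord mulr_natl.
rewrite -mean_sum// -[RHS](mean_cst (sphere_law n.+1) 1).
apply: (@sphere_law_ae_eq n ord0); [exact: bmeas_sum|exact: bmeas_cst|].
move=> s _ s1; rewrite s1 lexx -[RHS]s1 l1nE; apply: eq_bigr => i _.
by rewrite mul1r -normrEsg.
Qed.

Lemma mean_ball_weight_gt0 n : 0 < mean (Q n.+1) (@ball_weight n.+1).
Proof.
rewrite lt_neqAle mean_ge0 ?andbT; last by move=> w; exact: ball_weight_ge0.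
apply/eqP => h; have := slice_const_ball n; rewrite -h !mulr0 => /eqP.
by rewrite eq_sym oner_eq0.
Qed.

Lemma stokes n (i : 'I_n.+1) (G g : n.+1.-tuple R -> R) (M : R) :
  measurable_fun [set: n.+1.-tuple R] G -> measurable_fun [set: n.+1.-tuple R] g ->
  (forall w, l1n w <= 1 -> `|G w| <= M) -> (forall w, l1n w <= 1 -> `|g w| <= M) ->
  (forall z (t : R), is_derive t 1 (fun t => G (ins i z t)) (g (ins i z t))) ->
  (forall z, continuous (fun t => g (ins i z t))) ->
  n.+1%:R * mean (sphere_law n.+1) (fun s => Num.sg (tnth s i) * ((l1n s <= 1)%R%:R * G s)) =
  mean (Q n.+1) (fun w => ball_weight w * g w) / mean (Q n.+1) (@ball_weight n.+1).
Proof.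
move=> mG mg GM gM dG cg; rewrite (stokes_slice mG mg GM gM dG cg).
have W0 := mean_ball_weight_gt0 n; apply: (mulIf (lt0r_neq0 W0)).
rewrite divfK ?gt_eqF//; have := slice_const_ball n.
set W := mean _ (@ball_weight _); set I := mean _ _ => h.
transitivity (n.+1%:R * (2 * slice_const n * W) * I); first by ring.
by rewrite h mul1r.
Qed.

End Stokes.

(** * Smooth approximation of convex Lipschitz functions *)

Section Euclidean.
Context {R : realType} {d : nat}.
Implicit Types (x y z u v : 'rV[R]_d) (a : R).

Lemma dotC x y : dot x y = dot y x.
Proof. by apply: eq_bigr => i _; rewrite mulrC. Qed.

Lemma dotDl x y z : dot (x + y) z = dot x z + dot y z.
Proof. by rewrite -big_split; apply: eq_bigr => i _; rewrite mxE mulrDl. Qed.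

Lemma dotDr x y z : dot z (x + y) = dot z x + dot z y.
Proof. by rewrite dotC dotDl !(dotC z). Qed.

Lemma dotZl a x y : dot (a *: x) y = a * dot x y.
Proof. by rewrite mulr_sumr; apply: eq_bigr => i _; rewrite mxE mulrA. Qed.

Lemma dotZr a x y : dot x (a *: y) = a * dot x y.
Proof. by rewrite dotC dotZl dotC. Qed.

Lemma dotNl x y : dot (- x) y = - dot x y.
Proof. by rewrite -scaleN1r dotZl mulN1r. Qed.

Lemma dotNr x y : dot x (- y) = - dot x y.
Proof. by rewrite dotC dotNl dotC. Qed.

Lemma dotBl x y z : dot (x - y) z = dot x z - dot y z.
Proof. by rewrite dotDl dotNl. Qed.

Lemma dotBr x y z : dot z (x - y) = dot z x - dot z y.
Proof. by rewrite dotDr dotNr. Qed.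

Lemma dot0l x : dot 0 x = 0.
Proof. by rewrite -(scale0r x) dotZl mul0r. Qed.

Lemma dot0r x : dot x 0 = 0.
Proof. by rewrite dotC dot0l. Qed.

Lemma dot_suml (I : Type) (s : seq I) (F : I -> 'rV[R]_d) y :
  dot (\sum_(k <- s) F k) y = \sum_(k <- s) dot (F k) y.
Proof.
elim: s => [|k s IH]; first by rewrite !big_nil dot0l.
by rewrite !big_cons dotDl IH.
Qed.

Lemma dot_ge0 x : 0 <= dot x x.
Proof. by apply: sumr_ge0 => i _; rewrite -expr2 sqr_ge0. Qed.

Lemma l2norm_ge0 x : 0 <= l2norm x.
Proof. exact: sqrtr_ge0. Qed.

Lemma sqr_l2norm x : l2norm x ^+ 2 = dot x x.
Proof. by rewrite sqr_sqrtr ?dot_ge0. Qed.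

Lemma l2normN x : l2norm (- x) = l2norm x.
Proof. by rewrite /l2norm dotNl dotNr opprK. Qed.

Lemma l2norm0 : l2norm (0 : 'rV[R]_d) = 0.
Proof. by rewrite /l2norm dot0l sqrtr0. Qed.

Lemma l2normZ a x : l2norm (a *: x) = `|a| * l2norm x.
Proof.
by rewrite /l2norm dotZl dotZr mulrA -expr2 sqrtrM ?sqr_ge0// sqrtr_sqr.
Qed.

Lemma sqr_l2normD x y : l2norm (x + y) ^+ 2 = l2norm x ^+ 2 + 2 * dot x y + l2norm y ^+ 2.
Proof. by rewrite !sqr_l2norm dotDl !dotDr (dotC y x); ring. Qed.

Lemma sqr_l2normB x y : l2norm (x - y) ^+ 2 = l2norm x ^+ 2 - 2 * dot x y + l2norm y ^+ 2.
Proof. by rewrite sqr_l2normD dotNr l2normN mulrN. Qed.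

Lemma l2norm_eq0 x : l2norm x = 0 -> x = 0.
Proof.
move=> /(congr1 (fun a => a ^+ 2)); rewrite sqr_l2norm expr0n /dot => /eqP.
rewrite psumr_eq0 => [/allP h|i _]; last by rewrite -expr2 sqr_ge0.
apply/rowP => i; rewrite mxE; have := h i.
by rewrite mem_index_enum -expr2 sqrf_eq0 => /(_ isT)/eqP.
Qed.

Lemma cauchy_schwarz x y : dot x y <= l2norm x * l2norm y.
Proof.
have [x0|x0] := eqVneq (l2norm x) 0; first by rewrite x0 (l2norm_eq0 x0) dot0l mul0r.
have [y0|y0] := eqVneq (l2norm y) 0; first by rewrite y0 (l2norm_eq0 y0) dot0r mulr0.
have xp : 0 < l2norm x by rewrite lt_neqAle eq_sym x0 l2norm_ge0.
have yp : 0 < l2norm y by rewrite lt_neqAle eq_sym y0 l2norm_ge0.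
have := dot_ge0 (l2norm y *: x - l2norm x *: y).
rewrite dotBl !dotBr !dotZl !dotZr -!sqr_l2norm (dotC y x) => h.
have : 0 <= (2 * l2norm x * l2norm y) * (l2norm x * l2norm y - dot x y) by nra.
by rewrite pmulr_rge0 ?subr_ge0// !mulr_gt0.
Qed.

Lemma cauchy_schwarz_norm x y : `|dot x y| <= l2norm x * l2norm y.
Proof.
rewrite ler_norml cauchy_schwarz andbT lerNl -dotNl -(l2normN x).
exact: cauchy_schwarz.
Qed.

Lemma l2normD x y : l2norm (x + y) <= l2norm x + l2norm y.
Proof.
rewrite -(@ler_pXn2r _ 2)// ?nnegrE ?addr_ge0 ?l2norm_ge0//.
rewrite sqr_l2normD sqrrD -[_ * _ *+ 2]mulr_natl.
by rewrite lerD2r lerD2l ler_pM2l// cauchy_schwarz.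
Qed.

Lemma l2normB x y : l2norm (x - y) <= l2norm x + l2norm y.
Proof. by rewrite -[in leRHS](l2normN y) l2normD. Qed.

Lemma l2norm_distC x y : l2norm (x - y) = l2norm (y - x).
Proof. by rewrite -l2normN opprB. Qed.

Lemma coord_le_l2norm x i : `|x 0 i| <= l2norm x.
Proof.
rewrite -sqrtr_sqr ler_wsqrtr// /dot (bigD1 i)//= expr2 lerDl.
by apply: sumr_ge0 => j _; rewrite -expr2 sqr_ge0.
Qed.

Lemma l2norm_le_sum x : l2norm x <= \sum_i `|x 0 i|.
Proof.
rewrite -(@ler_pXn2r _ 2)// ?nnegrE ?l2norm_ge0 ?sumr_ge0//.
rewrite sqr_l2norm expr2 mulr_suml; apply: ler_sum => i _.
rewrite -expr2 -real_normK ?num_real// expr2 ler_wpM2l//.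
by rewrite (bigD1 i)//= lerDl sumr_ge0.
Qed.

Lemma l2norm_le_mx_norm x : l2norm x <= d%:R * `|x|.
Proof.
apply: (le_trans (l2norm_le_sum x)).
have h i : `|x 0 i| <= `|x|.
  rewrite [leRHS]/Num.norm /= mx_normrE; apply/bigmax_geP; right => /=.
  by exists (0, i).
by apply: (le_trans (ler_sum _ (fun i _ => h i))); rewrite sumr_const card_ord mulr_natl.
Qed.

Lemma mx_norm_le_l2norm x : `|x| <= l2norm x.
Proof.
rewrite [leLHS]/Num.norm /= mx_normrE; apply/bigmax_leP; split => [|[i j] _ /=].
  exact: l2norm_ge0.
by rewrite (ord1 i) coord_le_l2norm.
Qed.

Lemma l2norm_delta (i : 'I_d) : l2norm (delta_mx 0 i : 'rV[R]_d) = 1.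
Proof.
rewrite /l2norm /dot (bigD1 i)//= big1 => [|j ji].
  by rewrite !mxE !eqxx mulr1 addr0 sqrtr1.
by rewrite !mxE (negbTE ji) andbF mul0r.
Qed.

Lemma dot_delta x (i : 'I_d) : dot x (delta_mx 0 i) = x 0 i.
Proof.
rewrite /dot (bigD1 i)//= big1 => [|j ji].
  by rewrite !mxE !eqxx mulr1 addr0.
by rewrite !mxE (negbTE ji) andbF mulr0.
Qed.

Lemma l2norm_lipschitz x y : `|l2norm x - l2norm y| <= l2norm (x - y).
Proof.
have h1 := l2normD (x - y) y; rewrite subrK in h1.
have h2 := l2normD (y - x) x; rewrite subrK l2norm_distC in h2.
by rewrite ler_norml; apply/andP; split; lra.
Qed.

Lemma continuous_l2norm : continuous (@l2norm R d).
Proof.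
move=> x; have F : Filter (nbhs (x : 'rV[R]_d)) by exact: nbhs_filter.
apply/cvgrPdist_le => e e0; near=> y.
apply: (le_trans (l2norm_lipschitz _ _)); apply: (le_trans (l2norm_le_mx_norm _)).
have : `|x - y| <= e / (d%:R + 1).
  by near: y; apply: cvgr_dist_le; [exact: cvg_id|rewrite divr_gt0// ltr_wpDl].
have d0 : 0 < d%:R + 1 :> R by rewrite ltr_wpDl.
rewrite ler_pdivlMr// mulrC; apply: le_trans; rewrite ler_wpM2r//.
by rewrite lerDl.
Unshelve. all: by end_near. Qed.

Lemma compact_l2ball (rho : R) : compact [set x : 'rV[R]_d | l2norm x <= rho].
Proof.
apply: bounded_closed_compact.
  exists rho; split; first by rewrite num_real.
  move=> M rM x /= xr; apply: (le_trans (mx_norm_le_l2norm x)).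
  by rewrite (le_trans xr)// ltW.
rewrite (_ : [set x | _] = (@l2norm R d) @^-1` [set t | t <= rho])//.
apply: preimage_closed; last exact: closed_le.
by move=> x _; exact: continuous_l2norm.
Qed.

End Euclidean.

Section SmoothNorm.
Context {R : realType} {d : nat}.
Variable del : R.
Hypothesis del0 : 0 < del.
Implicit Types (x y z u v : 'rV[R]_d).

(** The l2-norm of [v] extended by one more coordinate [del]: a smooth convex majorant of the norm,
    worth [del] at 0. *)
Definition softnorm v : R := Num.sqrt (del ^+ 2 + l2norm v ^+ 2).

Let soft_arg v : 0 <= del ^+ 2 + l2norm v ^+ 2.
Proof. by rewrite addr_ge0 ?sqr_ge0. Qed.

Lemma sqr_softnorm v : softnorm v ^+ 2 = del ^+ 2 + l2norm v ^+ 2.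
Proof. by rewrite sqr_sqrtr. Qed.

Lemma softnorm_ge_del v : del <= softnorm v.
Proof.
rewrite -(@ler_pXn2r _ 2)// ?nnegrE ?sqrtr_ge0 ?(ltW del0)//.
by rewrite sqr_softnorm lerDl sqr_ge0.
Qed.

Lemma softnorm_gt0 v : 0 < softnorm v.
Proof. exact: lt_le_trans del0 (softnorm_ge_del v). Qed.

Lemma softnorm_ge v : l2norm v <= softnorm v.
Proof.
rewrite -(@ler_pXn2r _ 2)// ?nnegrE ?sqrtr_ge0 ?l2norm_ge0//.
by rewrite sqr_softnorm lerDr sqr_ge0.
Qed.

Lemma softnorm0 : softnorm 0 = del.
Proof. by rewrite /softnorm l2norm0 expr0n addr0 sqrtr_sqr gtr0_norm. Qed.

(** Cauchy-Schwarz for the two vectors extended by the coordinate [del]. *)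
Lemma softnorm_cs u v : del ^+ 2 + dot u v <= softnorm u * softnorm v.
Proof.
have h : del ^+ 2 + l2norm u * l2norm v <= softnorm u * softnorm v.
  rewrite -(@ler_pXn2r _ 2)// ?nnegrE ?mulr_ge0 ?sqrtr_ge0//; last first.
    by rewrite addr_ge0 ?sqr_ge0// mulr_ge0 ?l2norm_ge0.
  rewrite exprMn !sqr_softnorm.
  by have := sqr_ge0 (del * l2norm u - del * l2norm v); nra.
by apply: le_trans h; rewrite lerD2l cauchy_schwarz.
Qed.

Lemma softnorm_convex u v t : 0 <= t -> t <= 1 ->
  softnorm (t *: u + (1 - t) *: v) <= t * softnorm u + (1 - t) * softnorm v.
Proof.
move=> t0 t1; have t1' : 0 <= 1 - t by rewrite subr_ge0.
have su := sqrtr_ge0 (del ^+ 2 + l2norm u ^+ 2).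
have sv := sqrtr_ge0 (del ^+ 2 + l2norm v ^+ 2).
rewrite -(@ler_pXn2r _ 2)// ?nnegrE ?addr_ge0 ?mulr_ge0 ?sqrtr_ge0//.
rewrite sqr_softnorm sqr_l2normD !l2normZ dotZl dotZr (ger0_norm t0) (ger0_norm t1').
rewrite sqrrD !exprMn !sqr_softnorm mulr2n.
have := softnorm_cs u v; have := mulr_ge0 t0 t1'; nra.
Qed.

(** A square root lies below its tangent, here taken at the squared value in [a]; then
    [softnorm a >= del] makes the curvature uniform. *)
Lemma softnorm_upper a v : softnorm (a + v) <=
  softnorm a + dot a v / softnorm a + l2norm v ^+ 2 / (2 * del).
Proof.
have a0 := softnorm_gt0 a; have ad := softnorm_ge_del a.
have h : softnorm (a + v) <= softnorm a + (2 * dot a v + l2norm v ^+ 2) / (2 * softnorm a).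
  rewrite -(@ler_pM2l _ (2 * softnorm a)) ?mulr_gt0//.
  have -> : 2 * softnorm a * (softnorm a + (2 * dot a v + l2norm v ^+ 2) / (2 * softnorm a))
      = 2 * softnorm a ^+ 2 + (2 * dot a v + l2norm v ^+ 2).
    by field; rewrite gt_eqF.
  have := sqr_ge0 (softnorm (a + v) - softnorm a).
  have := sqr_softnorm (a + v); rewrite sqr_l2normD.
  by have := sqr_softnorm a; nra.
apply: (le_trans h); rewrite -addrA lerD2l mulrDl lerD//.
  by rewrite -mulf_div divff// mul1r.
by rewrite ler_wpM2l ?sqr_ge0// lef_pV2 ?posrE ?mulr_gt0// ler_pM2l.
Qed.

End SmoothNorm.

Definition convexf {R : realType} {d : nat} (f : 'rV[R]_d -> R) :=
  forall x y t, 0 <= t -> t <= 1 ->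
    f (t *: x + (1 - t) *: y) <= t * f x + (1 - t) * f y.

Definition lipschitz_on {R : realType} {d : nat} (X : set 'rV[R]_d) (G : R) (f : 'rV[R]_d -> R) :=
  forall x y, X x -> X y -> `|f x - f y| <= G * l2norm (x - y).

Lemma convex_function_convexf {R : realType} {d : nat} (f : 'rV[R]_d -> R) :
  convex_function [set: 'rV[R]_d] f -> convexf f.
Proof.
move=> cf x y t t0 t1; have t01 : 0 <= t <= 1 by rewrite t0.
have := cf (Itv01 t0 t1) x y (mem_setT _) (mem_setT _).
by rewrite convRE.
Qed.

Section Smoothing.
Context {R : realType} {d : nat}.
Implicit Types (x y z u v : 'rV[R]_d).
Notation X := (l2ball 1 : set 'rV[R]_d).

(* First-order form of: [F] is convex, with a Lipschitz gradient [p]. *)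
Definition tangent_bounds (F : 'rV[R]_d -> R) (p : 'rV[R]_d -> 'rV[R]_d) (K : R) :=
  forall x v, F x + dot (p x) v <= F (x + v) <= F x + dot (p x) v + K * l2norm v ^+ 2.

(** The lower tangent bound follows from the upper one: [x] lies between [x + v] and [x - t v], so
    convexity and the upper bound at [- t v] give the tangent inequality up to [B * t], and [t] is
    arbitrarily small. *)
Lemma convex_tangent_bounds (F : 'rV[R]_d -> R) (p : 'rV[R]_d -> 'rV[R]_d) (K : R) :
  convexf F -> (forall x v, F (x + v) <= F x + dot (p x) v + K * l2norm v ^+ 2) ->
  tangent_bounds F p K.
Proof.
move=> cF up x v; rewrite up andbT.
set B := K * l2norm v ^+ 2.
have step t : 0 < t -> t <= 1 -> F x + dot (p x) v - B * t <= F (x + v).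
  move=> t0 t1; have t1p : 0 < 1 + t by rewrite addr_gt0.
  have h1 := up x (- t *: v); rewrite dotZr l2normZ normrN gtr0_norm// exprMn in h1.
  have h2 := cF (x + v) (x - t *: v) (t / (1 + t)).
  have e1 : 1 - t / (1 + t) = 1 / (1 + t) by field; rewrite gt_eqF.
  have e2 : (t / (1 + t)) *: (x + v) + (1 - t / (1 + t)) *: (x - t *: v) = x.
    rewrite e1 scalerBr scalerDr scalerA addrACA -scalerDl.
    rewrite (_ : t / (1 + t) + 1 / (1 + t) = 1); last by field; rewrite gt_eqF.
    rewrite (_ : 1 / (1 + t) * t = t / (1 + t)); last by field; rewrite gt_eqF.
    by rewrite scale1r subrr addr0.
  have := h2 (ltac:(by rewrite divr_ge0 ?ltW)) (ltac:(by rewrite ler_pdivrMr// mul1r lerDr)).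
  rewrite e2 e1 scaleNr in h1 *.
  rewrite -(@ler_pM2l _ (1 + t))//.
  have -> a b : (1 + t) * (t / (1 + t) * a + 1 / (1 + t) * b) = t * a + b.
    by field; rewrite gt_eqF.
  move=> h3.
  have h4 : t * (F x + dot (p x) v - B * t) <= t * F (x + v).
    by rewrite /B; nra.
  by move: h4; rewrite ler_pM2l.
apply/ler_addgt0Pr => e e0.
pose t := Num.min 1 (e / (`|B| + 1)).
have B1 : 0 < `|B| + 1 by rewrite ltr_wpDl.
have t0 : 0 < t by rewrite lt_min ltr01 divr_gt0.
have t1 : t <= 1 by rewrite ge_min lexx.
have te : t <= e / (`|B| + 1) by rewrite ge_min lexx orbT.
have := step t t0 t1; suff : B * t <= e by lra.
move: te; rewrite ler_pdivlMr// => te.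
by have := ler_norm B; have := normr_ge0 B; nra.
Qed.

Variables (f : 'rV[R]_d -> R) (G del : R).
Hypotheses (cf : convexf f) (lf : lipschitz_on X G f) (G0 : 0 < G) (del0 : 0 < del).

(** The function minimized in the infimal convolution. The minimum over [z] is taken on the unit
    ball, where [f] is known to be Lipschitz, while [x] ranges over the whole space. *)
Let obj x z : R := f z + 2 * G * softnorm del (x - z).

Let obj_min x : exists2 z, X z & forall z', X z' -> obj x z <= obj x z'.
Proof.
have X0 : X !=set0 by exists 0; rewrite /l2ball /= l2norm0.
have cobj : {within X, continuous (obj x)}.
  apply/subspace_continuousP => z Xz.
  have F : Filter (nbhs (z : 'rV[R]_d)) by exact: nbhs_filter.
  apply/cvgrPdist_le => e e0.
  have L0 : 0 < 3 * G * (d%:R + 1) by rewrite !mulr_gt0// ltr_wpDl.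
  near=> z'.
  have Xz' : X z' by near: z'; exact: withinT.
  have sn (a b : 'rV[R]_d) : `|softnorm del a - softnorm del b| <= l2norm (a - b).
    have main (u v : 'rV[R]_d) : softnorm del u - softnorm del v <= l2norm (u - v).
      have h := softnorm_gt0 del0 v.
      rewrite lerBlDr -(@ler_pXn2r _ 2)// ?nnegrE ?addr_ge0 ?sqrtr_ge0 ?l2norm_ge0//.
      rewrite sqrrD !sqr_softnorm// mulr2n.
      have := sqr_l2normD (u - v) v; rewrite subrK => ->.
      have := cauchy_schwarz (u - v) v; have := softnorm_ge del v.
      have := l2norm_ge0 (u - v); have := l2norm_ge0 v; nra.
    rewrite ler_norml; have := main a b; have := main b a.
    by rewrite l2norm_distC => h1 h2; apply/andP; split; lra.
  have h1 := lf Xz Xz'; have h2 := sn (x - z) (x - z').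
  have h3 : l2norm (x - z - (x - z')) = l2norm (z - z').
    by rewrite l2norm_distC; congr l2norm; rewrite opprB addrC addrA subrK.
  rewrite h3 in h2.
  rewrite -[leLHS]/(`|obj x z - obj x z'|).
  apply: (@le_trans _ _ (3 * G * l2norm (z - z'))).
    rewrite (_ : obj x z - obj x z' = (f z - f z') +
      2 * G * (softnorm del (x - z) - softnorm del (x - z'))); last by rewrite /obj; ring.
    apply: (@le_trans _ _ (`|f z - f z'| + 2 * G *
       `|softnorm del (x - z) - softnorm del (x - z')|)).
      rewrite -[2 * G in leRHS]ger0_norm ?mulr_ge0 ?(ltW G0)// -normrM.
      exact: ler_normD.
    have h4 := ler_wpM2l (mulr_ge0 (ler0n R 2) (ltW G0)) h2.
    by lra.
  apply: (@le_trans _ _ (3 * G * ((d%:R + 1) * `|z - z'|))).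
    rewrite ler_wpM2l ?mulr_ge0 ?(ltW G0)//.
    by apply: (le_trans (l2norm_le_mx_norm _)); rewrite ler_wpM2r// lerDl.
  rewrite mulrA -ler_pdivlMl//.
  near: z'; apply: cvgr_dist_le; last by rewrite mulr_gt0// invr_gt0.
  exact: cvg_within.
have [z] := EVT_min_rV X0 (@compact_l2ball R d 1) cobj.
rewrite inE => Xz zmin; exists z => // z' Xz'.
by apply: zmin; rewrite inE.
Unshelve. all: by end_near. Qed.

(** [F] is convex as a partial minimum of a jointly convex function. Using the minimizer [z x] as a
    competitor at [x + v] transfers the quadratic upper bound of the kernel to [F], with [p x] the
    gradient of the kernel at [x - z x]; the error [2 * G * del] is the value of the kernel at 0. *)
Lemma smooth_approximation : exists (F : 'rV[R]_d -> R) (p : 'rV[R]_d -> 'rV[R]_d),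
  [/\ forall x, X x -> f x <= F x <= f x + 2 * G * del,
      forall x, l2norm (p x) <= 2 * G &
      tangent_bounds F p (G / del)].
Proof.
have zex x : exists z, X z /\ forall z', X z' -> obj x z <= obj x z'.
  by have [z Xz zmin] := obj_min x; exists z.
have [z zP] := choice zex.
pose F x := obj x (z x).
pose p x := (2 * G / softnorm del (x - z x)) *: (x - z x).
have G2 : 0 < 2 * G by rewrite mulr_gt0.
have cF : convexf F.
  move=> x y t t0 t1; have t1' : 0 <= 1 - t by rewrite subr_ge0.
  have [Xx _] := zP x; have [Xy _] := zP y.
  have Xt : X (t *: z x + (1 - t) *: z y).
    rewrite /l2ball /=; apply: (le_trans (l2normD _ _)).
    by rewrite !l2normZ !ger0_norm//; rewrite /l2ball /= in Xx Xy; nra.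
  apply: (le_trans ((zP _).2 _ Xt)); rewrite /F /obj.
  have -> : t *: x + (1 - t) *: y - (t *: z x + (1 - t) *: z y) =
      t *: (x - z x) + (1 - t) *: (y - z y).
    by rewrite !scalerBr opprD addrACA.
  have h1 := cf (z x) (z y) t0 t1.
  have h2 := softnorm_convex del (x - z x) (y - z y) t0 t1.
  by nra.
exists F, p; split.
- move=> x Xx; have [Xz zmin] := zP x; apply/andP; split.
    have := lf Xx Xz; rewrite ler_norml => /andP[_].
    have := softnorm_ge del (x - z x); have := l2norm_ge0 (x - z x).
    by rewrite /F /obj; nra.
  by apply: (le_trans (zmin x Xx)); rewrite /obj subrr softnorm0.
- move=> x; have s0 := softnorm_gt0 del0 (x - z x).
  rewrite /p l2normZ ger0_norm ?divr_ge0 ?(ltW G2) ?(ltW s0)//.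
  by rewrite mulrAC ler_pdivrMr// ler_pM2l// softnorm_ge.
- apply: convex_tangent_bounds => // x v; have [Xz _] := zP x.
  apply: (le_trans ((zP (x + v)).2 _ Xz)); rewrite /F /obj.
  have -> : x + v - z x = x - z x + v by rewrite addrAC.
  have h := ler_wpM2l (ltW G2) (softnorm_upper del0 (x - z x) v).
  rewrite -(lerD2l (f (z x))) in h; apply: (le_trans h).
  rewrite le_eqVlt; apply/orP; left; apply/eqP.
  have s0 := softnorm_gt0 del0 (x - z x).
  by rewrite /p dotZl; field; rewrite !gt_eqF.
Qed.

End Smoothing.

Section TangentBounds.
Context {R : realType} {d : nat}.
Variables (F : 'rV[R]_d -> R) (p : 'rV[R]_d -> 'rV[R]_d) (K L : R).
Hypotheses (K0 : 0 <= K) (Fp : tangent_bounds F p K).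
Hypothesis pL : forall x, l2norm (p x) <= L.
Implicit Types (x y z u v : 'rV[R]_d).

Lemma tangent_bounds_lipschitz x y : `|F x - F y| <= L * l2norm (x - y).
Proof.
have main u v : F u - F v <= L * l2norm (u - v).
  have /andP[h _] := Fp u (v - u); rewrite [u + _]addrC subrK -opprB dotNr in h.
  have := cauchy_schwarz (p u) (u - v); have := pL u; have := l2norm_ge0 (u - v); nra.
rewrite ler_norml; have := main x y; have := main y x.
by rewrite l2norm_distC => h1 h2; apply/andP; split; lra.
Qed.

(** Summing the tangent bounds at the two ends controls [p] along the displacement itself. This is
    what continuity of the i-th component along axis [i] requires. *)
Lemma tangent_bounds_dot_diff x v : `|dot (p (x + v) - p x) v| <= 2 * K * l2norm v ^+ 2.
Proof.
have /andP[h1 h2] := Fp x v; have /andP[h3 h4] := Fp (x + v) (- v).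
rewrite addrK dotNr l2normN in h3 h4; rewrite dotBl ler_norml.
have h5 := mulr_ge0 K0 (sqr_ge0 (l2norm v)).
by apply/andP; split; lra.
Qed.

Lemma tangent_bounds_coord x i (h : R) :
  `|p (x + h *: delta_mx 0 i) 0 i - p x 0 i| <= 2 * K * `|h|.
Proof.
have [->|h0] := eqVneq h 0; first by rewrite scale0r addr0 subrr normr0 mulr0.
have := tangent_bounds_dot_diff x (h *: delta_mx 0 i).
rewrite dotZr dot_delta !mxE l2normZ l2norm_delta mulr1 normrM.
have h0' : 0 < `|h| by rewrite normr_gt0.
by rewrite expr2 mulrA [leRHS]mulrC ler_pM2l.
Qed.

Lemma tangent_bounds_is_derive x i (t : R) :
  is_derive t 1 (fun t : R => F (x + t *: delta_mx 0 i)) (p (x + t *: delta_mx 0 i) 0 i).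
Proof.
set y := x + _; set D := p y 0 i.
have K1 : 0 < K + 1 by rewrite ltr_wpDl.
have key (h : R) : `|F (x + (t + h) *: delta_mx 0 i) - F y - h * D| <= K * h ^+ 2.
  have := Fp y (h *: delta_mx 0 i).
  rewrite dotZr dot_delta l2normZ l2norm_delta mulr1 real_normK ?num_real//.
  rewrite /y -addrA -scalerDl -/y -/D => /andP[h1 h2].
  by rewrite ler_norml; apply/andP; split; have := sqr_ge0 h; nra.
have cvgD : (fun h : R => h^-1 *: (F (x + (h *: 1 + t) *: delta_mx 0 i) - F y))
    @ 0^' --> D.
  apply/cvgrPdist_le => e e0; near=> h.
  have h0 : h != 0 by near: h; exact: nbhs_dnbhs_neq.
  rewrite [h *: 1]mulr1 [h + t]addrC.
  have -> : D - h^-1 *: (F (x + (t + h) *: delta_mx 0 i) - F y) =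
      - h^-1 * (F (x + (t + h) *: delta_mx 0 i) - F y - h * D).
    by rewrite /GRing.scale /=; field.
  rewrite normrM normrN normfV ler_pdivrMl ?normr_gt0//.
  apply: (le_trans (key h)); rewrite -real_normK ?num_real// expr2 mulrA mulrC.
  rewrite ler_pM2l ?normr_gt0//.
  apply: (@le_trans _ _ ((K + 1) * `|h|)); first by rewrite ler_wpM2r// lerDl.
  rewrite -ler_pdivlMl//; near: h.
  by apply: dnbhs0_le; rewrite mulr_gt0 ?invr_gt0.
split; first by apply/cvg_ex; exists D.
by apply: cvg_lim.
Unshelve. all: by end_near. Qed.

Lemma tangent_bounds_continuous x i : continuous (fun t : R => p (x + t *: delta_mx 0 i) 0 i).
Proof.
have K1 : 0 < 2 * K + 1 by rewrite ltr_wpDl// mulr_ge0.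
move=> t; apply/cvgrPdist_le => e e0; near=> s.
rewrite (_ : x + s *: delta_mx 0 i = (x + t *: delta_mx 0 i) + (s - t) *: delta_mx 0 i).
  rewrite distrC; apply: (le_trans (tangent_bounds_coord _ _ _)).
  apply: (@le_trans _ _ ((2 * K + 1) * `|s - t|)); first by rewrite ler_wpM2r// lerDl.
  rewrite -ler_pdivlMl// distrC; near: s.
  by apply: cvgr_dist_le; [exact: cvg_id|rewrite mulr_gt0 ?invr_gt0].
by rewrite -addrA -scalerDl [t + _]addrC subrK.
Unshelve. all: by end_near. Qed.

End TangentBounds.

(** * Measurability of Lipschitz functions and of their gradients *)

Section LipschitzMeasurability.
Context {R : realType} {d : nat}.
Implicit Types (x y z u v : 'rV[R]_d).

Lemma rat_dense_rV x (e : R) : 0 < e ->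
  exists q : 'rV[rat]_d, l2norm (x - map_mx ratr q) < e.
Proof.
move=> e0; have d1 : 0 < d%:R + 1 :> R by rewrite ltr_wpDl.
have e1 : 0 < e / (d%:R + 1) by rewrite divr_gt0.
have ex (i : 'I_d) : exists q : rat, `|x 0 i - ratr q| <= e / (d%:R + 1).
  have [|q] := @rat_in_itvoo R (x 0 i - e / (d%:R + 1)) (x 0 i + e / (d%:R + 1)).
    by rewrite ltrBlDr -addrA ltrDl addr_gt0.
  rewrite in_itv /= => /andP[h1 h2]; exists q.
  by rewrite ler_norml; apply/andP; split; lra.
have [q qP] := choice ex; exists (\row_i q i).
apply: (le_lt_trans (l2norm_le_sum _)).
apply: (@le_lt_trans _ _ (\sum_(i < d) e / (d%:R + 1))).
  by apply: ler_sum => i _; rewrite !mxE; exact: qP.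
rewrite sumr_const card_ord -[ltLHS]mulr_natl mulrCA -[ltRHS]mulr1 ltr_pM2l//.
by rewrite ltr_pdivrMr// mul1r ltrDl.
Qed.

Context {dT : measure_display} {Theta : measurableType dT}.

Lemma measurable_l2norm (h : Theta -> 'rV[R]_d) :
  (forall i, measurable_fun [set: Theta] (fun t => h t 0 i)) ->
  measurable_fun [set: Theta] (fun t => l2norm (h t)).
Proof.
move=> mh.
rewrite (_ : (fun _ => _) = (fun t => Num.sqrt (\sum_i h t 0 i * h t 0 i)))//.
apply: (@measurableT_comp _ _ _ _ _ _ (@Num.sqrt R)).
  by apply: continuous_measurable_fun; exact: sqrt_continuous.
by apply: measurable_sum => i; exact: measurable_funM.
Qed.

(** [F] is the infimum, over the countably many rational [q], of the cones [F q + L * |x - q|]; so a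
    strict sublevel set is a countable union of sets defined by norms. Measurability of [h] is
    expressed coordinate by coordinate. *)
Lemma lipschitz_measurable (F : 'rV[R]_d -> R) (L : R) (h : Theta -> 'rV[R]_d) :
  (forall x y, `|F x - F y| <= L * l2norm (x - y)) ->
  (forall i, measurable_fun [set: Theta] (fun t => h t 0 i)) ->
  measurable_fun [set: Theta] (F \o h).
Proof.
wlog L0 : L / 0 <= L.
  move=> wl FL; apply: (wl `|L|) => // x y; apply: (le_trans (FL x y)).
  by rewrite ler_wpM2r ?l2norm_ge0// ler_norm.
move=> FL mh mD; apply: (measurability _ (RGenInftyO.measurableE R)) => //.
move=> _ [_ [c ->] <-]; rewrite setTI.
pose a (q : 'rV[rat]_d) : 'rV[R]_d := map_mx ratr q.
have -> : (F \o h) @^-1` `]-oo, c[ =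
    \bigcup_(q : 'rV[rat]_d) [set t | F (a q) + L * l2norm (h t - a q) < c].
  apply/seteqP; split=> x; rewrite /= in_itv /=.
    move=> Fc; have L1 : 0 < 2 * L + 1 by rewrite ltr_wpDl// mulr_ge0.
    have c0 : 0 < (c - F (h x)) / (2 * L + 1) by rewrite divr_gt0 ?subr_gt0.
    have [q qP] := rat_dense_rV (h x) c0; exists q => //=.
    rewrite ltr_pdivlMr// -/(a q) in qP.
    have := FL (a q) (h x); rewrite l2norm_distC ler_norml => /andP[_].
    by have := l2norm_ge0 (h x - a q); lra.
  move=> [q _ /=]; have := FL (h x) (a q); rewrite ler_norml => /andP[_]; lra.
apply: countable_bigcupT_measurable; first exact: countableP.
move=> q.
have mq : measurable_fun [set: Theta] (fun t => F (a q) + L * l2norm (h t - a q)).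
  apply: measurable_funD => //; apply: measurable_funM => //; apply: measurable_l2norm => i.
  rewrite (_ : (fun _ => _) = (fun t => h t 0 i - a q 0 i)); first exact: measurable_funB.
  by apply/funext => x; rewrite !mxE.
rewrite (_ : [set t | _] = (fun t => F (a q) + L * l2norm (h t - a q)) @^-1` `]-oo, c[).
  by rewrite -[X in measurable X]setTI; apply: mq => //; exact: measurable_itv.
by apply/funext => x; rewrite /= in_itv.
Qed.

(** The components of [p] are pointwise limits of the difference quotients of [F] with steps
    [1 / (n + 1)]. *)
Lemma tangent_bounds_measurable (F : 'rV[R]_d -> R) (p : 'rV[R]_d -> 'rV[R]_d) (K L : R)
    (h : Theta -> 'rV[R]_d) i :
  0 <= K -> tangent_bounds F p K -> (forall x, l2norm (p x) <= L) ->
  (forall i, measurable_fun [set: Theta] (fun t => h t 0 i)) ->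
  measurable_fun [set: Theta] (fun t => p (h t) 0 i).
Proof.
move=> K0 Fp pL mh; have FL := tangent_bounds_lipschitz Fp pL.
pose q n (x : Theta) := n.+1%:R * (F (h x + n.+1%:R^-1 *: delta_mx 0 i) - F (h x)).
apply: (@measurable_fun_cvg _ _ _ _ q) => [n|x _].
  apply: measurable_funM => //; apply: measurable_funB; last exact: lipschitz_measurable FL mh.
  apply: (@lipschitz_measurable F L (fun t => h t + n.+1%:R^-1 *: delta_mx 0 i)) => // j.
  rewrite (_ : (fun _ => _) = (fun t => h t 0 j + (n.+1%:R^-1 *: delta_mx 0 i : 'rV[R]_d) 0 j)).
    exact: measurable_funD.
  by apply/funext => x; rewrite mxE.
apply/cvgrPdist_le => e e0; near=> n.
have /andP[h1 h2] := Fp (h x) (n.+1%:R^-1 *: delta_mx 0 i).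
rewrite dotZr dot_delta l2normZ l2norm_delta mulr1 in h1 h2.
rewrite real_normK ?num_real// in h2.
have n0 : 0 < n.+1%:R :> R by [].
have nK : K * n.+1%:R^-1 <= e.
  rewrite ler_pdivrMr// -ler_pdivrMl// mulrC; apply: ltW.
  apply: (@lt_le_trans _ _ n%:R); last by rewrite ler_nat.
  by near: n; exact: nbhs_infty_gtr.
rewrite /q; set D := p (h x) 0 i in h1 h2 *; set F1 := F (h x + _) in h1 h2 *.
have e1 : n.+1%:R * (F1 - F (h x)) - D =
    n.+1%:R * (F1 - (F (h x) + n.+1%:R^-1 * D)) by field.
rewrite distrC e1 ger0_norm; last by rewrite mulr_ge0// subr_ge0.
apply: le_trans nK; rewrite -ler_pdivlMl// lerBlDl.
by apply: (le_trans h2); rewrite lerD2l expr2 mulrCA.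
Unshelve. all: by end_near. Qed.

End LipschitzMeasurability.

(** * Moments of the gradient estimator *)

Section Rows.
Context {R : realType}.

Definition rowv n (w : n.-tuple R) : 'rV[R]_n := \row_i tnth w i.

Lemma sqr_l2norm_rowv n (w : n.-tuple R) : l2norm (rowv w) ^+ 2 = l2sq w.
Proof. by rewrite sqr_l2norm l2sqE; apply: eq_bigr => i _; rewrite mxE -expr2. Qed.

Lemma l2norm_rowv_le n (w : n.-tuple R) : l2norm (rowv w) <= l1n w.
Proof.
apply: (le_trans (l2norm_le_sum _)); rewrite l1nE le_eqVlt; apply/orP; left.
by apply/eqP; apply: eq_bigr => i _; rewrite mxE.
Qed.

Lemma rowv_scalet n c (w : n.-tuple R) : rowv (scalet c w) = c *: rowv w.
Proof. by apply/rowP => i; rewrite !mxE tnth_scalet. Qed.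

Lemma rowv_upd n (w : n.-tuple R) i t :
  rowv (upd w i t) = rowv (upd w i 0) + t *: delta_mx 0 i.
Proof.
apply/rowP => j; rewrite !mxE !tnth_mktuple eqxx /=.
by case: (j == i); rewrite ?add0r ?mulr1 ?mulr0 ?addr0.
Qed.

Lemma rowv_ins n (z : n.-tuple R) i t :
  rowv (ins i z t) = rowv (ins i z 0) + t *: delta_mx 0 i.
Proof. by rewrite -(upd_ins i z 0 t) rowv_upd upd_ins. Qed.

Lemma measurable_rowv n (y : 'rV[R]_n) c i :
  measurable_fun [set: n.-tuple R] (fun w => (y + c *: rowv w) 0 i).
Proof.
under eq_fun do rewrite !mxE.
by apply: measurable_funD => //; apply: measurable_funM => //; exact: measurable_tnth.
Qed.

Lemma sqr_l2norm_signv n (x : 'rV[R]_n) : l2norm (signv x) ^+ 2 = n%:R.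
Proof.
rewrite sqr_l2norm /dot (eq_bigr (fun=> 1)) => [|i _]; last first.
  by rewrite mxE; case: ifP; rewrite ?mulr1// mulrNN mulr1.
by rewrite sumr_const card_ord.
Qed.

End Rows.

(** * A bounded smooth truncation *)

Section Truncation.
Context {R : realType}.
Variable M : R.
Hypothesis M0 : 0 < M.

(* A smooth 1-Lipschitz truncation, expanding on [-M/2, M/2] up to a factor. *)
Definition trunc (a : R) : R := a / (1 + (a / M) ^+ 2).

Definition dtrunc (a : R) : R := (1 - (a / M) ^+ 2) / (1 + (a / M) ^+ 2) ^+ 2.

Let den_gt0 (a : R) : 0 < 1 + (a / M) ^+ 2.
Proof. by rewrite ltr_wpDr// sqr_ge0. Qed.

Lemma trunc_bound a : `|trunc a| <= M / 2.
Proof.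
have h := den_gt0 a.
rewrite normrM normfV (gtr0_norm h) ler_pdivrMr//.
have -> : `|a| = M * `|a / M| by rewrite normrM normfV (gtr0_norm M0); field; rewrite gt_eqF.
rewrite -mulrA ler_pM2l// -[(a / M) ^+ 2]real_normK ?num_real//.
by have := sqr_ge0 (`|a / M| - 1); lra.
Qed.

Let trunc_sub a b : trunc a - trunc b =
  (a - b) * ((1 - a / M * (b / M)) / ((1 + (a / M) ^+ 2) * (1 + (b / M) ^+ 2))).
Proof.
rewrite /trunc; have Mn : M != 0 by rewrite gt_eqF.
have ha := lt0r_neq0 (den_gt0 a); have hb := lt0r_neq0 (den_gt0 b).
move: ha hb; rewrite !exprMn !exprVn.
set a2 := 1 + a ^+ 2 / M ^+ 2; set b2 := 1 + b ^+ 2 / M ^+ 2 => ha hb.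
apply: (mulIf ha); apply: (mulIf hb); rewrite /a2 /b2; field.
rewrite -/a2 -/b2.
have -> : M ^+ 2 + a ^+ 2 = M ^+ 2 * a2 by rewrite /a2; field.
have -> : M ^+ 2 + b ^+ 2 = M ^+ 2 * b2 by rewrite /b2; field.
by rewrite Mn !mulf_neq0 ?expf_neq0.
Qed.

Lemma trunc_lipschitz a b : `|trunc a - trunc b| <= `|a - b|.
Proof.
rewrite trunc_sub normrM -[leRHS]mulr1 ler_wpM2l//.
have h := mulr_gt0 (den_gt0 a) (den_gt0 b).
rewrite normrM normfV (gtr0_norm h) ler_pdivrMr// mul1r ler_norml.
set x := a / M; set z := b / M; have := sqr_ge0 (x - z); have := sqr_ge0 (x + z).
have := sqr_ge0 x; have := sqr_ge0 z; have := sqr_ge0 (x * z).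
by move=> h1 h2 h3 h4 h5; apply/andP; split; nra.
Qed.

(** With [x = a / M] and [z = b / M] of size at most 1/2, the ratio of the increments is
    [(1 - x z) / ((1 + x^2) (1 + z^2))], at least [(3/4) / (25/16) = 12/25], hence more than 1/3. *)
Lemma trunc_expand a b : `|a| <= M / 2 -> `|b| <= M / 2 ->
  `|a - b| <= 3 * `|trunc a - trunc b|.
Proof.
move=> ha hb; rewrite trunc_sub normrM mulrCA -[leLHS]mulr1 ler_wpM2l//.
have h := mulr_gt0 (den_gt0 a) (den_gt0 b).
have {}ha : `|a / M| <= 2^-1.
  by rewrite normrM normfV (gtr0_norm M0) ler_pdivrMr// mulrC.
have {}hb : `|b / M| <= 2^-1.
  by rewrite normrM normfV (gtr0_norm M0) ler_pdivrMr// mulrC.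
move: ha hb h; set x := a / M; set z := b / M => ha hb h.
rewrite normrM normfV (gtr0_norm h) mulrA ler_pdivlMr// mul1r.
move: ha hb; rewrite !ler_norml => /andP[x1 x2] /andP[z1 z2].
have xz : `|x * z| <= 4^-1.
  by rewrite ler_norml; apply/andP; split; nra.
have xx : x ^+ 2 <= 4^-1 by nra.
have zz : z ^+ 2 <= 4^-1 by nra.
have p1 : 1 - x * z <= `|1 - x * z| by exact: ler_norm.
move: xz; rewrite ler_norml => /andP[_ xz].
have := sqr_ge0 x; have := sqr_ge0 z; nra.
Qed.

Lemma dtrunc_bound a : `|dtrunc a| <= 1.
Proof.
have h := den_gt0 a; have h2 : 0 < (1 + (a / M) ^+ 2) ^+ 2 by rewrite exprn_gt0.
rewrite normrM normfV (gtr0_norm h2) ler_pdivrMr// mul1r ler_norml.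
have := sqr_ge0 (a / M); set x := (a / M) ^+ 2 => x0.
by apply/andP; split; nra.
Qed.

Lemma is_derive_trunc (a : R) : is_derive a 1 trunc (dtrunc a).
Proof.
have h : 1 + (a / M) ^+ 2 != 0 by rewrite gt_eqF.
have d1 : is_derive a 1 (fun a : R => 1 + (a / M) ^+ 2) (2 * (a / M) / M).
  have d0 : is_derive a 1 (fun a : R => a / M) M^-1.
    by apply: (is_derive_eq (is_deriveM (is_derive_id a 1) (is_derive_cst M^-1 a 1)));
      rewrite scaler0 add0r [LHS]mulr1.
  rewrite (_ : (fun _ => _) = cst 1 + (fun a : R => a / M) * (fun a : R => a / M)); last first.
    by apply/funext => z; rewrite expr2.
  apply: (is_derive_eq (is_deriveD (is_derive_cst (1 : R) a 1) (is_deriveM d0 d0))).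
  by rewrite add0r /GRing.scale /=; ring.
pose q (a : R) := 1 + (a / M) ^+ 2.
have d2 := @is_deriveV _ q _ _ _ h d1.
apply: (is_derive_eq (is_deriveM (is_derive_id a 1) d2)).
have -> : (q a)^-1%:A = (q a)^-1 :> R by exact: mulr1.
rewrite /dtrunc /q /GRing.scale /=; field.
have Mn : M != 0 by rewrite gt_eqF.
rewrite Mn /=.
have -> : M ^+ 2 + a ^+ 2 = M ^+ 2 * (1 + (a / M) ^+ 2) by field.
by rewrite mulf_neq0// expf_neq0.
Qed.

Lemma continuous_dtrunc : continuous dtrunc.
Proof.
move=> a.
have c1 : (fun a : R => (a / M) ^+ 2) @ a --> (a / M) ^+ 2.
  by apply: cvgM; apply: cvgM => //; exact: cvg_cst.
apply: cvgM; first by apply: cvgB => //; exact: cvg_cst.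
apply: cvgV; first by rewrite expf_neq0 // gt_eqF.
by apply: cvgM; apply: cvgD => //; exact: cvg_cst.
Qed.

End Truncation.

Section LaplaceSymmetry.
Context {R : realType}.

Lemma mean_lap_opp (f : R -> R) : bmeas f ->
  mean (lap R) (fun x => f (- x)) = mean (lap R) f.
Proof.
move=> bf; have [mf [M fM]] := bf.
have bfN : bmeas (fun x : R => f (- x)) by apply: bmeas_comp => //; exact: oppr_measurable.
apply: (@addIr _ M); rewrite -!mean_shift// /mean /Rintegral; congr fine.
apply: (@integral_lap_opp R (fun x => (f x + M)%:E)).
  by apply/measurable_EFinP; exact: measurable_funD.
by move=> x; rewrite lee_fin; have := fM x; rewrite ler_norml => /andP[]; lra.
Qed.

Lemma mean_iid_lap_opp n (f : n.-tuple R -> R) : bmeas f ->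
  mean (iid (lap R) n) (fun w => f (scalet (-1) w)) = mean (iid (lap R) n) f.
Proof.
elim: n f => [|n IH] f bf.
  by apply: eq_mean => w; congr f; apply: eq_from_tnth; case.
have bfN : bmeas (fun w => f (scalet (-1) w)).
  by apply: (bmeas_comp bf); apply: measurable_scalet.
rewrite (mean_iidS _ bfN) (mean_iidS _ bf).
transitivity (mean (lap R) (fun x => mean (iid (lap R) n) (fun v => f [tuple of - x :: v]))).
  apply: eq_mean => x; rewrite -(IH (fun v => f [tuple of - x :: v])); last exact: bmeas_cons1.
  by apply: eq_mean => v; rewrite scalet_cons mulN1r.
rewrite (mean_lap_opp (f := fun x => mean (iid (lap R) n) (fun v => f [tuple of x :: v])))//.
exact: (bmeas_mean2 (iid (lap R) n) (bmeas_cons bf)).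
Qed.

End LaplaceSymmetry.

Section TruncatedVariance.
Context {R : realType} {n : nat}.
Variables (F : 'rV[R]_n -> R) (p : 'rV[R]_n -> 'rV[R]_n) (K L M : R).
Hypotheses (K0 : 0 <= K) (Fp : tangent_bounds F p K) (M0 : 0 < M).
Hypothesis pL : forall x, l2norm (p x) <= L.
Variable y : 'rV[R]_n.
Notation Q := (iid (lap R) n).

Definition truncf (v : 'rV[R]_n) : R := trunc M (F (y + v) - F y).

Lemma truncf_lipschitz u v : `|truncf u - truncf v| <= L * l2norm (u - v).
Proof.
apply: (le_trans (trunc_lipschitz M0 _ _)).
rewrite (_ : F (y + u) - F y - (F (y + v) - F y) = F (y + u) - F (y + v)); last by ring.
apply: (le_trans (tangent_bounds_lipschitz Fp pL _ _)).
by rewrite opprD addrACA subrr add0r.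
Qed.

Let L0 : 0 <= L.
Proof. exact: le_trans (l2norm_ge0 _) (pL 0). Qed.

Let H c (w : n.-tuple R) := truncf (c *: rowv w).

Let h c i (w : n.-tuple R) :=
  c * dtrunc M (F (y + c *: rowv w) - F y) * p (y + c *: rowv w) 0 i.

Lemma bmeas_truncf (g : n.-tuple R -> 'rV[R]_n) :
  (forall i, measurable_fun [set: n.-tuple R] (fun w => g w 0 i)) ->
  bmeas (fun w => truncf (g w)).
Proof.
move=> mg; split; last by exists (M / 2) => w; exact: trunc_bound.
exact: (lipschitz_measurable truncf_lipschitz mg).
Qed.

Let bH c : bmeas (H c).
Proof.
apply: bmeas_truncf => i; have := measurable_rowv (0 : 'rV[R]_n) c i.
by under eq_fun do rewrite add0r.
Qed.

Let bh c i : bmeas (h c i).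
Proof.
split; last first.
  exists (`|c| * 1 * L) => w; rewrite normrM (normrM c) !ler_pM ?mulr_ge0 ?dtrunc_bound//.
  exact: le_trans (coord_le_l2norm _ _) (pL _).
apply: measurable_funM; last first.
  by apply: (tangent_bounds_measurable (h := fun w => y + c *: rowv w) i K0 Fp pL) => j;
    exact: measurable_rowv.
apply: measurable_funM => //.
apply: (@measurableT_comp _ _ _ _ _ _ (dtrunc M)).
  by apply: continuous_measurable_fun; exact: continuous_dtrunc.
apply: measurable_funB => //.
apply: (lipschitz_measurable (h := fun w => y + c *: rowv w) (tangent_bounds_lipschitz Fp pL)) => j.
exact: measurable_rowv.
Qed.

Let line c (w : n.-tuple R) i t : y + c *: rowv (upd w i t) =
  (y + c *: rowv (upd w i 0)) + (c * t) *: delta_mx 0 i.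
Proof. by rewrite rowv_upd scalerDr addrA scalerA. Qed.

Let partialsH c : partials (H c) (h c).
Proof.
move=> i w; set x := y + c *: rowv (upd w i 0).
have cF : continuous (fun t : R => F (x + t *: delta_mx 0 i)).
  move=> t; apply: differentiable_continuous; apply/derivable1_diffP.
  by have [] := tangent_bounds_is_derive K0 Fp x i t.
have cp : continuous (fun t : R => p (x + t *: delta_mx 0 i) 0 i).
  exact: (tangent_bounds_continuous K0 Fp).
have cmul : continuous (fun t : R => c * t).
  by move=> t; apply: cvgM; [exact: cvg_cst|exact: cvg_id].
split.
  move=> t; rewrite /H /truncf /h line -/x.
  under eq_fun do rewrite line -/x.
  have dc : is_derive t 1 (fun t : R => c * t) c.
    by apply: (is_derive_eq (is_deriveM (is_derive_cst c t 1) (is_derive_id t 1)));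
      rewrite scaler0 addr0 [LHS]mulr1.
  have dF := @is_derive1_comp R _ _ t _ _ (tangent_bounds_is_derive K0 Fp x i (c * t)) dc.
  have dFy := is_deriveB dF (is_derive_cst (F y) t 1).
  have dT := @is_derive1_comp R _ _ t _ _ (is_derive_trunc M0 _) dFy.
  by apply: (is_derive_eq dT); rewrite subr0 /=; ring.
rewrite /h; under eq_fun do rewrite line -/x.
move=> t; apply: cvgM.
  apply: cvgM; first exact: cvg_cst.
  apply: (@continuous_comp _ _ _ (fun t : R => F (x + (c * t) *: delta_mx 0 i) - F y)); last first.
    exact: continuous_dtrunc.
  apply: cvgB; last exact: cvg_cst.
  exact: (@continuous_comp _ _ _ (fun t : R => c * t) (fun t : R => F (x + t *: delta_mx 0 i))
    t (cmul t) (cF _)).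
exact: (@continuous_comp _ _ _ (fun t : R => c * t) (fun t : R => p (x + t *: delta_mx 0 i) 0 i)
  t (cmul t) (cp _)).
Qed.

(** The partial derivatives of [H c] are the components of [p] times [c] and a factor of size at
    most 1, so their squares sum to at most [c ^+ 2 * L ^+ 2], whatever the dimension. *)
Lemma truncf_variance c :
  mean Q (fun w => (H c w - mean Q (H c)) ^+ 2) <= 4 * (c ^+ 2 * L ^+ 2).
Proof.
apply: (le_trans (poincare_iid (bH c) (bh c) (@partialsH c))).
rewrite ler_pM2l// -mean_sum => [|i]; last exact: bmeasX.
rewrite -(mean_cst Q (c ^+ 2 * L ^+ 2)); apply: le_mean => [||w]; [| exact: bmeas_cst|].
  by apply: bmeas_sum => i; exact: bmeasX.
rewrite /h; set D := dtrunc _ _; set q := p _.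
have -> : \sum_i (c * D * q 0 i) ^+ 2 = c ^+ 2 * (D ^+ 2 * l2norm q ^+ 2).
  by rewrite sqr_l2norm mulrA mulr_sumr; apply: eq_bigr => i _; ring.
rewrite ler_wpM2l ?sqr_ge0// -[leRHS]mul1r ler_pM ?sqr_ge0//.
  rewrite -[leRHS](expr1n _ 2) -[D ^+ 2]real_normK ?num_real//.
  by rewrite ler_pXn2r ?nnegrE// dtrunc_bound.
by rewrite ler_pXn2r ?nnegrE ?l2norm_ge0 ?L0 ?pL.
Qed.

(** By symmetry of the Laplace law both terms have the same mean [m]; then
    [(a - b)^2 <= 2 (a - m)^2 + 2 (b - m)^2] and two variances at most [4 c^2 L^2] give 16. *)
Lemma truncf_odd_variance c :
  mean Q (fun w => (truncf (c *: rowv w) - truncf (- (c *: rowv w))) ^+ 2) <=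
  16 * (c ^+ 2 * L ^+ 2).
Proof.
have eN w : truncf (- (c *: rowv w)) = H (- c) w by rewrite /H scaleNr.
under eq_mean do rewrite eN.
have em : mean Q (H (- c)) = mean Q (H c).
  rewrite -(mean_iid_lap_opp (bH c)); apply: eq_mean => w.
  by rewrite /H rowv_scalet scalerA mulrN1.
have h1 := truncf_variance c; have := truncf_variance (- c).
rewrite em sqrrN; set m := mean Q (H c) in h1 *.
set V1 := mean Q _ in h1 *; set V2 := mean Q _ => h2.
apply: (@le_trans _ _ (2 * V1 + 2 * V2)); last by lra.
have b1 : bmeas (fun w => (H c w - m) ^+ 2).
  by apply: bmeasX; apply: bmeasB => //; exact: bmeas_cst.
have b2 : bmeas (fun w => (H (- c) w - m) ^+ 2).
  by apply: bmeasX; apply: bmeasB => //; exact: bmeas_cst.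
rewrite -!meanZ// -meanD; [|by apply: bmeasM => //; exact: bmeas_cst..].
apply: le_mean => [||w].
- exact: bmeasX 2 (bmeasB (bH c) (bH (- c))).
- by apply: bmeasD; apply: bmeasM => //; exact: bmeas_cst.
rewrite -/(H c w).
by have := sqr_ge0 ((H c w - m) + (H (- c) w - m)); nra.
Qed.

End TruncatedVariance.

Section SphereVariance.
Context {R : realType} {n : nat}.
Notation d := n.+1.
Variables (F : 'rV[R]_d -> R) (p : 'rV[R]_d -> 'rV[R]_d) (K L M : R).
Hypotheses (K0 : 0 <= K) (Fp : tangent_bounds F p K) (M0 : 0 < M).
Hypothesis pL : forall x, l2norm (p x) <= L.
Variable y : 'rV[R]_d.
Notation Q := (iid (lap R) d).
Notation tr := (truncf F M y).

Lemma l2norm_nrm_dist (w : d.-tuple R) :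
  l2norm (rowv (nrm w) - d%:R^-1 *: rowv w) ^+ 2 =
  d%:R ^- 2 * (l2sq (nrm w) * (l1n w - d%:R) ^+ 2).
Proof.
have [w0|w0] := eqVneq (l1n w) 0.
  have r0 : rowv w = 0.
    apply: l2norm_eq0; apply/eqP; rewrite -(@eqrXn2 _ 2)// ?l2norm_ge0// expr0n /=.
    have := l2norm_rowv_le w; rewrite w0 => h.
    by have := l2norm_ge0 (rowv w); rewrite (@le_anti _ _ (l2norm (rowv w)) 0) ?expr0n ?h ?l2norm_ge0.
  rewrite /nrm rowv_scalet r0 !scaler0 subr0 l2norm0 l2sq_scalet -sqr_l2norm_rowv r0 l2norm0.
  by rewrite expr0n /= mulr0 mul0r mulr0.
have -> : rowv w = l1n w *: rowv (nrm w).
  by rewrite /nrm rowv_scalet scalerA divff// scale1r.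
rewrite scalerA -[X in l2norm (X - _)]scale1r -scalerBl l2normZ exprMn.
rewrite real_normK ?num_real// sqr_l2norm_rowv; field.
by rewrite addrC natr1 pnatr_eq0.
Qed.

(** The sphere point [s = nrm w] is coupled with [w / d]. The difference [B] at [w / d] has second
    moment at most 16 units [mu^2 L^2 / d^2] by Poincare; by Lipschitz continuity [A - B] has at
    most [4 * 2 = 8], as [E |s - w / d|^2 <= 2 / d^2]. Then [A^2 <= 2 (A - B)^2 + 2 B^2] gives
    48. *)
Lemma sphere_truncf_variance (mu : R) :
  mean (sphere_law d) (fun s => (tr (mu *: rowv s) - tr (- (mu *: rowv s))) ^+ 2) <=
  48 * (mu ^+ 2 * L ^+ 2 / d%:R ^+ 2).
Proof.
have d0 : 0 < d%:R :> R by [].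
have bt (c : R) : bmeas (fun w : d.-tuple R => tr (c *: rowv w)).
  apply: (bmeas_truncf Fp M0 pL) => i; have := measurable_rowv (0 : 'rV[R]_d) c i.
  by under eq_fun do rewrite add0r.
have btn (c : R) : bmeas (fun w : d.-tuple R => tr (- (c *: rowv w))).
  by under eq_fun do rewrite -scaleNr; exact: bt.
have bd (c : R) : bmeas (fun w : d.-tuple R => tr (c *: rowv w) - tr (- (c *: rowv w))).
  exact: bmeasB (bt c) (btn c).
rewrite mean_sphere_lawE; last exact: bmeasX 2 (bd mu).
have mn : measurable_fun [set: d.-tuple R] (@nrm R d) by exact: measurable_nrm.
pose A w := tr (mu *: rowv (nrm w)) - tr (- (mu *: rowv (nrm w))).
pose B w := tr (mu / d%:R *: rowv w) - tr (- (mu / d%:R *: rowv w)).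
have bA : bmeas A by exact: (bmeas_comp (bd mu) mn).
have bB : bmeas B by exact: bd.
have L0 : 0 <= L by exact: le_trans (l2norm_ge0 _) (pL 0).
have AB w : (A w - B w) ^+ 2 <=
    4 * mu ^+ 2 * L ^+ 2 * (d%:R ^- 2 * (l2sq (nrm w) * (l1n w - d%:R) ^+ 2)).
  rewrite -l2norm_nrm_dist; set D := l2norm _.
  have h : `|A w - B w| <= 2 * (L * (`|mu| * D)).
    rewrite (_ : A w - B w = (tr (mu *: rowv (nrm w)) - tr (mu / d%:R *: rowv w)) -
      (tr (- (mu *: rowv (nrm w))) - tr (- (mu / d%:R *: rowv w)))); last by rewrite /A /B; ring.
    apply: (le_trans (ler_normB _ _)); rewrite mulr2n mulrDl mul1r lerD//.
      apply: (le_trans (truncf_lipschitz Fp M0 pL y _ _)).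
      by rewrite -scalerA -scalerBr l2normZ.
    apply: (le_trans (truncf_lipschitz Fp M0 pL y _ _)).
    by rewrite -opprD l2normN -scalerN -scalerA -scalerDr l2normZ scalerN.
  rewrite -[leLHS]real_normK ?num_real//.
  apply: (@le_trans _ _ ((2 * (L * (`|mu| * D))) ^+ 2)).
    by rewrite ler_pXn2r ?nnegrE ?mulr_ge0 ?l2norm_ge0.
  rewrite (_ : _ ^+ 2 = 4 * (`|mu| ^+ 2) * L ^+ 2 * D ^+ 2); last by ring.
  by rewrite real_normK ?num_real.
have mAB : mean Q (fun w => (A w - B w) ^+ 2) <= 8 * (mu ^+ 2 * L ^+ 2 / d%:R ^+ 2).
  set k := 4 * mu ^+ 2 * L ^+ 2 * d%:R ^- 2.
  have k0 : 0 <= k by rewrite /k divr_ge0 ?sqr_ge0// mulr_ge0 ?sqr_ge0// mulr_ge0 ?sqr_ge0.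
  pose J : \bar R := (\int[Q]_w (l2sq (nrm w) * (l1n w - d%:R) ^+ 2)%:E)%E.
  have mJ : measurable_fun [set: d.-tuple R] (fun w : d.-tuple R =>
      l2sq (nrm w) * (l1n w - d%:R) ^+ 2).
    apply: measurable_funM; first exact: (measurableT_comp (@measurable_l2sq R d) mn).
    apply: measurable_funX; apply: measurable_funB => //; exact: measurable_l1n.
  have hle : ((mean Q (fun w => (A w - B w) ^+ 2))%:E <= k%:E * J)%E.
    rewrite -meanE; last exact: bmeasX 2 (bmeasB bA bB).
    rewrite /J -ge0_integralZl//; last 2 first.
    - exact/measurable_EFinP.
    - by move=> w _; rewrite lee_fin mulr_ge0 ?l2sq_ge0 ?sqr_ge0.
    apply: ge0_le_integral => //.
    - by move=> w _; rewrite lee_fin sqr_ge0.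
    - by apply/measurable_EFinP; exact: bmeasW (bmeasX 2 (bmeasB bA bB)).
    - by apply/measurable_EFinP; exact: measurable_funM.
    by move=> w _; rewrite -EFinM lee_fin; apply: (le_trans (AB w)); rewrite mulrA.
  have hJ : (J <= 2%:E)%E.
    have := @integral_nrm_dist R n; rewrite -/J.
    have J0 : (0 <= J)%E.
      by apply: integral_ge0 => w _; rewrite lee_fin mulr_ge0 ?l2sq_ge0 ?sqr_ge0.
    move: J0; clear hle; clearbody J; case: J => [j||]//; last by rewrite mulry gtr0_sg ?mulr_gt0// mul1e.
    rewrite lee_fin -EFinM => j0 [] e; rewrite lee_fin.
    rewrite -(@ler_pM2l _ (n.+2%:R * d%:R)) ?mulr_gt0// e mulrAC [leRHS]mulrC -mulrA.
    rewrite mulrA [leRHS]mulrA ler_pM2r// ler_pM2l//.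
    by rewrite ler_nat.
  have hk : (k%:E * J <= (k * 2)%:E)%E by rewrite (EFinM k 2) lee_wpmul2l ?lee_fin.
  have := le_trans hle hk; rewrite lee_fin => h; apply: (le_trans h).
  by rewrite le_eqVlt; apply/orP; left; apply/eqP; rewrite /k; ring.
have mB : mean Q (fun w => B w ^+ 2) <= 16 * (mu ^+ 2 * L ^+ 2 / d%:R ^+ 2).
  have := truncf_odd_variance K0 Fp M0 pL y (mu / d%:R).
  by rewrite -/B exprMn exprVn mulrAC.
apply: (@le_trans _ _ (2 * mean Q (fun w => (A w - B w) ^+ 2) + 2 * mean Q (fun w => B w ^+ 2))).
  rewrite -!meanZ; [|exact: bmeasX|exact: bmeasX 2 (bmeasB bA bB)].
  have b1 : bmeas (fun w => 2 * (A w - B w) ^+ 2).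
    by apply: bmeasM; [exact: bmeas_cst|exact: bmeasX 2 (bmeasB bA bB)].
  have b2 : bmeas (fun w => 2 * B w ^+ 2) by apply: bmeasM; [exact: bmeas_cst|exact: bmeasX].
  rewrite -meanD//; apply: le_mean => [||w]; [exact: bmeasX|exact: bmeasD|].
  rewrite -/(A w); have := sqr_ge0 (A w - 2 * B w); nra.
move: mAB mB; set Z := _ / _; set a := mean _ _; set b := mean _ _; lra.
Qed.

End SphereVariance.

Section BallMean.
Context {R : realType} {n : nat}.
Notation d := n.+1.
Variables (F : 'rV[R]_d -> R) (p : 'rV[R]_d -> 'rV[R]_d) (K L : R).
Hypotheses (K0 : 0 <= K) (Fp : tangent_bounds F p K).
Hypothesis pL : forall x, l2norm (p x) <= L.
Variable y : 'rV[R]_d.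
Notation Q := (iid (lap R) d).
Notation law := (@sphere_law R d).

(** The average over the unit l1-ball for Lebesgue measure. *)
Definition ball_mean (phi : d.-tuple R -> R) : R :=
  mean Q (fun w => ball_weight w * phi w) / mean Q (@ball_weight R d).

Let measF (c : R) : measurable_fun [set: d.-tuple R] (fun w => F (y + c *: rowv w)).
Proof.
apply: (lipschitz_measurable (h := fun s => y + c *: rowv s)
  (tangent_bounds_lipschitz Fp pL)) => i.
exact: measurable_rowv.
Qed.

Let bp (c : R) i : bmeas (fun w : d.-tuple R => p (y + c *: rowv w) 0 i).
Proof.
split; last by exists L => w; exact: le_trans (coord_le_l2norm _ _) (pL _).
apply: (tangent_bounds_measurable (h := fun w => y + c *: rowv w) i K0 Fp pL) => j.
exact: measurable_rowv.
Qed.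

Let L0 : 0 <= L.
Proof. exact: le_trans (l2norm_ge0 _) (pL 0). Qed.

Lemma bmeas_on_ball_tangent (c : R) :
  bmeas (fun w : d.-tuple R => (l1n w <= 1)%R%:R * F (y + c *: rowv w)).
Proof.
apply: (@bmeas_on_ball R d _ (`|F y| + L * `|c|)) => // w w1.
have := tangent_bounds_lipschitz Fp pL (y + c *: rowv w) y.
rewrite (_ : y + _ - y = c *: rowv w); last by rewrite addrC addKr.
rewrite l2normZ => h.
have h2 : L * (`|c| * l2norm (rowv w)) <= L * `|c|.
  rewrite mulrA -[leRHS]mulr1 ler_wpM2l ?mulr_ge0//.
  exact: le_trans (l2norm_rowv_le w) w1.
rewrite -[F _ in leLHS](subrK (F y)); apply: (le_trans (ler_normD _ _)).
by rewrite addrC lerD2l; apply: le_trans h _.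
Qed.

(** The Stokes formula for [w |-> F (y + c w)]; the chain rule produces the factor [c], which is
    taken to be [mu] and [- mu] later on. *)
Lemma sphere_gradient_coord (c : R) i :
  d%:R * mean law (fun s => Num.sg (tnth s i) * ((l1n s <= 1)%R%:R * F (y + c *: rowv s))) =
  c * ball_mean (fun w => p (y + c *: rowv w) 0 i).
Proof.
have [M FM] := (bmeas_on_ball_tangent c).2.
have line (z : n.-tuple R) t : y + c *: rowv (ins i z t) =
    (y + c *: rowv (ins i z 0)) + (c * t) *: delta_mx 0 i.
  by rewrite rowv_ins scalerDr addrA scalerA.
have cmul : continuous (fun t : R => c * t).
  by move=> t; apply: cvgM; [exact: cvg_cst|exact: cvg_id].
have st := @stokes R n i (fun w => F (y + c *: rowv w)) (fun w => c * p (y + c *: rowv w) 0 i)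
  (M + `|c| * L) (measF c).
apply: (eq_trans (st _ _ _ _ _)); last 1 first.
- rewrite /ball_mean mulrA; congr (_ / _).
  rewrite -meanZ; last by apply: bmeasM => //; exact: bmeas_ball_weight.
  by apply: eq_mean => w; ring.
- by apply: measurable_funM => //; exact: bmeasW (bp c i).
- move=> w w1; have := FM w; rewrite w1 mul1r => h; apply: (le_trans h).
  by rewrite lerDl mulr_ge0.
- move=> w w1; rewrite normrM.
  have M0 : 0 <= M by exact: le_trans (normr_ge0 _) (FM w).
  apply: (@le_trans _ _ (`|c| * L)); last by rewrite lerDr.
  by rewrite ler_wpM2l//; exact: le_trans (coord_le_l2norm _ _) (pL _).
- move=> z t; set x := y + c *: rowv (ins i z 0).
  rewrite line; under eq_fun do rewrite line -/x.
  have dc : is_derive t 1 (fun t : R => c * t) c.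
    by apply: (is_derive_eq (is_deriveM (is_derive_cst c t 1) (is_derive_id t 1)));
      rewrite scaler0 addr0 [LHS]mulr1.
  have dF := @is_derive1_comp R _ _ t _ _ (tangent_bounds_is_derive K0 Fp x i (c * t)) dc.
  by apply: (is_derive_eq dF); rewrite mulrC.
- move=> z; set x := y + c *: rowv (ins i z 0).
  under eq_fun do rewrite line -/x.
  have cp : continuous (fun t : R => p (x + t *: delta_mx 0 i) 0 i).
    exact: (tangent_bounds_continuous K0 Fp).
  move=> t; apply: cvgM; first exact: cvg_cst.
  exact: (@continuous_comp _ _ _ (fun t : R => c * t) (fun t : R => p (x + t *: delta_mx 0 i) 0 i)
    t (cmul t) (cp _)).
Qed.

(** At each point [x = y + c w] of the average, convexity gives [dot (p x) v >= F x - F (x - v)];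
    moving back from [x] to [y] and from [x - v] to [y - v] costs [L * |c|] each. *)
Lemma ball_mean_gradient_ge (c : R) (v : 'rV[R]_d) :
  F y - F (y - v) - 2 * L * `|c| <= \sum_i v 0 i * ball_mean (fun w => p (y + c *: rowv w) 0 i).
Proof.
have W0 := mean_ball_weight_gt0 (R := R) n.
have bw := @bmeas_ball_weight R d.
have FL := tangent_bounds_lipschitz Fp pL.
have bpi i : bmeas (fun w : d.-tuple R => ball_weight w * p (y + c *: rowv w) 0 i).
  exact: bmeasM.
have -> : \sum_i v 0 i * ball_mean (fun w => p (y + c *: rowv w) 0 i) =
    mean Q (fun w => ball_weight w * dot (p (y + c *: rowv w)) v) / mean Q (@ball_weight R d).
  rewrite /ball_mean; under eq_bigr do rewrite mulrA -meanZ//.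
  rewrite -mulr_suml -mean_sum => [|i]; last by apply: bmeasM => //; exact: bmeas_cst.
  congr (_ / _); apply: eq_mean => w; rewrite mulr_sumr; apply: eq_bigr => i _; ring.
rewrite ler_pdivlMr// -meanZ//; apply: le_mean.
- by apply: bmeasM => //; exact: bmeas_cst.
- under eq_fun do rewrite mulr_sumr.
  apply: bmeas_sum => i; under eq_fun do rewrite mulrA.
  by apply: bmeasM => //; exact: bmeas_cst.
move=> w; rewrite mulrC /ball_weight; case: (leP (l1n w) 1) => w1; last by rewrite !mulr0 !mul0r.
rewrite mulr1 ler_wpM2l ?expR_ge0//.
set x := y + c *: rowv w.
have /andP[h1 _] := Fp x (- v); rewrite dotNr in h1.
have cw : L * l2norm (c *: rowv w) <= L * `|c|.
  rewrite l2normZ mulrA -[leRHS]mulr1 ler_wpM2l ?mulr_ge0//.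
  exact: le_trans (l2norm_rowv_le w) w1.
have := FL x y; rewrite (_ : x - y = c *: rowv w); last by rewrite /x addrC addKr.
rewrite ler_norml => /andP[h2 _].
have := FL (x - v) (y - v); rewrite (_ : x - v - (y - v) = c *: rowv w); last first.
  by rewrite opprB addrA subrK /x addrC addKr.
rewrite ler_norml => /andP[_ h3].
by lra.
Qed.

End BallMean.

Section EstimatorBounds.
Context {R : realType} {n : nat}.
Notation d := n.+1.
Notation X := (l2ball 1 : set 'rV[R]_d).
Notation law := (@sphere_law R d).

Lemma le_mean_sphere (f g : d.-tuple R -> R) : bmeas f -> bmeas g ->
  (forall s, l1n s = 1 -> f s <= g s) -> mean law f <= mean law g.
Proof.
move=> bf bg fg.
(* The inequality holds on the sphere only; there [f] agrees with this minimum, which is below [g]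
   everywhere. *)
have bmin : bmeas (fun s => Num.min (f s) (g s)).
  have [mf [M fM]] := bf; have [mg [N gN]] := bg.
  split; first exact: measurable_minr.
  exists (M + N) => s; have := fM s; have := gN s.
  have := normr_ge0 (f s); have := normr_ge0 (g s).
  by rewrite /Num.min; case: ifP => _; lra.
rewrite (@sphere_law_ae_eq R n ord0 f _ bf bmin); last first.
  by move=> s _ s1; rewrite min_l// fg.
by apply: le_mean => // s; rewrite ge_min lexx orbT.
Qed.

Variables (f h : 'rV[R]_d -> R) (G B : R).
Hypotheses (G0 : 0 < G) (cf : convexf f) (lf : lipschitz_on X G f).
Hypotheses (hf : forall x, X x -> h x = f x) (hB : forall x, `|h x| <= B).
Hypothesis lh : forall x z, `|h x - h z| <= G * l2norm (x - z).
Variables (y : 'rV[R]_d) (mu : R).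
Hypotheses (mu0 : 0 < mu) (ymu : l2norm y + mu <= 1).

Let in_ball (s : d.-tuple R) (c : R) : l1n s <= 1 -> `|c| <= mu -> X (y + c *: rowv s).
Proof.
move=> s1 cmu; rewrite /l2ball /=; apply: (le_trans (l2normD _ _)).
apply: le_trans ymu; rewrite lerD2l l2normZ -[leRHS]mulr1 ler_pM ?l2norm_ge0//.
exact: le_trans (l2norm_rowv_le s) s1.
Qed.

Let bh (c : R) : bmeas (fun s : d.-tuple R => h (y + c *: rowv s)).
Proof.
split; last by exists B => s.
apply: (lipschitz_measurable (h := fun s => y + c *: rowv s) lh) => i.
exact: measurable_rowv.
Qed.

Let bhB : bmeas (fun s : d.-tuple R => h (y + mu *: rowv s) - h (y - mu *: rowv s)).
Proof.
apply: bmeasB; first exact: bh.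
by under eq_fun do rewrite -scaleNr; exact: bh.
Qed.

(** Smoothing at scale [mu / d] costs [e = 2 G mu / d], of the order of the standard deviation
    itself. From [|a - b| <= 3 |T| + e] one gets [(a - b)^2 <= 18 T^2 + 2 e^2]; with [L = 2 G] the
    total is [18 * 48 * 4 + 8 = 3464] units [Z]. *)
Lemma sphere_difference_variance :
  mean law (fun s => (h (y + mu *: rowv s) - h (y - mu *: rowv s)) ^+ 2) <=
  3600 * (G ^+ 2 * mu ^+ 2 / d%:R ^+ 2).
Proof.
have d0 : 0 < d%:R :> R by [].
have del0 : 0 < mu / d%:R by rewrite divr_gt0.
have [F [p [fF pL Fp]]] := smooth_approximation cf lf G0 del0.
set K := _ / _ in Fp; have K0 : 0 <= K by rewrite divr_ge0 ?(ltW G0) ?(ltW del0).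
(* [F] is [2 G]-Lipschitz, so its increments over distance [mu] stay within [M / 2], the range where
   the truncation can be undone. *)
pose M := 4 * G * mu; have M0 : 0 < M by rewrite !mulr_gt0.
have V := sphere_truncf_variance K0 Fp M0 pL y mu.
set tr := truncf F M y in V.
pose Z := G ^+ 2 * mu ^+ 2 / d%:R ^+ 2.
have bD : bmeas (fun s : d.-tuple R => (tr (mu *: rowv s) - tr (- (mu *: rowv s))) ^+ 2).
  have bt (c : R) : bmeas (fun w : d.-tuple R => tr (c *: rowv w)).
    apply: (bmeas_truncf Fp M0 pL) => i; have := measurable_rowv (0 : 'rV[R]_d) c i.
    by under eq_fun do rewrite add0r.
  apply: bmeasX; apply: bmeasB; first exact: bt.
  by under eq_fun do rewrite -scaleNr; exact: bt.
apply: (@le_trans _ _ (mean law (fun s => 18 * (tr (mu *: rowv s) - tr (- (mu *: rowv s))) ^+ 2 +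
    8 * Z))); last first.
  rewrite mean_shift; last by apply: bmeasM => //; exact: bmeas_cst.
  rewrite meanZ//.
  have e : mu ^+ 2 * (2 * G) ^+ 2 / d%:R ^+ 2 = 4 * Z by rewrite /Z; ring.
  rewrite e in V; have Z0 : 0 <= Z by rewrite /Z divr_ge0 ?sqr_ge0// mulr_ge0 ?sqr_ge0.
  rewrite -/Z; move: V; set v := mean _ _; lra.
apply: le_mean_sphere => [||s s1].
- exact: bmeasX 2 bhB.
- by apply: bmeasD; [apply: bmeasM => //|]; exact: bmeas_cst.
have mu1 : `|mu| <= mu by rewrite gtr0_norm.
have Xp : X (y + mu *: rowv s) by apply: in_ball; rewrite ?s1.
have Xm : X (y - mu *: rowv s).
  by rewrite -scaleNr; apply: in_ball; rewrite ?s1 ?normrN.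
rewrite (hf Xp) (hf Xm).
have /andP[p1 p2] := fF _ Xp; have /andP[m1 m2] := fF _ Xm.
have FL := tangent_bounds_lipschitz Fp pL.
have r1 : l2norm (mu *: rowv s) <= mu.
  rewrite l2normZ gtr0_norm// -[leRHS]mulr1 ler_pM2l// -s1; exact: l2norm_rowv_le.
have small v : l2norm v <= mu -> `|F (y + v) - F y| <= M / 2.
  move=> vm; apply: (le_trans (FL _ _)).
  rewrite (_ : y + v - y = v); last by rewrite addrC addKr.
  by rewrite (_ : M / 2 = 2 * G * mu) ?ler_pM2l ?mulr_gt0// /M; field.
have E := trunc_expand M0 (small _ r1) (small (- (mu *: rowv s)) _).
rewrite l2normN in E; have {E} := E r1; rewrite -!/(truncf F M y _) -/tr.
rewrite (_ : _ - _ - _ = F (y + mu *: rowv s) - F (y - mu *: rowv s)); last by ring.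
move: p1 p2 m1 m2; set a := f _; set b := f _; set a' := F _; set b' := F _.
set T := tr _ - tr _ => p1 p2 m1 m2 E.
set e := 2 * G * _ in p2 m2.
have eZ : e ^+ 2 = 4 * Z by rewrite /e /Z -exprVn; ring.
have hab : `|a - b| <= 3 * `|T| + e.
  have : `|a - b| <= `|a' - b'| + e.
    rewrite ler_norml; have := ler_norm (a' - b'); have := ler_norm (- (a' - b')).
    by rewrite normrN => h1 h2; apply/andP; split; lra.
  by move=> h1; lra.
have e0 : 0 <= e by rewrite !mulr_ge0 ?(ltW G0) ?invr_ge0 ?(ltW mu0).
rewrite -[(a - b) ^+ 2]real_normK ?num_real// -[T ^+ 2]real_normK ?num_real//.
have -> : 8 * Z = 2 * e ^+ 2 by rewrite eZ; ring.
have := normr_ge0 (a - b); have := normr_ge0 T.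
have := sqr_ge0 (3 * `|T| - e); nra.
Qed.

(** The constant is [8 = 2 + 4 + 2]: replacing [h] by [F] in the estimator, moving the gradient
    average back to [y] ([2 * L * mu] with [L = 2 G]), and comparing [F u] with [f u]. *)
Lemma sphere_estimate_bias (u : 'rV[R]_d) : X u ->
  f y - f u - 8 * (G * mu) <=
  mean law (fun s => dot (pbmd_estimate mu h y (rowv s)) (y - u)).
Proof.
move=> Xu; have d0 : 0 < d%:R :> R by [].
have Xy : l2norm y <= 1 by apply: le_trans ymu; rewrite lerDl ltW.
have mu1 : mu <= 1 by apply: le_trans ymu; rewrite lerDr l2norm_ge0.
(* The error [2 G del] enters [d] coordinates, each with a factor [d / (2 mu)] and a component of
   [y - u] of size at most 2; the square makes the total [2 G mu]. *)
pose del := (mu / d%:R) ^+ 2; have del0 : 0 < del by rewrite exprn_gt0// divr_gt0.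
have delmu : del <= mu.
  have h1 : mu / d%:R <= mu by rewrite ler_pdivrMr// ler_peMr ?(ltW mu0)// ler1n.
  have h2 : 0 <= mu / d%:R by rewrite divr_ge0 ?(ltW mu0).
  rewrite /del expr2; apply: le_trans h1; rewrite ler_piMl//.
  by rewrite ler_pdivrMr// mul1r (le_trans mu1)// ler1n.
have [F [p [fF pL Fp]]] := smooth_approximation cf lf G0 del0.
set K := _ / _ in Fp; have K0 : 0 <= K by rewrite divr_ge0 ?(ltW G0) ?(ltW del0).
pose v := y - u; pose k : R := d%:R / (2 * mu).
have k0 : 0 <= k by rewrite divr_ge0 ?mulr_ge0 ?(ltW mu0).
pose D s := h (y + mu *: rowv s) - h (y - mu *: rowv s).
pose Fc c (s : d.-tuple R) := (l1n s <= 1)%R%:R * F (y + c *: rowv s).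
pose DF s := Fc mu s - Fc (- mu) s.
pose sg i (s : d.-tuple R) := Num.sg (tnth s i).
have bsg i : bmeas (sg i) by exact: bmeas_sg_tnth.
have bF c : bmeas (Fc c) by exact: bmeas_on_ball_tangent Fp pL y c.
have bDF : bmeas DF by exact: bmeasB.
have bsgF i c : bmeas (fun s => sg i s * Fc c s) by exact: bmeasM.
pose E s := \sum_i v 0 i * (k * D s * sg i s).
have bE1 i : bmeas (fun s => k * D s * sg i s).
  by apply: bmeasM => //; apply: bmeasM => //; exact: bmeas_cst.
have bE2 i : bmeas (fun s : d.-tuple R => k * D s * (if 0 <= tnth s i then 1 else -1)).
  apply: bmeasM; first by apply: bmeasM => //; exact: bmeas_cst.
  rewrite (_ : (fun _ => _) = (fun s : d.-tuple R => 2 * (0 <= tnth s i)%R%:R - 1)); last first.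
    by apply/funext => s; case: ifP => _; rewrite ?mulr1 ?mulr0; ring.
  apply: bmeasB; last exact: bmeas_cst.
  apply: bmeasM; first exact: bmeas_cst.
  by apply: bmeas_nat_of_bool; apply: measurable_fun_ler => //; exact: measurable_tnth.
have -> : mean law (fun s => dot (pbmd_estimate mu h y (rowv s)) (y - u)) = mean law E.
  rewrite /pbmd_estimate -/k.
  rewrite /E -/v [RHS]mean_sum => [|i]; last exact: bmeasM (bmeas_cst _ _) (bE1 i).
  transitivity (\sum_i v 0 i * mean law (fun s : d.-tuple R =>
      k * D s * (if 0 <= tnth s i then 1 else -1))).
    under [RHS]eq_bigr do rewrite -meanZ//.
    rewrite -mean_sum => [|i]; last exact: bmeasM (bmeas_cst _ _) (bE2 i).
    by apply: eq_mean => s; apply: eq_bigr => i _; rewrite !mxE /D; ring.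
  apply: eq_bigr => i _; rewrite meanZ//; congr (_ * _).
  (* The two conventions for the sign of 0 differ on a null set; [Num.sg] is the sign that the
     Stokes formula uses. *)
  apply: (@sphere_law_ae_eq R n i _ _ (bE2 i) (bE1 i)) => s si _; congr (_ * _).
  rewrite /sg; case: (leP 0 (tnth s i)) => h0; last by rewrite ltr0_sg.
  by rewrite gtr0_sg// lt_def si.
pose E' s := \sum_i v 0 i * (k * DF s * sg i s).
have bE' i : bmeas (fun s => k * DF s * sg i s).
  by apply: bmeasM => //; apply: bmeasM => //; exact: bmeas_cst.
have bsum (H : 'I_d -> d.-tuple R -> R) : (forall i, bmeas (H i)) ->
    bmeas (fun s => \sum_i v 0 i * H i s).
  by move=> bH; apply: bmeas_sum => i; apply: bmeasM => //; exact: bmeas_cst.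
have E'E : mean law E' - 2 * (G * mu) <= mean law E.
  rewrite -mean_shift; last exact: bsum.
  apply: le_mean_sphere => [||s s1]; [| exact: bsum|].
    by apply: bmeasD; [exact: bsum|exact: bmeas_cst].
  have mun : `|mu| <= mu by rewrite gtr0_norm.
  have Xp : X (y + mu *: rowv s) by apply: in_ball; rewrite ?s1.
  have Xm : X (y - mu *: rowv s).
    by rewrite -scaleNr; apply: in_ball; rewrite ?s1 ?normrN.
  have DDF : `|DF s - D s| <= 2 * G * del.
    rewrite /DF /D /Fc s1 lexx mul1r mul1r scaleNr (hf Xp) (hf Xm).
    have /andP[p1 p2] := fF _ Xp; have /andP[m1 m2] := fF _ Xm.
    by rewrite ler_norml; apply/andP; split; lra.
  rewrite lerBlDr -lerBlDl /E /E' -sumrB.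
  apply: (le_trans (ler_norm _)); apply: (le_trans (ler_norm_sum _ _ _)).
  apply: (@le_trans _ _ (\sum_(i < d) 2 * (k * (2 * G * del)))).
    apply: ler_sum => i _; rewrite -mulrBr -mulrBl -mulrBr.
    rewrite normrM (normrM (k * _)) (normrM k).
    have vi : `|v 0 i| <= 2.
      apply: (le_trans (coord_le_l2norm _ _)); apply: (le_trans (l2normB _ _)).
      by move: Xy Xu; rewrite /l2ball /=; lra.
    have sgi : `|sg i s| <= 1 by rewrite normr_sg; case: (_ != _).
    have kD := mulr_ge0 k0 (normr_ge0 (DF s - D s)).
    rewrite (ger0_norm k0); apply: ler_pM vi _ => //; first exact: mulr_ge0.
    rewrite -[leRHS]mulr1; apply: ler_pM sgi => //.
    by rewrite ler_wpM2l.
  rewrite sumr_const card_ord -[leLHS]mulr_natl le_eqVlt; apply/orP; left; apply/eqP.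
  by rewrite /k /del; field; rewrite (gt_eqF mu0) /= ?andbT addrC natr1 pnatr_eq0.
apply: le_trans E'E; rewrite lerBrDr.
(* Each of the two queries gives a Stokes formula, for [mu] and for [- mu]; the factor [d / (2 mu)]
   turns their difference into the half-sum of two ball averages. *)
have -> : mean law E' = 2^-1 * (\sum_i v 0 i * ball_mean (fun w => p (y + mu *: rowv w) 0 i)) +
    2^-1 * (\sum_i v 0 i * ball_mean (fun w => p (y + - mu *: rowv w) 0 i)).
  rewrite /E' mean_sum => [|i]; last exact: bmeasM (bmeas_cst _ _) (bE' i).
  rewrite !mulr_sumr -big_split /=; apply: eq_bigr => i _.
  rewrite meanZ//.
  have h1 := sphere_gradient_coord K0 Fp pL y mu i.
  have h2 := sphere_gradient_coord K0 Fp pL y (- mu) i.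
  move: h1 h2; set c1 := ball_mean _; set c2 := ball_mean _ => h1 h2.
  rewrite (_ : _ + _ = v 0 i * (2^-1 * (c1 + c2))); last by ring.
  congr (_ * _).
  transitivity (mean law (fun s => k * (sg i s * Fc mu s - sg i s * Fc (- mu) s))).
    by apply: eq_mean => s; rewrite /DF; ring.
  rewrite meanZ; last exact: bmeasB (bsgF i mu) (bsgF i (- mu)).
  rewrite (meanB _ (bsgF i mu) (bsgF i (- mu))).
  rewrite /k mulrAC mulrBr h1 h2; field.
  by rewrite gt_eqF.
have g1 := ball_mean_gradient_ge K0 Fp pL y mu v.
have g2 := ball_mean_gradient_ge K0 Fp pL y (- mu) v.
rewrite normrN (gtr0_norm mu0) in g2; rewrite (gtr0_norm mu0) in g1.
rewrite /v subKr -/v in g1 g2.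
have /andP[y1 _] := fF _ Xy; have /andP[_ u2] := fF _ Xu.
have Gd : G * del <= G * mu by rewrite ler_pM2l.
move: g1 g2; set S1 := \sum_i _; set S2 := \sum_i _ => g1 g2.
by lra.
Qed.

(** [signv] has squared norm exactly [d], so the bound is [(d / (2 mu))^2 * d] times the second
    moment of the difference, and [3600 / 4 = 900]. *)
Lemma sphere_estimate_second_moment :
  mean law (fun s => l2norm (pbmd_estimate mu h y (rowv s)) ^+ 2) <= 900 * (G ^+ 2 * d%:R).
Proof.
have d0 : 0 < d%:R :> R by [].
pose c : R := (d%:R / (2 * mu)) ^+ 2 * d%:R.
have c0 : 0 < c by rewrite mulr_gt0// exprn_gt0// divr_gt0// mulr_gt0.
rewrite (@eq_mean _ _ _ _ _ (fun s => c * (h (y + mu *: rowv s) - h (y - mu *: rowv s)) ^+ 2)).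
  rewrite meanZ; last exact: bmeasX 2 bhB.
  apply: (@le_trans _ _ (c * (3600 * (G ^+ 2 * mu ^+ 2 / d%:R ^+ 2)))).
    by rewrite ler_pM2l// sphere_difference_variance.
  rewrite le_eqVlt; apply/orP; left; apply/eqP; rewrite /c; field.
  by rewrite (gt_eqF mu0) /= ?andbT addrC natr1 pnatr_eq0.
move=> s; rewrite /pbmd_estimate l2normZ exprMn real_normK ?num_real//.
by rewrite sqr_l2norm_signv /c; ring.
Qed.

End EstimatorBounds.

(** * Mirror descent and exponential weights *)

Section Projection.
Context {R : realType} {d : nat}.
Implicit Types (x y z u v g : 'rV[R]_d).

Definition half_sq (x : 'rV[R]_d) : R := l2norm x ^+ 2 / 2.

Lemma gradient_half_sq y : gradient half_sq y = y.
Proof.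
apply/rowP => i; rewrite mxE /derive; apply: cvg_lim => //.
have key (h : R) : h != 0 ->
    h^-1 *: (half_sq (h *: delta_mx 0 i + y) - half_sq y) = y 0 i + h / 2.
  move=> h0; rewrite /half_sq [h *: _ + _]addrC sqr_l2normD l2normZ l2norm_delta mulr1.
  by rewrite real_normK ?num_real// dotZr dot_delta /GRing.scale /=; field.
apply/cvgrPdist_le => e e0; near=> h.
have h0 : h != 0 by near: h; exact: nbhs_dnbhs_neq.
rewrite /= key// opprD addrA subrr sub0r normrN normrM normfV (@gtr0_norm _ 2)//.
rewrite ler_pdivrMr//; near: h.
by apply: dnbhs0_le; rewrite mulr_gt0.
Unshelve. all: by end_near. Qed.

Lemma bregman_half_sq x y : bregman half_sq x y = l2norm (x - y) ^+ 2 / 2.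
Proof.
rewrite /bregman gradient_half_sq /half_sq sqr_l2normB dotBr -[dot y y]sqr_l2norm.
by rewrite (dotC y x); field.
Qed.

Lemma shrink_l2ball alpha : 0 < 1 - alpha ->
  shrink alpha (l2ball 1 : set 'rV[R]_d) = l2ball (1 - alpha).
Proof.
move=> a0; apply/seteqP; split=> [_ [x x1 <-]|x xa].
  rewrite /l2ball /= l2normZ gtr0_norm// -[leRHS]mulr1 ler_pM2l//.
exists ((1 - alpha)^-1 *: x); last by rewrite scalerA divff ?scale1r// gt_eqF.
by rewrite /l2ball /= l2normZ gtr0_norm ?invr_gt0// ler_pdivrMl// mulr1.
Qed.

Variable rho : R.
Hypothesis rho0 : 0 < rho.

Definition proj z : 'rV[R]_d := (rho / Num.max rho (l2norm z)) *: z.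

Let max_gt0 z : 0 < Num.max rho (l2norm z).
Proof. by rewrite lt_max rho0. Qed.

Lemma proj_le z : l2norm (proj z) <= rho.
Proof.
rewrite /proj l2normZ ger0_norm ?divr_ge0 ?(ltW rho0) ?(ltW (max_gt0 z))//.
rewrite mulrAC ler_pdivrMr// ler_pM2l// le_max.
by rewrite lexx orbT.
Qed.

Lemma proj_id z : l2norm z <= rho -> proj z = z.
Proof. by move=> h; rewrite /proj max_l// divff ?scale1r// gt_eqF. Qed.

Lemma proj_variational z v : l2norm v <= rho -> dot (z - proj z) (v - proj z) <= 0.
Proof.
move=> vr; have [zr|zr] := leP (l2norm z) rho; first by rewrite proj_id// subrr dot0l.
have z0 : 0 < l2norm z by exact: lt_trans zr.
rewrite /proj max_r ?(ltW zr)//; set c := rho / _.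
have cz : c * l2norm z = rho by rewrite /c divfK// gt_eqF.
have c1 : 0 <= 1 - c by rewrite subr_ge0 /c ler_pdivrMr// mul1r ltW.
rewrite -[X in X - _]scale1r -scalerBl dotZl dotBr dotZr -sqr_l2norm.
have := cauchy_schwarz z v; have := ltW z0; nra.
Qed.

Lemma proj_pythagoras z v : l2norm v <= rho ->
  l2norm (proj z - z) ^+ 2 + l2norm (v - proj z) ^+ 2 <= l2norm (v - z) ^+ 2.
Proof.
move=> vr; have h := proj_variational z vr.
have -> : v - z = (v - proj z) - (z - proj z) by rewrite opprB addrA subrK.
by rewrite (sqr_l2normB (v - proj z)) dotC (l2norm_distC (proj z)); lra.
Qed.

Lemma proj_nonexpansive a b : l2norm (proj a - proj b) <= l2norm (a - b).
Proof.
have h1 := proj_variational a (proj_le b); have h2 := proj_variational b (proj_le a).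
have h3 : dot (a - b) (proj a - proj b) = l2norm (proj a - proj b) ^+ 2 -
    dot (a - proj a) (proj b - proj a) - dot (b - proj b) (proj a - proj b).
  by rewrite sqr_l2norm !(dotBl, dotBr); ring.
have h4 := cauchy_schwarz (a - b) (proj a - proj b).
have := l2norm_ge0 (proj a - proj b); rewrite le_eqVlt => /orP[/eqP <-|h5].
  exact: l2norm_ge0.
by rewrite -(ler_pM2r h5) -expr2; lra.
Qed.

(** Completing the square makes the objective a multiple of the squared distance to [x - eta *: g],
    up to a constant. The Pythagorean inequality gives uniqueness, which the arbitrary choice in
    [argmin] requires. *)
Lemma argmin_mirror g x eta : 0 < eta ->
  argmin (l2ball rho) (fun z => dot g z + eta^-1 * bregman half_sq z x) = proj (x - eta *: g).
Proof.
move=> eta0; set w := x - eta *: g.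
have objE z : dot g z + eta^-1 * bregman half_sq z x =
    l2norm (z - w) ^+ 2 / (2 * eta) + (dot g x - eta / 2 * l2norm g ^+ 2).
  have -> : z - w = (z - x) + eta *: g by rewrite /w opprB addrCA addrC.
  rewrite bregman_half_sq (sqr_l2normD (z - x)) dotZr l2normZ exprMn real_normK ?num_real//.
  by rewrite dotBl (dotC z) (dotC x); field; rewrite gt_eqF.
have e2 : 0 < (2 * eta)^-1 by rewrite invr_gt0 mulr_gt0.
rewrite /argmin; apply: xget_unique.
  split; first exact: proj_le.
  move=> z zr; rewrite !objE lerD2r ler_pM2r//.
  have := proj_pythagoras w zr; have := sqr_ge0 (l2norm (z - proj w)); lra.
move=> z [zr zmin]; have := zmin _ (proj_le w); rewrite !objE lerD2r ler_pM2r// => h.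
have := proj_pythagoras w zr; have h2 := sqr_ge0 (l2norm (z - proj w)) => h3.
apply/eqP; rewrite -subr_eq0; apply/eqP; apply: l2norm_eq0; apply/eqP.
by rewrite -sqrf_eq0 eq_le h2 andbT; lra.
Qed.

Lemma mirror_step g x u eta : 0 < eta -> l2norm u <= rho ->
  dot g (x - u) <= (l2norm (x - u) ^+ 2 - l2norm (proj (x - eta *: g) - u) ^+ 2) / (2 * eta) +
    eta / 2 * l2norm g ^+ 2.
Proof.
move=> eta0 ur; set w := x - eta *: g.
have := proj_pythagoras w ur; rewrite (l2norm_distC u) (l2norm_distC u w).
have -> : w - u = (x - u) - eta *: g by rewrite /w addrAC.
rewrite (sqr_l2normB (x - u)) dotZr l2normZ exprMn real_normK ?num_real// (dotC (x - u)).
have := sqr_ge0 (l2norm (proj w - w)); set a := l2norm _ ^+ 2; set b := l2norm _ ^+ 2.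
set c := l2norm _ ^+ 2; set e := l2norm _ ^+ 2 => h1 h2.
rewrite -(@ler_pM2l _ (2 * eta)) ?mulr_gt0// mulrDr mulrCA mulfV ?mulr1; last first.
  by rewrite gt_eqF// mulr_gt0.
have -> : 2 * eta * (eta / 2 * e) = eta ^+ 2 * e by field.
by lra.
Qed.

End Projection.

(** * Exponential weights *)

Section Hedge.
Context {R : realType}.

(** Write [expR x] as the inverse square of [expR (- (x / 2))], which is at least [1 - x / 2]. *)
Lemma expR_le_quadratic (x : R) : `|x| <= 1 -> expR x <= 1 + x + 2 * x ^+ 2.
Proof.
rewrite ler_norml => /andP[x1 x2].
have h1 : 1 - x / 2 <= expR (- (x / 2)) by exact: expR_ge1Dx.
have h0 : 0 < 1 - x / 2 by lra.
have e : expR x = (expR (- (x / 2)) ^+ 2)^-1.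
  by rewrite -expRM_natl -expRN; congr expR; rewrite mulrN opprK mulrCA divff ?mulr1.
apply: (@le_trans _ _ ((1 - x / 2) ^- 2)).
  rewrite e lef_pV2 ?posrE ?exprn_gt0 ?expR_gt0//.
  by rewrite ler_pXn2r ?nnegrE ?expR_ge0// ltW.
rewrite -div1r ler_pdivrMr ?exprn_gt0//.
have : 0 <= x ^+ 2 by exact: sqr_ge0.
have : 0 <= x ^+ 2 * (1 - x) by rewrite mulr_ge0 ?sqr_ge0//; lra.
have : 0 <= x ^+ 2 * x ^+ 2 by rewrite mulr_ge0 ?sqr_ge0.
nra.
Qed.

(** For [B <= 1] the quadratic bound applies and centering removes the linear term; for [B > 1] the
    trivial bound [expR B] is already below [expR (2 * B ^+ 2)]. Thus [gamma] times the gradient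
    norm may be large, which matters since gradients are controlled in mean square only. *)
Lemma hedge_normalizer N (w x : 'I_N -> R) (B : R) : (forall k, 0 <= w k) ->
  \sum_k w k = 1 -> \sum_k w k * x k = 0 -> (forall k, `|x k| <= B) ->
  \sum_k w k * expR (x k) <= expR (2 * B ^+ 2).
Proof.
move=> w0 w1 wx xB.
have avg (F : 'I_N -> R) c : (forall k, F k <= c) -> \sum_k w k * F k <= c.
  move=> Fc; rewrite -[leRHS]mul1r -w1 mulr_suml; apply: ler_sum => k _.
  exact: ler_wpM2l.
have [B1|B1] := leP B 1.
  apply: (@le_trans _ _ (1 + 2 * B ^+ 2)); last exact: expR_ge1Dx.
  apply: (@le_trans _ _ (\sum_k w k * (1 + x k + 2 * x k ^+ 2))).
    apply: ler_sum => k _; rewrite ler_wpM2l// expR_le_quadratic//.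
    exact: le_trans (xB k) B1.
  under eq_bigr do rewrite mulrDr mulrDr mulr1.
  rewrite !big_split /= w1 wx addr0 lerD2l.
  apply: avg => k; rewrite ler_pM2l// -[x k ^+ 2]real_normK ?num_real//.
  by rewrite ler_pXn2r ?nnegrE// (le_trans _ (xB k)).
apply: (@le_trans _ _ (expR B)).
  by apply: avg => k; rewrite ler_expR; exact: le_trans (ler_norm _) (xB k).
by rewrite ler_expR; nra.
Qed.

End Hedge.

Lemma sqr_dist_path {R : realType} (a b c : R) : 0 <= a -> 0 <= b -> 0 <= c ->
  a <= 2 -> b <= 2 -> a <= b + c -> a ^+ 2 - b ^+ 2 <= 4 * c.
Proof. nra. Qed.

Lemma path_potential_step {R : realType} (P a b c e : R) : a - b <= 4 * c ->
  4 + 4 * P - b + (a - e) <= 4 + 4 * (P + c) - e.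
Proof. lra. Qed.

Section DeterministicRegret.
Context {R : realType} {d : nat}.
Variables (rho mu gamma : R) (n : nat) (eta : nat -> R) (y1 : 'rV[R]_d).
Variables (f : nat -> 'rV[R]_d -> R) (s : nat -> 'rV[R]_d).
Hypotheses (rho0 : 0 < rho) (rho1 : rho <= 1) (gamma0 : 0 < gamma).
Hypotheses (eta0 : forall k, 0 < eta k) (y1r : l2norm y1 <= rho).
Notation N := n.+1.
Notation run := (pbmd_run half_sq (l2ball rho) mu gamma N eta y1 f s).
Notation y t := (pbmd_mean (run t)).
Notation g t := (pbmd_estimate mu (f t) (y t) (s t)).
Notation w t k := ((run t).1 k).
Notation z t k := ((run t).2 k).

Lemma init_weights_sum : \sum_(k < N) N.+1%:R / N%:R * (k.+1 * k.+2)%N%:R^-1 = 1 :> R.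
Proof.
rewrite -mulr_sumr.
have h m : \sum_(k < m) (k.+1 * k.+2)%N%:R^-1 = 1 - m.+1%:R^-1 :> R.
  elim: m => [|m IH]; first by rewrite big_ord0 invr1 subrr.
  rewrite big_ord_recr /= IH natrM; field.
  by rewrite !gt_eqF ?ltr_wpDr.
rewrite h; field.
by rewrite !gt_eqF ?ltr_wpDr.
Qed.

Let normalizer t := \sum_(j < N) w t j * expR (- gamma * dot (g t) (z t j - y t)).

Let wS t k : w t.+1 k = w t k * expR (- gamma * dot (g t) (z t k - y t)) / normalizer t.
Proof. by []. Qed.

Lemma run_weights_gt0 t k : 0 < w t k.
Proof.
elim: t k => [|t IH] k.
  by rewrite /= mulr_gt0// ?divr_gt0// invr_gt0 ltr0n muln_gt0.
rewrite wS divr_gt0//; first by rewrite mulr_gt0 ?expR_gt0.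
rewrite /normalizer (bigD1 ord0)//= ltr_pwDl ?mulr_gt0 ?expR_gt0//.
by apply: sumr_ge0 => j _; rewrite mulr_ge0 ?expR_ge0 ?(ltW (IH _)).
Qed.

Let normalizer_gt0 t : 0 < normalizer t.
Proof.
rewrite /normalizer (bigD1 ord0)//= ltr_pwDl ?mulr_gt0 ?expR_gt0 ?run_weights_gt0//.
by apply: sumr_ge0 => j _; rewrite mulr_ge0 ?expR_ge0 ?(ltW (run_weights_gt0 _ _)).
Qed.

Lemma run_weights_sum t : \sum_k w t k = 1.
Proof.
case: t => [|t]; first exact: init_weights_sum.
under eq_bigr do rewrite wS.
by rewrite -mulr_suml -/(normalizer t) divff ?gt_eqF ?normalizer_gt0.
Qed.

Lemma run_experts_step t k : z t.+1 k = proj rho (z t k - eta k *: g t).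
Proof. exact: argmin_mirror. Qed.

Lemma run_experts_le t k : l2norm (z t k) <= rho.
Proof. by case: t => [//|t]; rewrite run_experts_step; exact: proj_le. Qed.

Lemma run_mean_le t : l2norm (y t) <= rho.
Proof.
have main m (a : 'I_m -> R) (v : 'I_m -> 'rV[R]_d) : (forall k, 0 <= a k) ->
    (forall k, l2norm (v k) <= rho) -> l2norm (\sum_k a k *: v k) <= (\sum_k a k) * rho.
  elim: m a v => [|m IH] a v a0 vr; first by rewrite !big_ord0 l2norm0 mul0r.
  rewrite !big_ord_recr /= mulrDl; apply: (le_trans (l2normD _ _)); rewrite lerD ?IH//.
  by rewrite l2normZ ger0_norm// ler_wpM2l.
rewrite -[leRHS]mul1r -(run_weights_sum t); apply: main => k.
  exact: ltW (run_weights_gt0 t k).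
exact: run_experts_le.
Qed.

(** By induction, the weight of expert [k] is at least its initial weight times the exponential of
    [gamma] times its regret minus the variance cost; weights sum to 1, so it is at most 1. All
    points lie in the unit ball, so [B = 2 gamma |g|] in [hedge_normalizer], and
    [2 B^2 = 8 gamma^2 |g|^2]. *)
Lemma hedge_regret T k : \sum_(t < T) dot (g t) (y t - z t k) <=
  ln (k.+1 * k.+2)%N%:R / gamma + 8 * gamma * \sum_(t < T) l2norm (g t) ^+ 2.
Proof.
set c := ln _.
have main : w 0%N k * expR (gamma * \sum_(t < T) dot (g t) (y t - z t k) -
    8 * gamma ^+ 2 * \sum_(t < T) l2norm (g t) ^+ 2) <= w T k.
  elim: T => [|T IH]; first by rewrite !big_ord0 !mulr0 subr0 expR0 mulr1.
  move: IH; set w00 := w 0%N k => IH; rewrite wS !big_ord_recr /=.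
  set a := \sum_(t < T) _ in IH *; set b := \sum_(t < T) _ in IH *.
  set D := dot _ _.
  rewrite (_ : gamma * (a + D) - 8 * gamma ^+ 2 * (b + l2norm (g T) ^+ 2) =
    (gamma * a - 8 * gamma ^+ 2 * b) + (gamma * D + - (8 * gamma ^+ 2 * l2norm (g T) ^+ 2)));
    last by ring.
  rewrite expRD mulrA.
  rewrite -[leRHS]mulrA; apply: ler_pM _ _ IH _.
  - by rewrite mulr_ge0 ?expR_ge0 ?(ltW (run_weights_gt0 0 k)).
  - exact: expR_ge0.
  rewrite expRD (_ : gamma * D = - gamma * dot (g T) (z T k - y T)); last first.
    by rewrite /D -opprB dotNr; ring.
  rewrite ler_wpM2l ?expR_ge0// expRN lef_pV2 ?posrE ?expR_gt0//.
  rewrite (_ : 8 * gamma ^+ 2 * l2norm (g T) ^+ 2 = 2 * (2 * gamma * l2norm (g T)) ^+ 2); last by ring.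
  apply: hedge_normalizer.
  - by move=> j; exact: ltW (run_weights_gt0 T j).
  - exact: run_weights_sum.
  - rewrite (eq_bigr (fun j => - gamma * (dot (g T) (w T j *: z T j) - w T j * dot (g T) (y T)))).
      rewrite -mulr_sumr sumrB -mulr_suml run_weights_sum mul1r.
      have -> : \sum_j dot (g T) (w T j *: z T j) = dot (g T) (y T).
        rewrite dotC dot_suml; apply: eq_bigr => j _; exact: dotC.
      by rewrite subrr mulr0.
    by move=> j _; rewrite dotBr dotZr; ring.
  move=> j; rewrite mulNr normrN normrM gtr0_norm//.
  rewrite (_ : 2 * gamma * _ = gamma * (l2norm (g T) * 2)) ?ler_pM2l//; last by ring.
  apply: (le_trans (cauchy_schwarz_norm _ _)); rewrite ler_wpM2l ?l2norm_ge0//.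
  apply: (le_trans (l2normB _ _)).
  by have := rho1; have := run_experts_le T j; have := run_mean_le T; lra.
have wT1 : w T k <= 1.
  rewrite -(run_weights_sum T) (bigD1 k)//= lerDl; apply: sumr_ge0 => j _.
  exact: ltW (run_weights_gt0 T j).
(* The prefactor [(N + 1) / N] of the initial weights is at least 1. *)
have w0c : expR (- c) <= w 0%N k.
  rewrite expRN /c lnK ?posrE ?ltr0n ?muln_gt0//= ler_peMl ?invr_ge0//.
  by rewrite ler_pdivlMr// mul1r ler_nat.
set a := \sum_(t < T) _ in main *; set b := \sum_(t < T) _ in main *.
have : expR (- c + (gamma * a - 8 * gamma ^+ 2 * b)) <= expR 0.
  rewrite expRD expR0; apply: le_trans wT1; apply: le_trans main.
  by rewrite ler_wpM2r ?expR_ge0.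
rewrite ler_expR => h.
rewrite -(ler_pM2l gamma0) mulrDr mulrCA divff ?gt_eqF// mulr1.
have -> : gamma * (8 * gamma * b) = 8 * gamma ^+ 2 * b by ring.
by lra.
Qed.

Variable u : nat -> 'rV[R]_d.
Hypothesis u_rho : forall t, l2norm (u t) <= rho.

(** The potential [|z_t - u_t|^2] telescopes. Distances are at most 2, so it starts below 4, and
    moving the comparator changes it by at most 4 times the displacement. The induction keeps the
    final potential as a negative term, as the next step uses it. *)
Lemma expert_regret T k : \sum_(t < T) dot (g t) (z t k - u t) <=
  2 * (1 + path_length T u) / eta k + eta k / 2 * \sum_(t < T) l2norm (g t) ^+ 2.
Proof.
have e0 := eta0 k.
have main m : \sum_(t < m.+1) dot (g t) (z t k - u t) <=
    (4 + 4 * path_length m.+1 u - l2norm (z m.+1 k - u m) ^+ 2) / (2 * eta k) +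
    eta k / 2 * \sum_(t < m.+1) l2norm (g t) ^+ 2.
  elim: m => [|m IH].
    rewrite !big_ord1 /path_length big_ord0 mulr0 addr0.
    apply: (le_trans (mirror_step rho0 (g 0%N) (z 0%N k) e0 (u_rho 0%N))).
    rewrite -run_experts_step lerD2r ler_pM2r ?invr_gt0 ?mulr_gt0// lerD2r.
    have := l2normB (z 0%N k) (u 0%N); have := run_experts_le 0 k; have := u_rho 0%N.
    by have := l2norm_ge0 (z 0%N k - u 0%N); move: rho1; nra.
  rewrite big_ord_recr [X in _ <= _ + _ * X]big_ord_recr /=.
  have step := mirror_step rho0 (g m.+1) (z m.+1 k) e0 (u_rho m.+1).
  rewrite -run_experts_step in step.
  apply: (le_trans (lerD IH step)); rewrite mulrDr addrACA lerD2r -mulrDl.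
  rewrite ler_pM2r ?invr_gt0 ?mulr_gt0//.
  have -> : path_length m.+2 u = path_length m.+1 u + l2norm (u m.+1 - u m).
    by rewrite /path_length /= big_ord_recr.
  set q := z m.+1 k.
  apply: path_potential_step.
  have h1 : l2norm (q - u m.+1) <= l2norm (q - u m) + l2norm (u m.+1 - u m).
    have -> : q - u m.+1 = (q - u m) - (u m.+1 - u m) by rewrite opprB addrA subrK.
    exact: l2normB.
  have := l2normB q (u m); have := l2normB q (u m.+1); have := u_rho m; have := u_rho m.+1.
  have : l2norm q <= rho by exact: run_experts_le.
  have := l2norm_ge0 (q - u m.+1); have := l2norm_ge0 (q - u m).
  have := l2norm_ge0 (u m.+1 - u m).
  move=> c0 b0 a0 er e2r e1r ha hb; apply: sqr_dist_path a0 b0 c0 _ _ h1.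
    by apply: (le_trans ha); rewrite -[2]/(1 + 1) lerD// (le_trans _ rho1).
  by apply: (le_trans hb); rewrite -[2]/(1 + 1) lerD// (le_trans _ rho1).
have P0 : 0 <= path_length T u by apply: sumr_ge0 => t _; exact: l2norm_ge0.
case: T P0 main => [|m] P0 main.
  by rewrite !big_ord0 mulr0 addr0 divr_ge0 ?(ltW e0)// mulr_ge0// addr_ge0.
apply: (le_trans (main m)); rewrite lerD2r.
have -> : 2 * (1 + path_length m.+1 u) / eta k = (4 + 4 * path_length m.+1 u) / (2 * eta k).
  by field; rewrite gt_eqF.
by rewrite ler_pM2r ?invr_gt0 ?mulr_gt0// lerBlDr lerDl sqr_ge0.
Qed.

End DeterministicRegret.

(** * The law of an independent sequence *)

Section IidLaw.
Context {R : realType} {dV : measure_display} {V : measurableType dV}.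
Local Open Scope ereal_scope.

Definition rectangle n (A : 'I_n -> set V) : set (n.-tuple V) :=
  [set v | forall i, A i (tnth v i)].

Lemma measurable_rectangle n (A : 'I_n -> set V) : (forall i, measurable (A i)) ->
  measurable (rectangle A).
Proof.
move=> mA; rewrite (_ : rectangle A =
    \bigcap_(i in setT) ((fun v : n.-tuple V => tnth v i) @^-1` A i)).
  apply: fin_bigcap_measurable => [|i _]; first exact: finite_finset.
  by rewrite -[X in measurable X]setTI; exact: measurable_tnth.
by apply/seteqP; split=> v /= h i; [move=> _; exact: h|exact: h].
Qed.

Lemma iid_rectangle (Q : probability V R) n (A : 'I_n -> set V) :
  (forall i, measurable (A i)) -> iid Q n (rectangle A) = \prod_(i < n) Q (A i).
Proof.
elim: n A => [|n IH] A mA.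
  rewrite big_ord0 /= diracE mem_set//; by case.
rewrite big_ord_recl /= /pushforward /= -(IH (fun i => A (lift ord0 i)))//.
rewrite (_ : _ @^-1` _ = A ord0 `*` rectangle (fun i => A (lift ord0 i))).
  by rewrite -[LHS]/((Q \x iid Q n) _) product_measure1E//; exact: measurable_rectangle.
apply/seteqP; split=> -[x v] /=.
  move=> h; split=> [|i]; first by have := h ord0; rewrite tnth0.
  by have := h (lift ord0 i); rewrite tnthS.
move=> [h0 h] i; case: (unliftP ord0 i) => [j|] ->; last by rewrite tnth0.
by rewrite tnthS; exact: h.
Qed.

(** Rectangles are stable under intersection, and they generate the sigma-algebra of tuples, since
    the preimage of a set by one coordinate is a rectangle. *)
Lemma probability_tuple_unique n (m1 m2 : probability (n.-tuple V) R) :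
  (forall A : 'I_n -> set V, (forall i, measurable (A i)) ->
    m1 (rectangle A) = m2 (rectangle A)) ->
  forall B, measurable B -> m1 B = m2 B.
Proof.
move=> m12 B mB.
pose G := [set C : set (n.-tuple V) | exists2 A, (forall i, measurable (A i)) & C = rectangle A].
apply: (@g_sigma_algebra_measure_unique _ _ _ G _ (fun=> setT)) => //.
- by move=> _ [A mA ->]; exact: measurable_rectangle.
- by move=> _; exists (fun=> setT) => //; apply/seteqP; split.
- by rewrite bigcup_const.
- move=> _ _ [A1 mA1 ->] [A2 mA2 ->]; exists (fun i => A1 i `&` A2 i).
    by move=> i; exact: measurableI.
  apply/seteqP; split=> v /=; first by move=> [h1 h2] i; split; [exact: h1|exact: h2].
  by move=> h; split=> i; have [] := h i.
- by move=> _ [A mA ->]; exact: m12.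
- by move=> _; rewrite [X in (X < _)%E](probability_setT m1) ltry.
move: B mB; apply: smallest_sub; first exact: smallest_sigma_algebra.
move=> B; rewrite -(bigcup_seq (index_enum 'I_n)) => -[i _ [C mC <-]].
apply: sub_sigma_algebra; exists (fun j => if j == i then C else setT).
  by move=> j; case: ifP.
apply/seteqP; split=> v /=; first by move=> [_ Cv] j; case: eqP => [->|].
by move=> h; split=> //; have := h i; rewrite eqxx.
Qed.

End IidLaw.

(** * Comparison of integrals off a null set *)

Section AlmostSureDomination.
Context {R : realType} {d : measure_display} {T : measurableType d}.
Local Open Scope ereal_scope.

(** Integrals of nonnegative functions are suprema over simple functions below them, so this covers
    functions that are not known to be measurable, such as the regret of the original losses. *)
Lemma ge0_integral_mono (mu : {measure set T -> \bar R}) (f g : T -> \bar R) :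
  (forall x, 0 <= f x) -> (forall x, f x <= g x) -> \int[mu]_x f x <= \int[mu]_x g x.
Proof.
move=> f0 fg; have g0 x : 0 <= g x by exact: le_trans (f0 x) (fg x).
rewrite !ge0_integralTE//; apply: le_ereal_sup => _ /= [h hf <-]; exists h => //= x.
exact: le_trans (hf x) (fg x).
Qed.

Variables (P : probability T R) (N : set T).
Hypotheses (mN : measurable N) (PN : P N = 0).

Let mN1 : measurable_fun [set: T] (fun x => (\1_N x)%:E : \bar R).
Proof. by apply/measurable_EFinP; exact: measurable_indic. Qed.

(** Raising [g] to infinity on [N] does not change its integral and makes the inequality hold
    everywhere. *)
Lemma ge0_integral_le_ae (f g : T -> \bar R) : (forall x, 0 <= f x) -> (forall x, 0 <= g x) ->
  measurable_fun [set: T] g -> (forall x, ~ N x -> f x <= g x) ->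
  \int[P]_x f x <= \int[P]_x g x.
Proof.
move=> f0 g0 mg fg.
have -> : \int[P]_x g x = \int[P]_x (g x + +oo * (\1_N x)%:E).
  apply: ge0_ae_eq_integral => //.
  - by apply: emeasurable_funD => //; exact: measurable_funeM.
  - by move=> x _; rewrite adde_ge0// mule_ge0// lee_fin.
  exists N; split=> // x /= h; apply: contrapT => Nx; apply: h => _.
  by rewrite indicE memNset// mule0 adde0.
apply: ge0_integral_mono => // x; have [Nx|Nx] := pselect (N x).
  by rewrite indicE mem_set// mule1 addey ?leey// gt_eqF// (lt_le_trans _ (g0 x)) ?ltNy0.
by rewrite indicE memNset// mule0 adde0; exact: fg.
Qed.

Lemma ge0_integral_ge_ae (f g : T -> \bar R) : (forall x, 0 <= f x) -> (forall x, 0 <= g x) ->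
  measurable_fun [set: T] f -> (forall x, ~ N x -> f x <= g x) ->
  \int[P]_x f x <= \int[P]_x g x.
Proof.
move=> f0 g0 mf fg.
have mNc : measurable_fun [set: T] (fun x => (\1_(~` N) x)%:E : \bar R).
  by apply/measurable_EFinP; apply: measurable_indic; exact: measurableC.
have -> : \int[P]_x f x = \int[P]_x (f x * (\1_(~` N) x)%:E).
  apply: ge0_ae_eq_integral => //.
  - exact: emeasurable_funM.
  - by move=> x _; rewrite mule_ge0// lee_fin.
  exists N; split=> // x /= h; apply: contrapT => Nx; apply: h => _.
  by rewrite indicE mem_set// mule1.
apply: ge0_integral_mono => x; first by rewrite mule_ge0// lee_fin.
have [Nx|Nx] := pselect (N x); first by rewrite indicE memNset ?mule0//; apply.
by rewrite indicE mem_set// mule1; exact: fg.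
Qed.

(** Positive and negative parts are compared separately, each time with the measurable function [g]
    as the one modified on [N]. *)
Lemma integral_le_mean_ae (f g : T -> R) : bmeas g -> (forall x, ~ N x -> (f x <= g x)%R) ->
  \int[P]_x (f x)%:E <= (mean P g)%:E.
Proof.
move=> bg fg; rewrite -meanE// integralE [leRHS]integralE.
have mg : measurable_fun [set: T] (fun x => (g x)%:E : \bar R).
  by apply/measurable_EFinP; exact: bmeasW.
apply: leeB.
  apply: ge0_integral_le_ae => //; first exact: measurable_funepos.
  by move=> x Nx; rewrite !funeposE; apply: le_max2; rewrite // lee_fin fg.
apply: ge0_integral_ge_ae => //; first exact: measurable_funeneg.
by move=> x Nx; rewrite !funenegE; apply: le_max2; rewrite // lee_fin lerN2 fg.
Qed.

End AlmostSureDomination.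

Section IndependentSamples.
Context {R : realType} {dO dV : measure_display} {Omega : measurableType dO}.
Context {V : measurableType dV}.
Variables (P : probability Omega R) (Q : probability V R) (n : nat).
Variable X : nat -> Omega -> V.
Hypothesis mX : forall t, measurable_fun [set: Omega] (X t).
Hypothesis indX : mutually_independent P n X.
Hypothesis lawX : forall t, (t < n)%N -> forall B, measurable B -> P (X t @^-1` B) = Q B.

Definition samples (w : Omega) : n.-tuple V := [tuple X i w | i < n].

Lemma measurable_samples : measurable_fun [set: Omega] samples.
Proof. by apply: measurable_fun_tuple => i; under eq_fun do rewrite tnth_mktuple; exact: mX. Qed.

HB.instance Definition _ :=
  isMeasurableFun.Build _ _ _ _ samples measurable_samples.

Lemma samples_law B : measurable B -> distribution P samples B = iid Q n B.
Proof.
apply: probability_tuple_unique => A mA; rewrite iid_rectangle//.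
rewrite -[LHS]/(P (samples @^-1` rectangle A)).
have -> : samples @^-1` rectangle A =
    \bigcap_(t in [set` [set: 'I_n]%SET]) ((fun t : 'I_n => X t @^-1` A t) t).
  apply/seteqP; split=> w /=.
    by move=> h t _ /=; have := h t; rewrite tnth_mktuple.
  by move=> h t /=; rewrite tnth_mktuple; apply: h; rewrite /= inE.
rewrite indX//; under eq_bigl do rewrite inE.
by apply: eq_bigr => t _; rewrite lawX.
Qed.

Lemma mean_samples (F : n.-tuple V -> R) : bmeas F ->
  mean P (fun w => F (samples w)) = mean (iid Q n) F.
Proof.
move=> bF; have [mF [M FM]] := bF.
have bFX : bmeas (fun w => F (samples w)) by apply: bmeas_comp bF _; exact: measurable_samples.
apply: (@addIr _ M); rewrite -!mean_shift// /mean /Rintegral; congr fine.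
have mFM : measurable_fun [set: n.-tuple V] (fun v => (F v + M)%:E).
  by apply/measurable_EFinP; exact: measurable_funD.
have FM0 (v : n.-tuple V) : (0 <= (F v + M)%:E)%E.
  by rewrite lee_fin; have := FM v; rewrite ler_norml => /andP[]; lra.
transitivity (\int[distribution P samples]_v (F v + M)%:E)%E.
  by rewrite ge0_integral_pushforward.
by apply: eq_measure_integral => A mA _; exact: samples_law.
Qed.

End IndependentSamples.

(** It plays the role of conditional expectation: draw [i] is integrated first, all the other draws,
    later ones included, being frozen in [v]. *)
Lemma mean_samples_le {R : realType} {dO dV : measure_display} {Omega : measurableType dO}
    {V : measurableType dV} (P : probability Omega R) (Q : probability V R) (n : nat)
    (X : nat -> Omega -> V) (i : 'I_n) (F : n.-tuple V -> R) (c : R) :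
  (forall t, measurable_fun [set: Omega] (X t)) -> mutually_independent P n X ->
  (forall t, (t < n)%N -> forall B, measurable B -> P (X t @^-1` B) = Q B) ->
  bmeas F -> (forall v, mean Q (fun x => F (upd v i x)) <= c) ->
  mean P (fun w => F (samples n X w)) <= c.
Proof.
move=> mX indX lawX bF Fc; rewrite (mean_samples mX indX lawX bF).
case: n i F indX lawX bF Fc => [[]//|n] i F indX lawX bF Fc.
rewrite (mean_iid_ins Q i bF) -[leRHS](mean_cst (iid Q n)).
have mins : measurable_fun [set: n.-tuple V * V] (fun zx => ins i zx.1 zx.2).
  exact: measurable_ins.
apply: le_mean => [| |z].
- exact: (bmeas_mean2 Q (bmeas_comp bF mins)).
- exact: bmeas_cst.
have := Fc (ins i z point); congr (_ <= _); apply: eq_mean => x.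
by rewrite upd_ins.
Qed.

(** * Expected regret for arbitrary parameters *)

Section MeasurableVectors.
Context {R : realType} {d : nat} {dT : measure_display} {Theta : measurableType dT}.

Definition mvec (v : Theta -> 'rV[R]_d) :=
  forall i, measurable_fun [set: Theta] (fun t => v t 0 i).

Lemma mvecD (u v : Theta -> 'rV[R]_d) : mvec u -> mvec v -> mvec (fun t => u t + v t).
Proof. by move=> mu mv i; under eq_fun do rewrite mxE; exact: measurable_funD. Qed.

Lemma mvecZ (c : Theta -> R) (v : Theta -> 'rV[R]_d) :
  measurable_fun [set: Theta] c -> mvec v -> mvec (fun t => c t *: v t).
Proof. by move=> mc mv i; under eq_fun do rewrite mxE; exact: measurable_funM. Qed.

Lemma mvecN (v : Theta -> 'rV[R]_d) : mvec v -> mvec (fun t => - v t).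
Proof.
move=> mv; under eq_fun do rewrite -scaleN1r; apply: mvecZ mv.
exact: measurable_cst.
Qed.

Lemma mvecB (u v : Theta -> 'rV[R]_d) : mvec u -> mvec v -> mvec (fun t => u t - v t).
Proof. by move=> mu mv; apply: mvecD => //; exact: mvecN. Qed.

Lemma mvec_cst (x : 'rV[R]_d) : mvec (fun=> x).
Proof. by move=> i; exact: measurable_cst. Qed.

Lemma mvec_sum (I : Type) (s : seq I) (v : I -> Theta -> 'rV[R]_d) :
  (forall j, mvec (v j)) -> mvec (fun t => \sum_(j <- s) v j t).
Proof.
move=> mv; elim: s => [|j s IH].
  by under eq_fun do rewrite big_nil; exact: mvec_cst.
by under eq_fun do rewrite big_cons; exact: mvecD.
Qed.

Lemma measurable_dot (u v : Theta -> 'rV[R]_d) : mvec u -> mvec v ->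
  measurable_fun [set: Theta] (fun t => dot (u t) (v t)).
Proof. by move=> mu mv; apply: measurable_sum => i; exact: measurable_funM. Qed.

Lemma mvec_signv (v : Theta -> 'rV[R]_d) : mvec v -> mvec (fun t => signv (v t)).
Proof.
move=> mv i; rewrite (_ : (fun _ => _) = (fun t => 2 * (0 <= v t 0 i)%R%:R - 1)).
  apply: measurable_funB => //; apply: measurable_funM => //.
  by apply: measurable_nat_of_bool; exact: measurable_fun_ler.
by apply/funext => t; rewrite mxE; case: ifP => _; rewrite ?mulr1 ?mulr0; ring.
Qed.

Lemma mvec_proj (rho : R) (v : Theta -> 'rV[R]_d) : 0 < rho -> mvec v ->
  mvec (fun t => proj rho (v t)).
Proof.
move=> rho0 mv; apply: mvecZ => //; apply: measurable_funM => //.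
apply: measurable_fun_invr_ge0; last by move=> t; rewrite le_max (ltW rho0).
by apply: measurable_maxr => //; exact: measurable_l2norm.
Qed.

Lemma mvec_estimate (mu G : R) (h : 'rV[R]_d -> R) (y s : Theta -> 'rV[R]_d) :
  (forall x z, `|h x - h z| <= G * l2norm (x - z)) -> mvec y -> mvec s ->
  mvec (fun t => pbmd_estimate mu h (y t) (s t)).
Proof.
move=> lh my ms; have mmu : mvec (fun t => mu *: s t) by apply: mvecZ.
apply: mvecZ; last exact: mvec_signv.
apply: measurable_funM => //; apply: measurable_funB.
  exact: (lipschitz_measurable lh (mvecD my mmu)).
exact: (lipschitz_measurable lh (mvecB my mmu)).
Qed.

End MeasurableVectors.

Section MeasurableRun.
Context {R : realType} {d : nat} {dT : measure_display} {Theta : measurableType dT}.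
Variables (rho mu gamma G : R) (n : nat) (eta : nat -> R) (y1 : 'rV[R]_d).
Variables (h : nat -> 'rV[R]_d -> R) (S : Theta -> nat -> 'rV[R]_d).
Hypotheses (rho0 : 0 < rho) (gamma0 : 0 < gamma) (eta0 : forall k, 0 < eta k).
Hypothesis lh : forall t x z, `|h t x - h t z| <= G * l2norm (x - z).
Hypothesis mS : forall t, mvec (S ^~ t).
Notation N := n.+1.
Notation run w := (pbmd_run half_sq (l2ball rho) mu gamma N eta y1 h (S w)).

Lemma measurable_run t : (forall k, measurable_fun [set: Theta] (fun w => (run w t).1 k)) /\
  (forall k, mvec (fun w => (run w t).2 k)).
Proof.
elim: t => [|t [IHw IHz]]; first by split=> k; [exact: measurable_cst|exact: mvec_cst].
have my : mvec (fun w => pbmd_mean (run w t)).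
  by apply: mvec_sum => k; exact: mvecZ.
have mg := mvec_estimate mu (lh t) my (mS t).
have mx k : measurable_fun [set: Theta] (fun w => (run w t).1 k *
    expR (- gamma * dot (pbmd_estimate mu (h t) (pbmd_mean (run w t)) (S w t))
      ((run w t).2 k - pbmd_mean (run w t)))).
  apply: measurable_funM => //; apply: (@measurableT_comp _ _ _ _ _ _ (@expR R)).
    exact: measurable_expR.
  by apply: measurable_funM => //; apply: measurable_dot => //; exact: mvecB.
split=> k.
  apply: measurable_funM => //; apply: measurable_fun_invr_ge0.
    by apply: measurable_sum => j; exact: mx.
  move=> w; apply: sumr_ge0 => j _; rewrite mulr_ge0 ?expR_ge0//.
  by apply: ltW; exact: run_weights_gt0.
under eq_fun do rewrite (run_experts_step _ _ _ _ _ rho0 eta0).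
by apply: mvec_proj => //; apply: mvecB => //; apply: mvecZ.
Qed.

Lemma measurable_run_mean t : mvec (fun w => pbmd_mean (run w t)).
Proof.
have [mw mz] := measurable_run t; apply: mvec_sum => k; exact: mvecZ.
Qed.

End MeasurableRun.

Section RunExtensionality.
Context {R : realType} {d : nat}.
Variables (rho mu gamma : R) (n : nat) (eta : nat -> R) (y1 : 'rV[R]_d).
Notation run := (pbmd_run half_sq (l2ball rho) mu gamma n.+1 eta y1).

Let runS f s t : run f s t.+1 =
  pbmd_step half_sq (l2ball rho) mu gamma eta (f t) (s t) (run f s t).
Proof. by []. Qed.

Lemma eq_pbmd_run (f : nat -> 'rV[R]_d -> R) (s s' : nat -> 'rV[R]_d) t :
  (forall i, (i < t)%N -> s i = s' i) -> run f s t = run f s' t.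
Proof.
elim: t => [|t IH] ss; first by [].
have e : run f s t = run f s' t by apply: IH => i it; apply: ss; exact: ltnW.
by rewrite !runS e (ss t (ltnSn t)).
Qed.

(** A run sees its losses only through the estimates at the points it visits, so losses that give
    the same estimates there give the same run. *)
Lemma eq_pbmd_run_losses (f h : nat -> 'rV[R]_d -> R) (s : nat -> 'rV[R]_d) t :
  (forall i, (i < t)%N ->
    pbmd_estimate mu (f i) (pbmd_mean (run h s i)) (s i) =
    pbmd_estimate mu (h i) (pbmd_mean (run h s i)) (s i)) ->
  run f s t = run h s t.
Proof.
elim: t => [|t IH] fh; first by [].
have e : run f s t = run h s t by apply: IH => i it; apply: fh; exact: ltnW.
by rewrite !runS e /pbmd_step (fh t (ltnSn t)).
Qed.

End RunExtensionality.

Section ExpectedRegret.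
Context {R : realType} {m : nat}.
Notation d := m.+1.
Notation X := (l2ball 1 : set 'rV[R]_d).
Variables (rho mu gamma G : R) (n : nat) (eta : nat -> R) (y1 : 'rV[R]_d).
Variables (f : nat -> 'rV[R]_d -> R) (u : nat -> 'rV[R]_d) (T : nat).
Hypotheses (rho0 : 0 < rho) (mu0 : 0 < mu) (rho_mu : rho + mu <= 1) (gamma0 : 0 < gamma).
Hypotheses (eta0 : forall k, 0 < eta k) (y1r : l2norm y1 <= rho) (G0 : 0 < G).
Hypothesis cf : forall t, (t < T)%N -> convexf (f t).
Hypothesis lf : forall t, (t < T)%N -> lipschitz_on X G (f t).
Hypothesis Xu : forall t, (t < T)%N -> X (u t).
Notation N := n.+1.
Notation V := (d.-tuple R).
Notation law := (@sphere_law R d).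

(* Outside the unit ball, and after the last round, the losses are replaced by
   Lipschitz ones: almost surely, these values are never queried. *)
Let h t (x : 'rV[R]_d) := if (t < T)%N then f t (proj 1 x) else 0.

(** The experts live in the ball of radius [rho], so they compete with the comparators scaled into
    it; this costs [G * (1 - rho)] per round. *)
Let u' t := if (t < T)%N then rho *: u t else 0.

Let lh t x z : `|h t x - h t z| <= G * l2norm (x - z).
Proof.
rewrite /h; case: ifP => tT; last by rewrite subrr normr0 mulr_ge0 ?l2norm_ge0 ?(ltW G0).
apply: (le_trans (lf tT (proj_le _ _) (proj_le _ _))) => //.
by rewrite ler_pM2l// proj_nonexpansive.
Qed.

Let hf t x : (t < T)%N -> X x -> h t x = f t x.
Proof. by move=> tT Xx; rewrite /h tT proj_id. Qed.

Let hB t x : `|h t x| <= `|f t 0| + G.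
Proof.
rewrite /h; case: ifP => tT; last by rewrite normr0 addr_ge0 ?(ltW G0).
have X0 : X 0 by rewrite /l2ball /= l2norm0.
have := lf tT (proj_le ltr01 x) X0; rewrite subr0 => h1.
rewrite -[f t (proj 1 x)](subrK (f t 0)) addrC; apply: (le_trans (ler_normD _ _)).
rewrite lerD2l; apply: (le_trans h1); rewrite -[leRHS]mulr1 ler_pM2l//.
exact: proj_le.
Qed.

Let u'_rho t : l2norm (u' t) <= rho.
Proof.
rewrite /u'; case: ifP => tT; last by rewrite l2norm0 ltW.
rewrite l2normZ gtr0_norm// -[leRHS]mulr1 ler_pM2l//; exact: Xu tT.
Qed.

Let rho1 : rho <= 1.
Proof. by apply: le_trans rho_mu; rewrite lerDl ltW. Qed.

Lemma path_length_shrink : path_length T u' <= path_length T u.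
Proof.
rewrite /path_length; apply: ler_sum => t _.
have t1T : (t.+1 < T)%N by rewrite -ltn_predRL.
rewrite /u' t1T (ltnW t1T) -scalerBr l2normZ gtr0_norm// -[leRHS]mul1r.
by rewrite ler_wpM2r ?l2norm_ge0.
Qed.

Let S (v : T.-tuple V) t : 'rV[R]_d := if insub t is Some i then rowv (tnth v i) else 0.

Let run (v : T.-tuple V) := pbmd_run half_sq (l2ball rho) mu gamma N eta y1 h (S v).

Let y (v : T.-tuple V) t := pbmd_mean (run v t).

Let g (v : T.-tuple V) t := pbmd_estimate mu (h t) (y v t) (S v t).

Let mS t : mvec (fun v => S v t).
Proof.
move=> i; rewrite /S; case: insubP => [j _ _|_]; last exact: measurable_cst.
under eq_fun do rewrite mxE.
apply: (@measurableT_comp _ _ _ _ _ _ (fun x : V => tnth x i)); exact: measurable_tnth.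
Qed.

Let my t : mvec (fun v => y v t).
Proof. exact: (measurable_run_mean mu gamma n y1 rho0 eta0 lh mS t). Qed.

Let mg t : mvec (fun v => g v t).
Proof. exact: mvec_estimate (lh t) (my t) (mS t). Qed.

Let y_rho v t : l2norm (y v t) <= rho.
Proof. exact: run_mean_le. Qed.

Let estimate_le t z (s : 'rV[R]_d) :
  l2norm (pbmd_estimate mu (h t) z s) <= d%:R / (2 * mu) * (2 * (`|f t 0| + G)) * d%:R.
Proof.
rewrite /pbmd_estimate l2normZ.
have c0 : 0 <= d%:R / (2 * mu) by rewrite divr_ge0// mulr_ge0// ltW.
rewrite normrM (ger0_norm c0) -[leLHS]mulrA -[leRHS]mulrA ler_wpM2l// ler_pM ?l2norm_ge0//.
  apply: (le_trans (ler_normB _ _)); rewrite mulr2n mulrDl mul1r; exact: lerD.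
apply: (le_trans (l2norm_le_sum _)).
rewrite (eq_bigr (fun=> 1)) => [|i _]; last first.
  by rewrite mxE; case: ifP; rewrite ?normrN normr1.
by rewrite sumr_const card_ord.
Qed.

Variable kappa : R.
Hypothesis kappa0 : 0 <= kappa.

(** What the pathwise bound leaves to the expectation in round [t]: the variance cost and the gap
    between the loss difference and its linear estimate. For a point [z] that is independent of the
    draw, both estimator bounds apply to it. *)
Definition round_excess t (z s : 'rV[R]_d) : R :=
  kappa * l2norm (pbmd_estimate mu (h t) z s) ^+ 2 + (h t z - h t (u' t)) -
  dot (pbmd_estimate mu (h t) z s) (z - u' t).

Let bmeas_parts (dT : measure_display) (Theta : measurableType dT) (z s : Theta -> 'rV[R]_d) t :
  mvec z -> mvec s -> (forall a, l2norm (z a) <= rho) ->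
  bmeas (fun a => l2norm (pbmd_estimate mu (h t) (z a) (s a)) ^+ 2) /\
  bmeas (fun a => dot (pbmd_estimate mu (h t) (z a) (s a)) (z a - u' t)) /\
  bmeas (fun a => h t (z a) - h t (u' t)).
Proof.
move=> mz ms zr; have me := mvec_estimate mu (lh t) mz ms.
split; [|split].
- apply: bmeasX; apply: bmeas_bounded => [|a]; first exact: measurable_l2norm.
  by rewrite ger0_norm ?l2norm_ge0//; exact: estimate_le.
- split.
    by apply: measurable_dot => //; apply: mvecB => //; exact: mvec_cst.
  exists (d%:R / (2 * mu) * (2 * (`|f t 0| + G)) * d%:R * (rho + rho)) => a.
  apply: (le_trans (cauchy_schwarz_norm _ _)).
  apply: ler_pM (l2norm_ge0 _) (l2norm_ge0 _) (estimate_le _ _ _) _.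
  by apply: (le_trans (l2normB _ _)); apply: lerD; [exact: zr|exact: u'_rho].
apply: bmeasB; last exact: bmeas_cst.
split; first exact: lipschitz_measurable (lh t) mz.
by eexists => a; exact: hB.
Qed.

Lemma bmeas_round_excess (dT : measure_display) (Theta : measurableType dT)
    (z s : Theta -> 'rV[R]_d) t : mvec z -> mvec s -> (forall a, l2norm (z a) <= rho) ->
  bmeas (fun a => round_excess t (z a) (s a)).
Proof.
move=> mz ms zr; have [b1 [b2 b3]] := bmeas_parts t mz ms zr.
apply: bmeasB => //; apply: bmeasD => //; apply: bmeasM => //; exact: bmeas_cst.
Qed.

Lemma mean_round_excess t (z : 'rV[R]_d) : (t < T)%N -> l2norm z <= rho ->
  mean law (fun s => round_excess t z (rowv s)) <= kappa * (900 * (G ^+ 2 * d%:R)) + 8 * (G * mu).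
Proof.
move=> tT zr.
have mz : mvec (fun _ : V => z) by exact: mvec_cst.
have ms : mvec (fun s : V => rowv s).
  by move=> i; under eq_fun do rewrite mxE; exact: measurable_tnth.
have [b1 [b2 b3]] := bmeas_parts t mz ms (fun=> zr).
have zmu : l2norm z + mu <= 1 by apply: le_trans rho_mu; rewrite lerD2r.
have V1 := sphere_estimate_second_moment G0 (cf tT) (lf tT) (fun x => @hf t x tT) (hB t) (lh t) mu0 zmu.
have Xu' : X (u' t) by exact: le_trans (u'_rho t) rho1.
have V2 := sphere_estimate_bias G0 (cf tT) (lf tT) (fun x => @hf t x tT) (hB t) (lh t) mu0 zmu Xu'.
rewrite /round_excess meanB//; last first.
  by apply: bmeasD => //; apply: bmeasM => //; exact: bmeas_cst.
rewrite mean_shift; last by apply: bmeasM => //; exact: bmeas_cst.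
rewrite meanZ// !hf//; last exact: le_trans zr rho1.
have := ler_wpM2l kappa0 V1; move: V2; set a := mean _ _; set b := mean _ _; lra.
Qed.

Context {dO : measure_display} {Omega : measurableType dO} (P : probability Omega R).
Variable s : nat -> Omega -> V.
Hypothesis ms : forall t, measurable_fun [set: Omega] (s t).
Hypothesis inds : mutually_independent P T s.
Hypothesis laws : forall t, (t < T)%N -> forall B, measurable B -> P (s t @^-1` B) = law B.

(** The point [y v t] depends on the earlier draws only, so it is left unchanged when draw [t] is
    resampled, and [mean_round_excess] applies at that fixed point. *)
Lemma mean_excess t : (t < T)%N ->
  mean P (fun w => round_excess t (y (samples T s w) t) (S (samples T s w) t)) <=
  kappa * (900 * (G ^+ 2 * d%:R)) + 8 * (G * mu).
Proof.
move=> tT; pose i := Ordinal tT.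
apply: (mean_samples_le (Q := law) (i := i) (F := fun v => round_excess t (y v t) (S v t)) ms inds laws).
  exact: bmeas_round_excess.
move=> v.
have eqS j a : (j < t)%N -> S (upd v i a) j = S v j.
  move=> jt; rewrite /S; case: insubP => [k _ ek|//]; rewrite tnth_mktuple.
  by rewrite (_ : k == i = false)//; apply/eqP => ki; move: jt; rewrite -ek ki ltnn.
have eqy a : y (upd v i a) t = y v t.
  rewrite /y /run (@eq_pbmd_run _ _ _ _ _ _ _ _ h (S (upd v i a)) (S v) t)// => j jt.
  exact: eqS.
apply: le_trans (mean_round_excess tT (y_rho v t)).
rewrite le_eqVlt; apply/orP; left; apply/eqP; apply: eq_mean => a.
by rewrite eqy /S insubT /= tnth_mktuple (_ : _ == i).
Qed.

(** On this event a query may leave the unit ball, where the original and the modified loss can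
    differ. *)
Let null_round t := [set w : Omega | l1n (s t w) != 1].

Let measurable_null_round t : measurable (null_round t).
Proof.
have ml : measurable_fun [set: Omega] (fun w => l1n (s t w)) by exact: measurable_l1n.
rewrite (_ : null_round t = ~` ((fun w => l1n (s t w)) @^-1` [set 1])).
  by apply: measurableC; rewrite -[X in measurable X]setTI; exact: ml.
by apply/seteqP; split=> w /= /eqP.
Qed.

Let null_round0 t : (t < T)%N -> P (null_round t) = 0%E.
Proof.
move=> tT; have mA : measurable [set v : V | l1n v != 1].
  rewrite (_ : [set v | _] = ~` (@l1n R d @^-1` [set 1])).
    apply: measurableC; rewrite -[X in measurable X]setTI.
    by apply: measurable_l1n => //; exact: measurable_set1.
  by apply/seteqP; split=> v /= /eqP.
transitivity (law [set v : V | l1n v != 1]); first exact: laws tT _ mA.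
change (iid (lap R) d (@nrm R d @^-1` [set v : V | l1n v != 1]) = 0%E).
apply: (@subset_measure0 _ _ _ (iid (lap R) d) _ [set w : V | tnth w ord0 = 0]).
- by rewrite -[X in measurable X]setTI; exact: (@measurable_nrmT R d).
- exact: measurable_tnth_eq0.
- move=> w /=; have [//|w0] := eqVneq (tnth w ord0) 0.
  by rewrite (l1n_nrm w0) eqxx.
exact: iid_lap_tnth_eq0.
Qed.

Let null_set := \bigcup_(t in `I_T) null_round t.

Let measurable_null_set : measurable null_set.
Proof. exact: bigcup_measurable. Qed.

Let null_set0 : P null_set = 0%E.
Proof.
apply/eqP; rewrite -measure_le0 /null_set bigcup_mkord.
apply: (le_trans (Boole_inequality P _)) => //.
by rewrite big1// => t _; exact: null_round0.
Qed.

Variable k : 'I_N.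
Hypothesis kappaE : kappa = 8 * gamma + eta k / 2.

(** Off the null set all queries stay in the ball, so both families of losses produce the same run.
    Lipschitz continuity replaces the queries by [y] and [u] by [u'], at the cost
    [G * (mu + (1 - rho))] per round; the regrets of exponential weights and of expert [k] then add
    up. *)
Let regret_le w : ~ null_set w ->
  pbmd_regret half_sq (l2ball rho) mu gamma N eta y1 f (fun t => rowv (s t w)) T u <=
  ln (k.+1 * k.+2)%N%:R / gamma + 2 * (1 + path_length T u) / eta k +
  T%:R * (G * (mu + (1 - rho))) +
  \sum_(t < T) round_excess t (y (samples T s w) t) (S (samples T s w) t).
Proof.
move=> Nw; set v := samples T s w.
have Sv t : (t < T)%N -> S v t = rowv (s t w).
  by move=> tT; rewrite /S insubT /= tnth_mktuple.
have sv1 t : (t < T)%N -> l2norm (mu *: S v t) <= mu.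
  move=> tT; rewrite Sv// l2normZ gtr0_norm// -[leRHS]mulr1 ler_pM2l//.
  apply: (le_trans (l2norm_rowv_le _)).
  have [->//|l1] := eqVneq (l1n (s t w)) 1.
  by exfalso; apply: Nw; exists t.
have Xy t : X (y v t) by exact: le_trans (y_rho v t) rho1.
have Xp t : (t < T)%N -> X (y v t + mu *: S v t).
  move=> tT; apply: (le_trans (l2normD _ _)); apply: le_trans rho_mu.
  exact: lerD (y_rho v t) (sv1 t tT).
have Xm t : (t < T)%N -> X (y v t - mu *: S v t).
  move=> tT; apply: (le_trans (l2normB _ _)); apply: le_trans rho_mu.
  exact: lerD (y_rho v t) (sv1 t tT).
have runE t : (t < T)%N ->
    pbmd_run half_sq (l2ball rho) mu gamma N eta y1 f (fun t => rowv (s t w)) t = run v t.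
  move=> tT; rewrite (@eq_pbmd_run _ _ _ _ _ _ _ _ f _ (S v)) => [|i it]; last first.
    by rewrite Sv// (ltn_trans it).
  apply: eq_pbmd_run_losses => i it; have iT := ltn_trans it tT.
  by rewrite /pbmd_estimate -/(run v i) -/(y v i) !hf//; [exact: Xm|exact: Xp].
have step (t : 'I_T) : (f t (pbmd_plus half_sq (l2ball rho) mu gamma N eta y1 f (fun t => rowv (s t w)) t) +
    f t (pbmd_minus half_sq (l2ball rho) mu gamma N eta y1 f (fun t => rowv (s t w)) t)) / 2 -
    f t (u t) <= (h t (y v t) - h t (u' t)) + G * (mu + (1 - rho)).
  have tT := ltn_ord t.
  rewrite /pbmd_plus /pbmd_minus runE// -Sv// -/(y v t).
  have Xu' : X (u' t) by exact: le_trans (u'_rho t) rho1.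
  rewrite !hf//.
  have := lf tT (Xp t tT) (Xy t); have := lf tT (Xm t tT) (Xy t); have := lf tT Xu' (Xu tT).
  rewrite (_ : y v t + mu *: S v t - y v t = mu *: S v t); last by rewrite addrC addKr.
  rewrite (_ : y v t - mu *: S v t - y v t = - (mu *: S v t)); last by rewrite addrC addKr.
  have -> : l2norm (u' t - u t) = (1 - rho) * l2norm (u t).
    rewrite l2norm_distC /u' tT -[X in l2norm (X - _)]scale1r -scalerBl l2normZ.
    by rewrite ger0_norm ?subr_ge0.
  rewrite l2normN => h1 h2 h3.
  have h4 : G * ((1 - rho) * l2norm (u t)) <= G * (1 - rho).
    by rewrite ler_pM2l// -[leRHS]mulr1 ler_wpM2l ?subr_ge0//; exact: Xu tT.
  have h5 : G * l2norm (mu *: S v t) <= G * mu by rewrite ler_pM2l// sv1.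
  move: h1 h2 h3; rewrite !ler_norml => /andP[_ h1] /andP[_ h2] /andP[_ h3].
  move: h1 h2 h3 h4 h5; set a := f _ _; set b := f _ _; set c := f _ _; set e := f _ _.
  set q := f _ _; lra.
apply: (le_trans (ler_sum _ (fun t _ => step t))).
rewrite big_split /= sumr_const card_ord -[X in _ + X]mulr_natl.
rewrite addrAC lerD2r.
have H := hedge_regret mu h (S v) rho0 rho1 gamma0 eta0 y1r T k.
have E := expert_regret mu gamma h (S v) rho0 rho1 eta0 y1r u'_rho T k.
rewrite -/(run v) in H E.
set Sg := \sum_(t < T) l2norm _ ^+ 2 in H E.
have HE : \sum_(t < T) dot (g v t) (y v t - u' t) <=
    ln (k.+1 * k.+2)%N%:R / gamma + 2 * (1 + path_length T u) / eta k + kappa * Sg.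
  rewrite (eq_bigr (fun t : 'I_T => dot (g v t) (y v t - (run v t).2 k) +
      dot (g v t) ((run v t).2 k - u' t))) => [|t _]; last first.
    by rewrite -dotDr addrA subrK.
  rewrite big_split /= kappaE.
  have P1 : 2 * (1 + path_length T u') / eta k <= 2 * (1 + path_length T u) / eta k.
    by rewrite ler_pM2r ?invr_gt0// ler_pM2l// lerD2l path_length_shrink.
  rewrite [(_ + _) * Sg]mulrDl.
  by apply: (le_trans (lerD H E)); move: P1; set a := _ / eta k; set b := _ / eta k; lra.
rewrite /round_excess !sumrB !big_split /= -mulr_sumr -/Sg.
rewrite -/(y v) -/(g v).
move: HE; rewrite sumrN /g; set a := \sum_(t < T) dot _ _.
by set b := _ / gamma; set c := _ / eta k; lra.
Qed.

(** The expert [k] is free and enters the analysis only, so it can be chosen after the comparators.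
    In [9 * mu], one [mu] comes from the queries and 8 from the bias of the estimator. *)
Theorem expected_regret_bound :
  (\int[P]_w (pbmd_regret half_sq (l2ball rho) mu gamma N eta y1 f (fun t => rowv (s t w)) T u)%:E
   <= (ln (k.+1 * k.+2)%N%:R / gamma + 2 * (1 + path_length T u) / eta k +
       T%:R * (G * (9 * mu + (1 - rho))) + kappa * (900 * (G ^+ 2 * d%:R)) * T%:R)%:E)%E.
Proof.
pose c := ln (k.+1 * k.+2)%N%:R / gamma + 2 * (1 + path_length T u) / eta k +
  T%:R * (G * (mu + (1 - rho))).
pose Psi (t : nat) (w : Omega) := round_excess t (y (samples T s w) t) (S (samples T s w) t).
have bPsi t : bmeas (Psi t).
  apply: (bmeas_comp (f := fun v => round_excess t (y v t) (S v t))).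
    exact: bmeas_round_excess.
  exact: measurable_samples.
have bsum : bmeas (fun w => \sum_(t < T) Psi t w) by exact: bmeas_sum.
apply: (le_trans (integral_le_mean_ae measurable_null_set null_set0
  (g := fun w => c + \sum_(t < T) Psi t w) _ _)).
- by apply: bmeasD => //; exact: bmeas_cst.
- exact: regret_le.
rewrite lee_fin meanD//; last exact: bmeas_cst.
rewrite mean_cst mean_sum//.
have : \sum_(t < T) mean P (Psi t) <= \sum_(t < T) (kappa * (900 * (G ^+ 2 * d%:R)) + 8 * (G * mu)).
  by apply: ler_sum => t _; exact: mean_excess.
rewrite sumr_const card_ord -[X in _ <= X]mulr_natl /c.
set a := \sum_(t < T) _; set b := _ / gamma; set e := _ / eta k; set q := kappa * _; lra.
Qed.

End ExpectedRegret.

(** * Tuning of the parameters *)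

Section Constants.
Context {R : realType}.

(** Here [B] is [G * sqrt (d T)], [q] the square root of one plus the path length, [p] the power of
    two of the chosen expert, [e] the smallest step size and [H] the bias. The five terms contribute
    at most 42, 36, 10, 7200 and 450 units [A * (B * q)]. *)
Lemma tuned_regret_le (A B q p e gamma l H : R) : 1 <= A -> 0 < B -> 1 <= q -> 0 < p -> p <= q ->
  q <= 2 * A * p -> 0 < e -> e * B <= A -> 1 <= 9 * (e * B) ->
  0 < gamma -> gamma * B <= 1 -> gamma^-1 <= 21 * A * B -> 0 <= l -> l <= 2 * q ->
  H <= 10 * A * B ->
  l / gamma + 2 * q ^+ 2 / (p * e) + H + (8 * gamma + p * e / 2) * 900 * B ^+ 2 <=
  8000 * A * (B * q).
Proof.
move=> A1 B0 q1 p0 pq qp e0 eB1 eB9 g0 gB gi l0 lq HB.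
have A0 : 0 < A by exact: lt_le_trans A1.
have q0 : 0 < q by exact: lt_le_trans q1.
have AB0 : 0 < A * B by rewrite mulr_gt0.
have ABq : A * B <= A * (B * q) by rewrite ler_pM2l// ler_peMr// ltW.
have Bq : B <= A * (B * q) by apply: le_trans ABq; rewrite ler_peMl// ltW.
have t1 : l / gamma <= 42 * (A * (B * q)).
  apply: (@le_trans _ _ (2 * q * (21 * A * B))); last by rewrite le_eqVlt; apply/orP; left; apply/eqP; ring.
  by apply: ler_pM => //; rewrite invr_ge0 ltW.
have t2 : 2 * q ^+ 2 / (p * e) <= 36 * (A * (B * q)).
  rewrite ler_pdivrMr ?mulr_gt0//.
  have h1 : q * 1 <= (2 * A * p) * (9 * (e * B)) by apply: ler_pM => //; exact: ltW.
  have h2 := ler_wpM2l (ltW q0) h1.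
  by apply: (@le_trans _ _ (2 * (q * (2 * A * p * (9 * (e * B)))))); [rewrite expr2; lra|
    rewrite le_eqVlt; apply/orP; left; apply/eqP; ring].
have t3 : H <= 10 * (A * (B * q)) by lra.
have t4 : 8 * gamma * 900 * B ^+ 2 <= 7200 * (A * (B * q)).
  have h : gamma * B * B <= 1 * B by rewrite ler_pM2r.
  rewrite (_ : 8 * gamma * 900 * B ^+ 2 = 7200 * (gamma * B * B)); [lra|ring].
have t5 : p * e / 2 * 900 * B ^+ 2 <= 450 * (A * (B * q)).
  have h : p * (e * B) <= q * A by apply: ler_pM => //; rewrite ?mulr_ge0 ?ltW.
  have h2 := ler_wpM2r (ltW B0) h.
  rewrite (_ : p * e / 2 * 900 * B ^+ 2 = 450 * (p * (e * B) * B)); last by field.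
  rewrite (_ : A * (B * q) = q * A * B); last by ring.
  by move: h2; set x := p * (e * B) * B; set z := q * A * B; lra.
have AB : 0 < A * (B * q) by rewrite !mulr_gt0.
rewrite [(8 * gamma + _) * 900]mulrDl mulrDl -[8000 * A * _]mulrA.
move: t1 t2 t3 t4 t5 AB; set a1 := l / gamma; set a2 := _ / (p * e).
set a3 := 8 * gamma * 900 * _; set a4 := p * e / 2 * 900 * _; set z := A * (B * q).
lra.
Qed.

(** The largest available power of two below [q]: it is within a factor 2 of [q] unless the grid is
    exhausted. *)
Lemma expert_choice (n : nat) (q : R) : 1 <= q ->
  exists2 k : 'I_n.+1, 2 ^+ k <= q & q <= 2 * 2 ^+ k \/ k = ord_max.
Proof.
move=> q1; elim: n => [|n [k kq hk]].
  by exists ord0; [rewrite expr0|right; apply: val_inj].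
have [h|h] := leP q (2 * 2 ^+ k); first by exists (widen_ord (leqnSn _) k) => //; left.
case: hk => [hk|ek]; first by move: h; rewrite ltNge hk.
exists ord_max; last by right.
by rewrite /= exprS; move: h; rewrite ek /= => /ltW.
Qed.

(** The price of competing with expert [k] is at most of the order of its own power of two, so it is
    dominated by [q] and leaves no logarithm in the final rate. *)
Lemma ln_succ_le (k : nat) : ln (k.+1 * k.+2)%N%:R <= 2 * 2 ^+ k :> R.
Proof.
have lnS (j : nat) : ln j.+1%:R <= j%:R :> R.
  by rewrite -natr1 addrC le_ln1Dx// (lt_le_trans _ (ler0n _ _)).
have kk : k.+1%:R <= 2 ^+ k :> R by rewrite -natrX ler_nat ltn_expl.
rewrite natrM lnM ?posrE//.
apply: (@le_trans _ _ (k%:R + k.+1%:R)); first exact: lerD.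
by rewrite mulr2n mulrDl mul1r lerD// (le_trans _ kk)// ler_nat.
Qed.

Lemma le_sqrt_bounds : 1 <= Num.sqrt (2 : R) <= 2 /\ 1 <= Num.sqrt (48 : R) <= 7.
Proof.
have s1 : Num.sqrt 1 = 1 :> R by exact: sqrtr1.
have sq (a b : R) : 0 <= b -> a <= b ^+ 2 -> Num.sqrt a <= b.
  by move=> b0 ab; rewrite -[leRHS]ger0_norm// -sqrtr_sqr ler_wsqrtr.
split; apply/andP; split.
- by rewrite -{1}s1; apply: ler_wsqrtr; lra.
- by apply: sq => //; rewrite expr2; lra.
- by rewrite -{1}s1; apply: ler_wsqrtr; lra.
- by apply: sq => //; rewrite expr2; lra.
Qed.

(** The constant [c = 6 * (1 + sqrt 2) ^+ 2] satisfies [(e * B) ^+ 2 = A / c], and the crude bracket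
    [1 <= c <= 81] is enough; 9 is the square root of 81. *)
Lemma mirror_step_size (A B : R) : 1 <= A -> 0 < B ->
  let e := Num.sqrt (A / (6 * (1 + Num.sqrt 2) ^+ 2 * B ^+ 2)) in
  [/\ 0 < e, e * B <= A & 1 <= 9 * (e * B)].
Proof.
move=> A1 B0 e; have [/andP[s1 s2] _] := le_sqrt_bounds.
pose c : R := 6 * (1 + Num.sqrt 2) ^+ 2.
have eE : e = Num.sqrt (A / (c * B ^+ 2)) by [].
have c1 : 1 <= c by rewrite /c; nra.
have c81 : c <= 81 by rewrite /c; nra.
have A0 : 0 < A by exact: lt_le_trans A1.
have c0 : 0 < c by exact: lt_le_trans c1.
have x0 : 0 < A / (c * B ^+ 2) by rewrite divr_gt0// mulr_gt0// exprn_gt0.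
have e0 : 0 < e by rewrite eE sqrtr_gt0.
have eB : (e * B) ^+ 2 * c = A.
  by rewrite eE exprMn sqr_sqrtr ?(ltW x0)//; field; rewrite !gt_eqF.
have eB0 : 0 < e * B by rewrite mulr_gt0.
split=> //.
  rewrite -(@ler_pXn2r _ 2)// ?nnegrE ?(ltW eB0) ?(ltW A0)//.
  apply: (@le_trans _ _ A); last by rewrite expr2 ler_peMr// ltW.
  by rewrite -[leRHS]eB ler_peMr// sqr_ge0.
rewrite -(@ler_pXn2r _ 2)// ?nnegrE ?mulr_ge0 ?(ltW e0) ?(ltW B0)//.
rewrite expr1n exprMn; apply: (le_trans A1); rewrite -eB mulrC.
by apply: ler_wpM2r; rewrite ?sqr_ge0//; lra.
Qed.

Lemma sup_inf_le (E : set R) (x M m : R) : E x -> (forall y, E y -> m <= y <= M) ->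
  0 <= sup E - inf E.
Proof.
move=> Ex EM; rewrite subr_ge0; apply: (@le_trans _ _ x).
  by apply: inf_lbound => //; exists m => y /EM /andP[].
by apply: sup_upper_bound => //; split; [exists x|exists M => y /EM /andP[]].
Qed.

Lemma ceil_log2 (x : R) (n : nat) : 1 <= x ->
  n = `|Num.ceil (2^-1 * (ln x / ln 2))|%N -> x <= (2 ^+ n) ^+ 2.
Proof.
move=> x1 ->; have x0 : 0 < x by exact: lt_le_trans x1.
have l2 : 0 < ln 2 :> R by rewrite ln_gt0// ltr1n.
have lx : 0 <= ln x by exact: ln_ge0.
set z := 2^-1 * _; have z0 : 0 <= z by rewrite mulr_ge0 ?divr_ge0 ?(ltW l2).
set j := `|_|%N; have zn : z <= j%:R.
  (* The ceiling is nonnegative, so the absolute value that makes it a natural number changes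
     nothing. *)
  have c0 : 0 <= Num.ceil z by rewrite -(ler_int R) (le_trans z0)// ceil_ge.
  by apply: (le_trans (ceil_ge z)); rewrite /j pmulrn gez0_abs.
have : ln x <= 2 * (j%:R * ln 2).
  have -> : ln x = 2 * (z * ln 2) by rewrite /z; field; rewrite gt_eqF.
  by rewrite ler_pM2l// ler_pM2r.
rewrite -ler_expR lnK ?posrE// => h; apply: (le_trans h).
rewrite -exprM mulnC exprM expRM_natl expRM_natl lnK ?posrE//.
by rewrite -!exprM mulnC.
Qed.

End Constants.
Theorem corollary3p1 (R : realType) (A : R) :
  exists C : R,
  forall (d T : nat) (r Rad G : R)
    (f : nat -> 'rV[R]_d -> R) (u : nat -> 'rV[R]_d) (y1 : 'rV[R]_d)
    (dO : measure_display) (Omega : measurableType dO) (P : probability Omega R)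
    (s : nat -> {RV P >-> d.-tuple R}),
  let X : set 'rV[R]_d := [set x | l2norm x <= 1] in
  let psi (x : 'rV[R]_d) : R := l2norm x ^+ 2 / 2 in
  let lambda : R := 1 in
  let c_mu : R := 1 + 2 * zeta2 d + Rad / r in
  let mu : R :=
    Num.min (Rad * Num.sqrt d%:R / (Num.sqrt (lambda * T%:R) * c_mu)) (r / 2) in
  let alpha : R := mu / r in
  let Xa : set 'rV[R]_d := shrink alpha X in
  let Gpsi : R := sup [set l2norm (gradient psi y) | y in Xa] in
  let Fpsi : R := sup [set psi x | x in Xa] - inf [set psi x | x in Xa] in
  let gamma : R :=
    (Num.sqrt 48 * (1 + Num.sqrt 2) * Rad * G * Num.sqrt (d * T)%:R)^-1 in
  let N : nat :=
    (`|Num.ceil (2^-1 * (ln (1 + 2 * Rad * Gpsi * T%:R / A) / ln 2))|%N).+1 in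
  let eta (k : nat) : R :=
    2 ^+ k * Num.sqrt (A / (6 * (1 + Num.sqrt 2) ^+ 2 * G ^+ 2 * (d * T)%:R / lambda)) in
  let draws (w : Omega) (t : nat) : 'rV[R]_d := \row_i tnth (s t w) i in
  (3 <= d)%N -> (1 <= T)%N -> 0 < r -> 0 < Rad -> 0 < G ->
  l2ball r `<=` X -> X `<=` l2ball Rad ->
  Xa y1 ->
  Fpsi + sup [set bregman psi v y1 | v in Xa] + Num.max 1 lambda * Rad ^+ 2 <= A ->
  (forall t, (t < T)%N -> convex_function [set: 'rV[R]_d] (f t)) ->
  (forall t, (t < T)%N -> forall x y, X x -> X y ->
     `|f t x - f t y| <= G * l2norm (x - y)) ->
  (forall t, (t < T)%N -> X (u t)) ->
  (forall t, (t < T)%N -> forall B : set (d.-tuple R), measurable B ->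
     distribution P (s t) B = uniform_l1_sphere B) ->
  mutually_independent P T (fun t => s t : Omega -> d.-tuple R) ->
  ('E_P[fun w => pbmd_regret psi Xa mu gamma N eta y1 f (draws w) T u] <=
   (C * (G * Num.sqrt (d%:R * T%:R * (1 + path_length T u))))%:E)%E.
Proof.
exists (8000 * A).
move=> [|m] T r Rad G f u y1 dO Omega P s X psi lambda c_mu mu alpha Xa Gpsi Fpsi gamma N eta draws.
  by [].
move=> d3 T1 r0 Rad0 G0 rX XRad Xy1 hA cf lf Xu laws inds.
have d0 : 0 < m.+1%:R :> R by [].
have T0 : 0 < T%:R :> R by rewrite ltr0n.
(* A unit vector: through the two inclusions it forces [r <= 1 <= Rad]. *)
pose e1 : 'rV[R]_m.+1 := delta_mx 0 ord0.
have e1n : l2norm e1 = 1 by exact: l2norm_delta.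
have Rad1 : 1 <= Rad by have := XRad e1; rewrite /X /l2ball /= e1n; apply.
have r1 : r <= 1.
  have := rX (r *: e1); rewrite /X /l2ball /= l2normZ e1n mulr1 gtr0_norm//; exact.
have z0 : 0 <= @zeta2 R m.+1.
  by rewrite /zeta2; case: ifP => _; rewrite divr_ge0 ?mulr_ge0 ?sqrtr_ge0 ?expR_ge0 ?ln_ge0 ?ler1n.
have z2 : 0 <= 2 * @zeta2 R m.+1 by exact: mulr_ge0.
have c1 : 1 <= c_mu by rewrite /c_mu -addrA lerDl addr_ge0// divr_ge0// ltW.
have cR : Rad / r <= c_mu by rewrite /c_mu lerDr addr_ge0.
have cmu0 : 0 < c_mu by exact: lt_le_trans c1.
pose D : R := Num.sqrt m.+1%:R; pose Q : R := Num.sqrt T%:R.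
have D0 : 0 < D by rewrite sqrtr_gt0.
have Q0 : 0 < Q by rewrite sqrtr_gt0.
have QQ : Q * Q = T%:R by rewrite -expr2 sqr_sqrtr// ltW.
have DD : D * D = m.+1%:R by rewrite -expr2 sqr_sqrtr// ltW.
have muE : mu = Num.min (Rad * D / (Q * c_mu)) (r / 2) by rewrite /mu /lambda mul1r.
have mu0 : 0 < mu.
  by rewrite muE lt_min divr_gt0 ?mulr_gt0//= divr_gt0.
have mu_r : mu <= r / 2 by rewrite muE ge_min lexx orbT.
have mu_D : mu * (Q * c_mu) <= Rad * D.
  by rewrite -ler_pdivlMr ?mulr_gt0// muE ge_min lexx.
have a0 : 0 < alpha by rewrite divr_gt0.
have a2 : alpha <= 2^-1 by rewrite /alpha ler_pdivrMr// mulrC.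
have mua : mu <= alpha by rewrite /alpha ler_pdivlMr// ler_piMr// ltW.
pose rho : R := 1 - alpha.
have rho_half : 2^-1 <= rho by rewrite /rho; lra.
have rho0 : 0 < rho by lra.
have rho1 : rho <= 1 by rewrite /rho; lra.
have rho_mu : rho + mu <= 1 by rewrite /rho; lra.
have XaE : Xa = l2ball rho by exact: shrink_l2ball.
have psi_le y : Xa y -> 0 <= psi y <= 1.
  rewrite XaE /l2ball /= => yr; have h := l2norm_ge0 y.
  by rewrite /psi divr_ge0 ?sqr_ge0//= ler_pdivrMr//; nra.
have F0 : 0 <= Fpsi.
  by apply: (@sup_inf_le _ _ (psi y1) 1 0); [exists y1|move=> _ [y /psi_le ? <-]].
have B0 : 0 <= sup [set bregman psi v y1 | v in Xa].
  have bE v : bregman psi v y1 = l2norm (v - y1) ^+ 2 / 2 by exact: bregman_half_sq.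
  apply: (@le_trans _ _ (bregman psi y1 y1)).
    by rewrite bE divr_ge0 ?sqr_ge0.
  apply: sup_upper_bound; last by exists y1.
  split; first by exists (bregman psi y1 y1), y1.
  exists 2 => _ [v + <-]; rewrite bE XaE /l2ball /= => vr.
  have y1r : l2norm y1 <= rho by move: Xy1; rewrite XaE.
  have := l2normB v y1; have := l2norm_ge0 (v - y1) => h1 h2.
  by rewrite ler_pdivrMr//; nra.
(* The other two terms below [A] are nonnegative. This yields [1 <= A] and [Rad <= A], through which
   [Rad] and the numerical constants are absorbed in [C]. *)
have RA : Rad ^+ 2 <= A.
  by apply: le_trans hA; rewrite /lambda maxxx mul1r lerDr addr_ge0.
have A1 : 1 <= A by apply: le_trans RA; rewrite expr_ge1 ?(ltW Rad0).
have RadA : Rad <= A by apply: le_trans RA; rewrite expr2 ler_peMr ?(ltW Rad0).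
(* The gradient of [psi] is the identity and [rho >= 1/2]; this bounds the number of experts from
   below. *)
have Gpsi_half : 2^-1 <= Gpsi.
  apply: (le_trans rho_half); apply: sup_upper_bound; last first.
    exists (rho *: e1); first by rewrite XaE /l2ball /= l2normZ e1n mulr1 gtr0_norm.
    by rewrite [gradient _ _]gradient_half_sq l2normZ e1n mulr1 gtr0_norm.
  split; first by exists (l2norm (gradient psi y1)), y1.
  by exists rho => _ [y + <-]; rewrite XaE [gradient _ _]gradient_half_sq.
have y1r : l2norm y1 <= rho by move: Xy1; rewrite XaE.
pose B : R := G * (D * Q).
have BB0 : 0 < B by rewrite !mulr_gt0.
have dT : Num.sqrt (m.+1 * T)%:R = D * Q :> R by rewrite natrM sqrtrM ?ler0n.
have [/andP[s1 s2] [/andP[s3 s4]]] := @le_sqrt_bounds R.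
pose kg : R := Num.sqrt 48 * (1 + Num.sqrt 2) * Rad.
have kg1 : 1 <= kg by rewrite /kg !mulr_ege1// lerDl sqrtr_ge0.
have kgA : kg <= 21 * A.
  apply: ler_pM RadA; rewrite ?mulr_ge0 ?(ltW Rad0) ?sqrtr_ge0 ?addr_ge0 ?sqrtr_ge0//.
  rewrite (_ : 21 = 7 * 3 :> R); last by rewrite -natrM.
  by apply: ler_pM; rewrite ?sqrtr_ge0 ?addr_ge0 ?sqrtr_ge0//; lra.
have gE : gamma = (kg * B)^-1 by rewrite /gamma dT /kg /B !mulrA.
have kg0 : 0 < kg by exact: lt_le_trans kg1.
have g0 : 0 < gamma by rewrite gE invr_gt0 mulr_gt0.
have gB : gamma * B <= 1.
  by rewrite gE mulrC ler_pdivrMr ?mulr_gt0// mul1r ler_peMl// ltW.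
have gi : gamma^-1 <= 21 * A * B by rewrite gE invrK ler_pM2r.
pose e : R := Num.sqrt (A / (6 * (1 + Num.sqrt 2) ^+ 2 * B ^+ 2)).
have [e0 eB eB9] : [/\ 0 < e, e * B <= A & 1 <= 9 * (e * B)] := mirror_step_size A1 BB0.
have etaE k : eta k = 2 ^+ k * e.
  rewrite /eta /e /lambda divr1 /B; congr (_ * Num.sqrt (_ / _)).
  by rewrite exprMn exprMn !expr2 DD QQ natrM; ring.
clearbody e.
have eta0 k : 0 < eta k by rewrite etaE mulr_gt0// exprn_gt0.
pose Pu := path_length T u.
have P0 : 0 <= Pu by apply: sumr_ge0 => t _; exact: l2norm_ge0.
have PT : 1 + Pu <= 2 * T%:R.
  have h : Pu <= \sum_(t < T.-1) 2.
    apply: ler_sum => t _; have tT : (t.+1 < T)%N by rewrite -ltn_predRL.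
    apply: (le_trans (l2normB _ _)); rewrite -[2]/(1 + 1); apply: lerD; first exact: Xu.
    by apply: Xu; exact: ltnW.
  move: h; rewrite sumr_const card_ord -[X in _ <= X]mulr_natl.
  by rewrite -{2}(prednK T1) -natr1; lra.
pose q : R := Num.sqrt (1 + Pu).
have qq : q ^+ 2 = 1 + Pu by rewrite sqr_sqrtr// addr_ge0.
have q1 : 1 <= q by rewrite -{1}(@sqrtr1 R) ler_wsqrtr// lerDl.
case En : N => [//|n].
(* The grid of step sizes is long enough: [2 * Rad * Gpsi >= 1], so [T / A] is below the argument of
   the logarithm. *)
have TA : T%:R <= A * (2 ^+ n) ^+ 2.
  have x1 : 1 <= 1 + 2 * Rad * Gpsi * T%:R / A.
    rewrite lerDl divr_ge0//; last exact: le_trans A1.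
    by rewrite mulr_ge0 ?(ltW T0)// mulr_ge0 ?(le_trans _ Gpsi_half)// mulr_ge0 ?(ltW Rad0).
  have nE : n = `|Num.ceil (2^-1 * (ln (1 + 2 * Rad * Gpsi * T%:R / A) / ln 2))|%N.
    by case: En.
  have A0 : 0 < A by exact: lt_le_trans A1.
  rewrite mulrC -ler_pdivrMr//; apply: le_trans (ceil_log2 x1 nE).
  apply: (@le_trans _ _ (2 * Rad * Gpsi * T%:R / A)); last by rewrite lerDr.
  rewrite ler_pM2r ?invr_gt0// ler_peMl ?(ltW T0)//.
  rewrite mulrAC mulr_ege1//; have := Gpsi_half; lra.
have [k kq hk] := expert_choice n q1.
have p0 : 0 < 2 ^+ k :> R by rewrite exprn_gt0.
have qp : q <= 2 * A * 2 ^+ k.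
  case: hk => [hk|hk].
    by apply: (le_trans hk); rewrite ler_pM2r// ler_peMr.
  (* For the last expert, [q ^+ 2 <= 2 * T] because the path length is at most [2 * (T - 1)], and
     [TA] bounds [T]. *)
  rewrite -(@ler_pXn2r _ 2)// ?nnegrE ?sqrtr_ge0 ?mulr_ge0 ?(ltW p0)//; [|lra].
  rewrite qq hk /=; apply: (le_trans PT).
  apply: (@le_trans _ _ (2 * (A * (2 ^+ n) ^+ 2))); first by rewrite ler_pM2l.
  rewrite !exprMn mulrA ler_pM2r ?exprn_gt0//; nra.
(* Both [mu] and [alpha] are of order [sqrt (d / T)]: the first by its definition and [1 <= c_mu],
   the second because [Rad / r <= c_mu] absorbs the division by [r]. *)
have HT : T%:R * (G * (9 * mu + (1 - rho))) <= 10 * A * B.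
  have h1 : mu * Q <= A * D.
    apply: (@le_trans _ _ (Rad * D)); last by rewrite ler_pM2r.
    by apply: le_trans mu_D; rewrite mulrA ler_peMr// mulr_ge0 ?ltW.
  have h2 : alpha * Q <= A * D.
    apply: (@le_trans _ _ D); last by rewrite ler_peMl// ltW.
    rewrite -(ler_pM2l Rad0); apply: le_trans mu_D.
    rewrite (_ : Rad * (alpha * Q) = mu * Q * (Rad / r)); last by rewrite /alpha; field; rewrite gt_eqF.
    by rewrite [leRHS]mulrA ler_wpM2l// mulr_ge0 ?ltW.
  have h3 : G * Q * (9 * (mu * Q) + alpha * Q) <= G * Q * (10 * (A * D)).
    by rewrite ler_pM2l ?mulr_gt0//; move: h1 h2; set x := mu * Q; set z := alpha * Q; lra.
  rewrite /rho subKr -QQ (_ : Q * Q * _ = G * Q * (9 * (mu * Q) + alpha * Q)); last by ring.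
  by apply: (le_trans h3); rewrite le_eqVlt; apply/orP; left; apply/eqP; rewrite /B; ring.
have mg t : measurable_fun [set: Omega] (s t) by [].
have law_s t : (t < T)%N -> forall C, measurable C -> P (s t @^-1` C) = sphere_law m.+1 C.
  by move=> tT C mC; rewrite -uniform_l1_sphereE//; exact: laws tT C mC.
pose kappa : R := 8 * gamma + eta k / 2.
have kappa0 : 0 <= kappa by rewrite addr_ge0 ?mulr_ge0 ?(ltW g0) ?divr_ge0 ?(ltW (eta0 _)).
have main := expected_regret_bound rho0 mu0 rho_mu g0 eta0 y1r G0
  (fun t tT => convex_function_convexf (cf t tT)) lf Xu kappa0 mg inds law_s (erefl : kappa = _).
rewrite expectation.unlock XaE.
apply: (le_trans main).
rewrite lee_fin.
have -> : G * Num.sqrt (m.+1%:R * T%:R * (1 + path_length T u)) = B * q.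
  rewrite sqrtrM; last by rewrite mulr_ge0 ?(ltW d0) ?(ltW T0).
  by rewrite sqrtrM ?(ltW d0)// -/D -/Q -/q mulrA.
have l0 : 0 <= ln (k.+1 * k.+2)%N%:R :> R by rewrite ln_ge0// ler1n muln_gt0.
have lq : ln (k.+1 * k.+2)%N%:R <= 2 * q.
  by apply: (le_trans (ln_succ_le k)); rewrite ler_pM2l.
have fin := tuned_regret_le A1 BB0 q1 p0 kq qp e0 eB eB9 g0 gB gi l0 lq HT.
apply: le_trans fin; rewrite le_eqVlt; apply/orP; left; apply/eqP.
have BB : B ^+ 2 = G ^+ 2 * (m.+1%:R * T%:R) by rewrite /B !exprMn !expr2 DD QQ.
rewrite /kappa etaE -/Pu -qq BB; congr (_ + _); ring.
Qed.
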